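(* Let $(M^{4n+3},\phi_\alpha,\xi_\alpha,\eta_\alpha,g)$, $\alpha\in\{1,2,3\}$, be a $3$-quasi-Sasakian manifold of dimension $4n+3$ and rank $4l+3$, and let $m=n-l$. Then, for each $\beta,\gamma\in\{1,2,3\}$, $(\eta_\beta,\Theta_\gamma)$ is a contact-symplectic pair of type $(2l+1,2m)$.
   Context: Conventions: for a $1$-form $\eta$, $2d\eta(X,Y)=X(\eta(Y))-Y(\eta(X))-\eta([X,Y])$. An almost contact metric structure $(\phi,\xi,\eta,g)$ consists of a $(1,1)$-tensor $\phi$, a vector field $\xi$, a $1$-form $\eta$ and a Riemannian metric $g$ with $\phi^2=-I+\eta\otimes\xi$, $\eta(\xi)=1$, $g(\phi X,\phi Y)=g(X,Y)-\eta(X)\eta(Y)$. Its fundamental $2$-form is $\Phi(X,Y)=g(X,\phi Y)$. It is normal if $[\phi,\phi]+2d\eta\otimes\xi=0$ ($[\phi,\phi]$ the Nijenhuis torsion), and quasi-Sasakian if it is normal and $d\Phi=0$. A quasi-Sasakian structure has rank $2p+1$ if $\eta\wedge(d\eta)^p\neq0$ and $(d\eta)^{p+1}=0$ on $M$; only structures of constant rank are considered. A $3$-quasi-Sasakian manifold is a $(4n+3)$-dimensional manifold with three quasi-Sasakian structures $(\phi_\alpha,\xi_\alpha,\eta_\alpha,g)$, $\alpha=1,2,3$, with the same metric $g$, such that for every even permutation $(\alpha,\beta,\gamma)$ of $\{1,2,3\}$: $\phi_\gamma=\phi_\alpha\phi_\beta-\eta_\beta\otimes\xi_\alpha=-\phi_\beta\phi_\alpha+\eta_\alpha\otimes\xi_\beta$,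 $\xi_\gamma=\phi_\alpha\xi_\beta=-\phi_\beta\xi_\alpha$, $\eta_\gamma=\eta_\alpha\circ\phi_\beta=-\eta_\beta\circ\phi_\alpha$. It is known that $\eta_1,\eta_2,\eta_3$ have the same rank, called the rank of $M$, of the form $4l+1$ or $4l+3$ for some $0\le l\le n$. Put $\mathcal{V}=\langle\xi_1,\xi_2,\xi_3\rangle$, $\mathcal{H}=\bigcap_{\alpha=1}^3\ker\eta_\alpha=\mathcal{V}^\perp$. Let $\mathcal{E}^{4m}=\{X\in\mathcal{H}: i_Xd\eta_\alpha=0\text{ for some }\alpha\}$ (equivalently, for all $\alpha$), a distribution of rank $4m$, let $\mathcal{E}^{4l}$ be its orthogonal complement in $\mathcal{H}$, and $\mathcal{E}^{4l+3}=\mathcal{E}^{4l}\oplus\mathcal{V}$. For rank $4l+3$, $\theta_\gamma$ is the $(1,1)$-tensor equal to $\phi_\gamma$ on $\mathcal{E}^{4m}$ and to $0$ on $\mathcal{E}^{4l+3}$, and $\Theta_\gamma$ is the $2$-form $\Theta_\gamma(X,Y)=g(X,\theta_\gamma Y)$. A contact-symplectic pair of type $(h,k)$ on a manifold of dimension $2h+2k+1$ is a pair $(\beta,\omega)$ of a $1$-form $\beta$ and a closed $2$-form $\omega$ such that $\beta\wedge(d\beta)^h\wedge\omega^k$ is a volume form, $(d\beta)^{h+1}=0$ and $\omega^{k+1}=0$. *)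

(* Defs.v *)
From mathcomp Require Import all_boot all_order all_algebra all_fingroup.
From mathcomp Require Import all_classical all_reals all_analysis.
Import Order.TTheory GRing.Theory Num.Theory.
Import numFieldNormedType.Exports.

Set Implicit Arguments.
Unset Strict Implicit.
Unset Printing Implicit Defensive.

Local Open Scope classical_set_scope.
Local Open Scope ring_scope.

(* f is C^k on A; A is always an open subset of R^d below. *)
Fixpoint Ck (R : realType) (d : nat) (W : normedModType R) (k : nat)
    (A : set 'rV[R]_d) (f : 'rV[R]_d -> W) : Prop :=
  (forall a, A a -> {for a, continuous f}) /\
  (if k is k'.+1 then
     forall v, (forall a, A a -> derivable f a v) /\ Ck k' A (fun a => 'D_v f a)
   else True).

Definition Coo (R : realType) (d : nat) (W : normedModType R)
    (A : set 'rV[R]_d) (f : 'rV[R]_d -> W) : Prop := forall k, Ck k A f.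

(* Each point p comes with a preferred chart around p, and these charts form a
   smooth atlas: every smooth manifold is presented in this way by choosing,
   around each point, one chart of its maximal atlas. *)
Record manifold (R : realType) (d : nat) := Manifold {
  points :> topologicalType;
  chart_dom : points -> set points;
  chart : points -> points -> 'rV[R]_d;
  chart_inv : points -> 'rV[R]_d -> points;
  manifold_hausdorff : hausdorff_space points;
  manifold_second_countable : @second_countable points;
  chart_dom_open : forall p, open (chart_dom p);
  chart_dom_center : forall p, chart_dom p p;
  chart_open : forall p, open (chart p @` chart_dom p);
  chartK : forall p x, chart_dom p x -> chart_inv p (chart p x) = x;
  chart_continuous : forall p x, chart_dom p x -> {for x, continuous (chart p)};
  chart_inv_continuous : forall p a,
    (chart p @` chart_dom p) a -> {for a, continuous (chart_inv p)};
  chart_smooth : forall p q,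
    Coo (chart p @` (chart_dom p `&` chart_dom q)) (chart q \o chart_inv p)
}.

(* The tangent space at x is R^d, a tangent vector at x being given by its
   components in the preferred chart at x.  Since the preferred chart varies
   (in general discontinuously) with x, smoothness of a field is read after
   transporting the components to a fixed chart p; [components p X] is the component
   vector of X in the chart p, meaningful on [chart_dom p]. *)
Definition vfield (R : realType) (d : nat) (M : manifold R d) := M -> 'rV[R]_d.

Definition components (R : realType) (d : nat) (M : manifold R d) (p : M)
    (X : vfield M) (y : M) : 'rV[R]_d :=
  'D_(X y) (chart p \o chart_inv y) (chart y y).

Definition smooth_fun (R : realType) (d : nat) (M : manifold R d)
    (U : set M) (f : M -> R) : Prop :=
  forall p : M, Coo (chart p @` (U `&` chart_dom p)) (f \o chart_inv p : _ -> R^o).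

Definition smooth_field (R : realType) (d : nat) (M : manifold R d)
    (U : set M) (X : vfield M) : Prop :=
  forall p : M, Coo (chart p @` (U `&` chart_dom p)) (components p X \o chart_inv p).

(* X(f) *)
Definition vapply (R : realType) (d : nat) (M : manifold R d)
    (X : vfield M) (f : M -> R) (x : M) : R :=
  'D_(X x) (f \o chart_inv x : _ -> R^o) (chart x x).

(* [X, Y]^i = X^j d_j Y^i - Y^j d_j X^i in the preferred chart at x *)
Definition lie (R : realType) (d : nat) (M : manifold R d)
    (X Y : vfield M) : vfield M := fun x =>
  'D_(X x) (components x Y \o chart_inv x) (chart x x)
  - 'D_(Y x) (components x X \o chart_inv x) (chart x x).

(* The field, smooth on [chart_dom x], whose components in the chart at x are
   constant and equal to u; in particular its value at x is u. *)
Definition ext (R : realType) (d : nat) (M : manifold R d) (x : M)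
    (u : 'rV[R]_d) : vfield M := fun y =>
  'D_u (chart y \o chart_inv x) (chart x y).

(* A tensor field is a pointwise multilinear map; it is smooth when its values
   on smooth fields, defined on any open set, are smooth. *)
Definition one_form (R : realType) (d : nat) (M : manifold R d)
    (eta : M -> 'rV[R]_d -> R) : Prop :=
  (forall x, scalar (eta x)) /\
  (forall U X, open U -> smooth_field U X ->
     smooth_fun U (fun x => eta x (X x))).

Definition tensor11 (R : realType) (d : nat) (M : manifold R d)
    (phi : M -> 'rV[R]_d -> 'rV[R]_d) : Prop :=
  (forall x, linear (phi x)) /\
  (forall U (X : vfield M), open U -> smooth_field U X ->
     smooth_field U (fun x => phi x (X x))).

Definition tensor02 (R : realType) (d : nat) (M : manifold R d)
    (b : M -> 'rV[R]_d -> 'rV[R]_d -> R) : Prop :=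
  [/\ forall x u, scalar (b x u),
      forall x v, scalar (fun u => b x u v) &
      forall U (X Y : vfield M), open U -> smooth_field U X ->
        smooth_field U Y -> smooth_fun U (fun x => b x (X x) (Y x))].

Definition two_form (R : realType) (d : nat) (M : manifold R d)
    (w : M -> 'rV[R]_d -> 'rV[R]_d -> R) : Prop :=
  tensor02 w /\ forall x u, w x u u = 0.

Definition riemannian_metric (R : realType) (d : nat) (M : manifold R d)
    (g : M -> 'rV[R]_d -> 'rV[R]_d -> R) : Prop :=
  [/\ tensor02 g, forall x u v, g x u v = g x v u &
      forall x u, u != 0 -> 0 < g x u u].

(* 2 d eta(X, Y) = X(eta(Y)) - Y(eta(X)) - eta([X, Y]); as the right-hand side
   is tensorial, its value at tangent vectors u, v at x is obtained from any
   smooth local fields extending u and v, here from [ext x u] and [ext x v]. *)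
Definition dfields (R : realType) (d : nat) (M : manifold R d)
    (eta : M -> 'rV[R]_d -> R) (X Y : vfield M) (x : M) : R :=
  2^-1 * (vapply X (fun y => eta y (Y y)) x - vapply Y (fun y => eta y (X y)) x
          - eta x (lie X Y x)).

Definition dform (R : realType) (d : nat) (M : manifold R d)
    (eta : M -> 'rV[R]_d -> R) (x : M) (u v : 'rV[R]_d) : R :=
  dfields eta (ext x u) (ext x v) x.

(* d w = 0 for a 2-form w, through the formula for 3 dw(X, Y, Z) *)
Definition closed_form (R : realType) (d : nat) (M : manifold R d)
    (w : M -> 'rV[R]_d -> 'rV[R]_d -> R) : Prop :=
  forall (U : set M) (X Y Z : vfield M), open U ->
  smooth_field U X -> smooth_field U Y -> smooth_field U Z ->
  forall x, U x ->
    vapply X (fun y => w y (Y y) (Z y)) x + vapply Y (fun y => w y (Z y) (X y)) x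
    + vapply Z (fun y => w y (X y) (Y y)) x
    - w x (lie X Y x) (Z x) - w x (lie Y Z x) (X x) - w x (lie Z X x) (Y x) = 0.

Definition form (R : realType) (d k : nat) := ('I_k -> 'rV[R]_d) -> R.

Definition of1 (R : realType) (d : nat) (a : 'rV[R]_d -> R) : form R d 1 :=
  fun v => a (v ord0).

Definition of2 (R : realType) (d : nat) (w : 'rV[R]_d -> 'rV[R]_d -> R) :
    form R d 2 := fun v => w (v ord0) (v ord_max).

(* The factor 1/(p+q)! is the normalization compatible with the factor 2 in the
   formula for the exterior derivative. *)
Definition wedge (R : realType) (d p q : nat) (a : form R d p) (b : form R d q)
    : form R d (p + q) := fun v =>
  ((p + q)`!%:R)^-1 *
  \sum_(s : 'S_(p + q)) (-1) ^+ odd_perm s *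
     (a (fun i => v (s (lshift q i))) * b (fun j => v (s (rshift p j)))).

Fixpoint wpow (R : realType) (d : nat) (w : form R d 2) (k : nat) :
    form R d (k * 2) :=
  match k with
  | 0 => fun _ => 1
  | k'.+1 => wedge w (@wpow R d w k')
  end.
Arguments wpow {R d} w k _.

(* A form of degree 2h+2k+1 is a volume form when it is nowhere zero. *)
Definition contact_symplectic_pair (R : realType) (d : nat) (M : manifold R d)
    (beta : M -> 'rV[R]_d -> R) (w : M -> 'rV[R]_d -> 'rV[R]_d -> R)
    (h k : nat) : Prop :=
  [/\ d = (2 * h + 2 * k + 1)%N,
      one_form beta,
      two_form w /\ closed_form w,
      forall x, exists v,
        wedge (of1 (beta x))
          (wedge (wpow (of2 (dform beta x)) h) (wpow (of2 (w x)) k)) v != 0 &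
      forall x, (forall v, wpow (of2 (dform beta x)) h.+1 v = 0) /\
                (forall v, wpow (of2 (w x)) k.+1 v = 0)].

Definition almost_contact_metric (R : realType) (d : nat) (M : manifold R d)
    (phi : M -> 'rV[R]_d -> 'rV[R]_d) (xi : vfield M)
    (eta : M -> 'rV[R]_d -> R) (g : M -> 'rV[R]_d -> 'rV[R]_d -> R) : Prop :=
  [/\ [/\ tensor11 phi, smooth_field setT xi, one_form eta &
          riemannian_metric g],
      forall x u, phi x (phi x u) = - u + eta x u *: xi x,
      forall x, eta x (xi x) = 1 &
      forall x u v, g x (phi x u) (phi x v) = g x u v - eta x u * eta x v].

Definition fundamental_form (R : realType) (d : nat) (M : manifold R d)
    (g : M -> 'rV[R]_d -> 'rV[R]_d -> R) (phi : M -> 'rV[R]_d -> 'rV[R]_d)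
    (x : M) (u v : 'rV[R]_d) : R := g x u (phi x v).

Definition nijenhuis (R : realType) (d : nat) (M : manifold R d)
    (phi : M -> 'rV[R]_d -> 'rV[R]_d) (X Y : vfield M) : vfield M := fun x =>
  let phiX : vfield M := fun y => phi y (X y) in
  let phiY : vfield M := fun y => phi y (Y y) in
  phi x (phi x (lie X Y x)) + lie phiX phiY x
  - phi x (lie phiX Y x) - phi x (lie X phiY x).

Definition normal_structure (R : realType) (d : nat) (M : manifold R d)
    (phi : M -> 'rV[R]_d -> 'rV[R]_d) (xi : vfield M)
    (eta : M -> 'rV[R]_d -> R) : Prop :=
  forall (U : set M) (X Y : vfield M), open U ->
  smooth_field U X -> smooth_field U Y ->
  forall x, U x ->
    nijenhuis phi X Y x + (2 * dform eta x (X x) (Y x)) *: xi x = 0.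

Definition quasi_sasakian (R : realType) (d : nat) (M : manifold R d)
    (phi : M -> 'rV[R]_d -> 'rV[R]_d) (xi : vfield M)
    (eta : M -> 'rV[R]_d -> R) (g : M -> 'rV[R]_d -> 'rV[R]_d -> R) : Prop :=
  [/\ almost_contact_metric phi xi eta g, normal_structure phi xi eta &
      closed_form (fundamental_form g phi)].

(* The rank is 2p+1; being constant, the nonvanishing holds at every point. *)
Definition has_rank (R : realType) (d : nat) (M : manifold R d)
    (eta : M -> 'rV[R]_d -> R) (p : nat) : Prop :=
  forall x,
    (exists v, wedge (of1 (eta x)) (wpow (of2 (dform eta x)) p) v != 0) /\
    (forall v, wpow (of2 (dform eta x)) p.+1 v = 0).

Definition three_quasi_sasakian (R : realType) (n : nat)
    (M : manifold R (4 * n + 3))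
    (phi : 'I_3 -> M -> 'rV[R]_(4 * n + 3) -> 'rV[R]_(4 * n + 3))
    (xi : 'I_3 -> vfield M) (eta : 'I_3 -> M -> 'rV[R]_(4 * n + 3) -> R)
    (g : M -> 'rV[R]_(4 * n + 3) -> 'rV[R]_(4 * n + 3) -> R) : Prop :=
  (forall a, quasi_sasakian (phi a) (xi a) (eta a) g) /\
  (forall s : 'S_3, ~~ odd_perm s ->
   let a := s 0 in let b := s 1 in let c := s 2 in
   forall x,
   [/\ forall u, phi c x u = phi a x (phi b x u) - eta b x u *: xi a x /\
                 phi c x u = - phi b x (phi a x u) + eta a x u *: xi b x,
       xi c x = phi a x (xi b x) /\ xi c x = - phi b x (xi a x) &
       forall u, eta c x u = eta a x (phi b x u) /\
                 eta c x u = - eta b x (phi a x u)]).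

Definition distH (R : realType) (d : nat) (M : manifold R d)
    (eta : 'I_3 -> M -> 'rV[R]_d -> R) (x : M) : set 'rV[R]_d :=
  [set u | forall a, eta a x u = 0].

Definition distE4m (R : realType) (d : nat) (M : manifold R d)
    (eta : 'I_3 -> M -> 'rV[R]_d -> R) (x : M) : set 'rV[R]_d :=
  [set u | distH eta x u /\ exists a, forall v, dform (eta a) x u v = 0].

Definition distE4l (R : realType) (d : nat) (M : manifold R d)
    (eta : 'I_3 -> M -> 'rV[R]_d -> R)
    (g : M -> 'rV[R]_d -> 'rV[R]_d -> R) (x : M) : set 'rV[R]_d :=
  [set u | distH eta x u /\ forall v, distE4m eta x v -> g x u v = 0].

Definition distE4l3 (R : realType) (d : nat) (M : manifold R d)
    (xi : 'I_3 -> vfield M) (eta : 'I_3 -> M -> 'rV[R]_d -> R)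
    (g : M -> 'rV[R]_d -> 'rV[R]_d -> R) (x : M) : set 'rV[R]_d :=
  [set u | exists w (c : 'I_3 -> R),
     distE4l eta g x w /\ u = w + \sum_a c a *: xi a x].

Definition is_theta (R : realType) (d : nat) (M : manifold R d)
    (phi : M -> 'rV[R]_d -> 'rV[R]_d) (xi : 'I_3 -> vfield M)
    (eta : 'I_3 -> M -> 'rV[R]_d -> R)
    (g : M -> 'rV[R]_d -> 'rV[R]_d -> R)
    (theta : M -> 'rV[R]_d -> 'rV[R]_d) : Prop :=
  [/\ tensor11 theta,
      forall x u, distE4m eta x u -> theta x u = phi x u &
      forall x u, distE4l3 xi eta g x u -> theta x u = 0].

Definition Theta (R : realType) (d : nat) (M : manifold R d)
    (g : M -> 'rV[R]_d -> 'rV[R]_d -> R)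
    (theta : M -> 'rV[R]_d -> 'rV[R]_d) (x : M) (u v : 'rV[R]_d) : R :=
  g x u (theta x v).

(* Main.v *)
From HB Require Import structures.
Require Import Defs.
From mathcomp Require Import all_boot all_order all_algebra all_fingroup.
From mathcomp Require Import all_classical all_reals all_analysis.
From mathcomp Require Import zify ring lra.
Import Order.TTheory GRing.Theory Num.Theory.
Import numFieldNormedType.Exports.
Set Implicit Arguments.
Unset Strict Implicit.
Unset Printing Implicit Defensive.
Local Open Scope classical_set_scope.
Local Open Scope ring_scope.

(* In a chart the structure consists of matrices over the ring of smooth
   functions, on which the partial derivatives act as commuting derivations.
   Normality and d Phi_a = 0 make xi_a a Killing field preserving eta_a and phi_a,
   and for (a, b, c) cyclic the tensors T_c = L_(xi_a) phi_b satisfy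
   2 d eta_c (X, Y) = g(X, T_c Y).  Taking Lie derivatives of the quaternionic
   relations gives [xi_a, xi_b] = k xi_c with one function k for all (a, b, c),
   then dk = 0, T_c xi_b = k phi_c xi_b and T_c^2 = k T_c phi_c.  As the rank is
   larger than 1, k has no zeros, so that - k^-1 phi_c T_c is the orthogonal
   projection onto the complement of xi_c in E^(4l+3).  Hence
   Theta_c = Phi_c - k^-1 (2 d eta_c), which is closed since dk = 0.
   The remaining conditions are pointwise: a power of a 2-form vanishes beyond its
   rank, and is nonzero on a phi_c-invariant subspace where the form is a nonzero
   multiple of Phi_c; the volume form is evaluated on xi_b, followed by vectors of
   E^(4l+3) and vectors of E^(4m), for which only block permutations contribute. *)

(** * Exterior powers of 2-forms *)

(** Lie derivatives need identities between functions, whereas nondegeneracy of g, the vanishing of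
    phi xi and the final conditions are pointwise. The algebra is therefore done over a commutative
    ring with commuting derivations, and evaluations at points carry hypotheses in and conclusions
    out. Since the tangent space at each point is identified with R^d by the preferred chart of that
    point, brackets, exterior derivatives and tensors must first be rewritten in one fixed chart. No
    inverse of k is formed in the ring: the formula is kept as k Theta = k Phi - 2 d eta and divided
    at a point. The identity T_c^2 = k T_c phi_c says that 2 d eta_c is k Phi_c on the image of T_c;
    this is how a projection defined point by point becomes a smooth expression with a locally
    constant coefficient. The indices b and c are unrelated, and what links eta_b to Theta_c is that
    the d eta_a have the same kernel in H. *)

Section Wedge.
Variables (R : realType) (d : nat).
Implicit Types p q k : nat.

Definition alternating k (a : Defs.form R d k) :=
  forall (v : 'I_k -> 'rV[R]_d) (t : 'S_k),
    a (fun i => v (t i)) = (-1) ^+ odd_perm t * a v.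

Definition wedge_term p q (a : Defs.form R d p) (b : Defs.form R d q)
    (v : 'I_(p + q) -> 'rV[R]_d) (s : 'S_(p + q)) : R :=
  (-1) ^+ odd_perm s *
    (a (fun i => v (s (lshift q i))) * b (fun j => v (s (rshift p j)))).

Lemma wedge_alternating p q (a : Defs.form R d p) (b : Defs.form R d q) :
  alternating (wedge a b).
Proof.
move=> v t; rewrite /wedge mulrCA; congr (_ * _).
rewrite (reindex_inj (mulIg t^-1%g)) mulr_sumr; apply: eq_bigr => s _.
rewrite odd_permM odd_permV signr_addb -mulrA mulrCA; congr (_ * (_ * _)).
by congr (a _ * b _); apply: funext => i; rewrite permM permKV.
Qed.

Lemma wpow_alternating (w : Defs.form R d 2) k : alternating (wpow w k).
Proof.
case: k => [|k]; last exact: wedge_alternating.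
move=> v t; have -> : t = 1%g by apply/permP => -[].
by rewrite odd_perm1 mul1r.
Qed.

(** By finiteness a permutation that preserves the first block preserves the second. Its sign is the
    determinant of a block diagonal permutation matrix, which avoids counting inversions. *)
Lemma block_perm p q (s : 'S_(p + q)) :
    (forall i, exists j, s (lshift q i) = lshift q j) ->
  exists (s1 : 'S_p) (s2 : 'S_q),
    [/\ forall i, s (lshift q i) = lshift q (s1 i),
        forall j, s (rshift p j) = rshift p (s2 j) &
        (-1) ^+ odd_perm s = (-1) ^+ odd_perm s1 * (-1) ^+ odd_perm s2 :> R].
Proof.
move=> hs; have [f hf] := choice hs.
have fI : injective f.
  move=> i j e; apply: (@lshift_inj p q); apply: (@perm_inj _ s).
  by rewrite !hf e.
have hr j : exists i, s (rshift p j) = rshift p i.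
  case: (split_ordP (s (rshift p j))) => i hi; last by exists i.
  have : s (rshift p j) = s (lshift q (invF fI i)) by rewrite hf f_invF.
  by move/perm_inj/eqP; rewrite eq_rlshift.
have [h hh] := choice hr.
have hI : injective h.
  move=> i j e; apply: (@rshift_inj p q); apply: (@perm_inj _ s).
  by rewrite !hh e.
exists (perm fI), (perm hI); split=> [i|j|]; rewrite ?permE //.
rewrite -!det_perm -(det_ublock _ 0); congr (\det _).
apply/matrixP => i j; rewrite mxE.
case: (split_ordP i) => i' ->; case: (split_ordP j) => j' ->; rewrite ?(block_mxEul, block_mxEur, block_mxEdl, block_mxEdr) !mxE ?hf ?hh ?permE //.
- by rewrite eq_lrshift.
- by rewrite eq_rlshift.
- by rewrite eq_rshift.
Qed.

Lemma wedge_term_block p q (a : Defs.form R d p) (b : Defs.form R d q) v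
    (s : 'S_(p + q)) : alternating a -> alternating b ->
    (forall i, exists j, s (lshift q i) = lshift q j) ->
  wedge_term a b v s = a (fun i => v (lshift q i)) * b (fun j => v (rshift p j)).
Proof.
move=> ha hb /block_perm[s1 [s2 [h1 h2 sg]]]; rewrite /wedge_term.
have -> : (fun i => v (s (lshift q i))) = (fun i => v (lshift q (s1 i))).
  by apply: funext => i; rewrite h1.
have -> : (fun i => v (s (rshift p i))) = (fun i => v (rshift p (s2 i))).
  by apply: funext => i; rewrite h2.
rewrite (ha (fun i => v (lshift q i))) (hb (fun i => v (rshift p i))) sg.
have x1 (b' : bool) : (-1) ^+ b' * (-1) ^+ b' = 1 :> R by rewrite -expr2 sqrr_sign.
have e (x y A B : R) : x * x = 1 -> y * y = 1 -> x * y * (x * A * (y * B)) = A * B.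
  move=> hx hy; transitivity ((x * x) * (y * y) * (A * B)); first by ring.
  by rewrite hx hy !mul1r.
exact: e.
Qed.

(** No cancellation can occur: the identity contributes T0 and every other term is 0 or T0, so T0
    times the sum is at least T0^2 > 0. *)
Lemma wedge_neq0 p q (a : Defs.form R d p) (b : Defs.form R d q) v :
  let T0 := a (fun i => v (lshift q i)) * b (fun j => v (rshift p j)) in
  T0 != 0 -> (forall s, wedge_term a b v s = 0 \/ wedge_term a b v s = T0) ->
  wedge a b v != 0.
Proof.
move=> T0 T0n hT; rewrite /wedge mulf_neq0 ?invr_neq0 ?pnatr_eq0 -?lt0n ?fact_gt0 //.
have h1 : wedge_term a b v 1%g = T0.
  rewrite /wedge_term odd_perm1 mul1r; congr (a _ * b _); apply: funext => i;
    by rewrite perm1.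
have hT2 s : 0 <= T0 * wedge_term a b v s.
  by case: (hT s) => ->; rewrite ?mulr0 // -expr2 sqr_ge0.
suff: T0 * (\sum_s wedge_term a b v s) != 0.
  by rewrite mulf_eq0 negb_or => /andP[].
rewrite mulr_sumr (bigD1 1%g) //= gt_eqF // ltr_pwDl ?sumr_ge0 //.
by rewrite h1 -expr2 lt_def sqrf_eq0 sqr_ge0 andbT.
Qed.

(** A permutation that feeds a vector of the second block to [a] contributes nothing; the others
    preserve the blocks and all give the same value. *)
Lemma wedge_block_neq0 p q (a : Defs.form R d p) (b : Defs.form R d q) v :
  alternating a -> alternating b ->
  (forall u : 'I_p -> 'I_(p + q), (exists i j, u i = rshift p j) ->
     a (fun i => v (u i)) = 0) ->
  a (fun i => v (lshift q i)) != 0 -> b (fun j => v (rshift p j)) != 0 ->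
  wedge a b v != 0.
Proof.
move=> ha hb hv an bn; apply: wedge_neq0; rewrite ?mulf_neq0 // => s.
have [|hn] := pselect (forall i, exists j, s (lshift q i) = lshift q j).
  by move=> h; right; exact: wedge_term_block.
left; rewrite /wedge_term (hv (fun i => s (lshift q i))) ?mul0r ?mulr0 //.
apply: contrapT => hn'; apply: hn => i.
case: (split_ordP (s (lshift q i))) => j hj; first by exists j.
by case: hn'; exists i, j.
Qed.

(** Used to alter vectors along the kernel of w, or to permute them by a symmetry of their Gram
    matrix, without changing the power. *)
Lemma wpow_gram (w w' : 'rV[R]_d -> 'rV[R]_d -> R) k v v' :
  (forall i j, w (v i) (v j) = w' (v' i) (v' j)) ->
  wpow (of2 w) k v = wpow (of2 w') k v'.
Proof.
elim: k v v' => //= k IH v v' h; rewrite /wedge; congr (_ * _).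
apply: eq_bigr => s _; rewrite /of2 h; congr (_ * (_ * _)).
exact: IH.
Qed.

Definition upd k (v : 'I_k -> 'rV[R]_d) (i0 : 'I_k) (u : 'rV[R]_d) :=
  fun i => if i == i0 then u else v i.

Definition multilinear k (a : Defs.form R d k) := forall v i0 (c : R) u u',
  a (upd v i0 (c *: u + u')) = c * a (upd v i0 u) + a (upd v i0 u').

Lemma upd_perm k k' (v : 'I_k -> 'rV[R]_d) i0 u (f : 'I_k' -> 'I_k) j :
  injective f -> f j = i0 ->
  (fun i => upd v i0 u (f i)) = upd (fun i => v (f i)) j u.
Proof.
by move=> fI <-; apply: funext => i; rewrite /upd (inj_eq fI).
Qed.

Lemma upd_out k k' (v : 'I_k -> 'rV[R]_d) i0 u (f : 'I_k' -> 'I_k) :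
  (forall i, f i != i0) -> (fun i => upd v i0 u (f i)) = (fun i => v (f i)).
Proof. by move=> fI; apply: funext => i; rewrite /upd (negbTE (fI i)). Qed.

(** For each permutation s the slot i0 is read by exactly one factor, the one whose block contains
    s^-1 i0; the other factor does not see the update. *)
Lemma wedge_multilinear p q (a : Defs.form R d p) (b : Defs.form R d q) :
  multilinear a -> multilinear b -> multilinear (wedge a b).
Proof.
move=> ha hb v i0 c u u'; rewrite /wedge mulrCA -mulrDr; congr (_ * _).
rewrite mulr_sumr -big_split /=; apply: eq_bigr => s _.
have lI : injective (fun i => s (lshift q i)).
  exact: inj_comp (@perm_inj _ s) (@lshift_inj p q).
have rI : injective (fun i => s (rshift p i)).
  exact: inj_comp (@perm_inj _ s) (@rshift_inj p q).
rewrite [c * _]mulrCA -mulrDr; congr (_ * _).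
case: (split_ordP ((s^-1)%g i0)) => j hj.
  have sj : s (lshift q j) = i0 by rewrite -hj permKV.
  have eL x : (fun i => upd v i0 x (s (lshift q i))) =
              upd (fun i => v (s (lshift q i))) j x := upd_perm v x lI sj.
  have eR x : (fun i => upd v i0 x (s (rshift p i))) = (fun i => v (s (rshift p i))).
    by apply: upd_out => i; rewrite -sj (inj_eq perm_inj) eq_rlshift.
  by rewrite !eL !eR ha mulrDl mulrA.
have sj : s (rshift p j) = i0 by rewrite -hj permKV.
have eR x : (fun i => upd v i0 x (s (rshift p i))) =
            upd (fun i => v (s (rshift p i))) j x := upd_perm v x rI sj.
have eL x : (fun i => upd v i0 x (s (lshift q i))) = (fun i => v (s (lshift q i))).
  by apply: upd_out => i; rewrite -sj (inj_eq perm_inj) eq_lrshift.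
by rewrite !eL !eR hb mulrDr (mulrCA c).
Qed.

Lemma of2_multilinear (w : 'rV[R]_d -> 'rV[R]_d -> R) :
  (forall u, scalar (w u)) -> (forall v, scalar (fun u => w u v)) ->
  multilinear (of2 w).
Proof.
move=> w1 w2 v i0 c u u'; rewrite /of2 /upd.
by case: i0 => [[|[|//]] hi]; rewrite -!val_eqE /= ?w1 ?w2.
Qed.

Lemma wpow_multilinear (w : Defs.form R d 2) k :
  multilinear w -> multilinear (wpow w k).
Proof.
move=> hw; elim: k => [|k IH] /=; last exact: wedge_multilinear.
by move=> v [].
Qed.

Lemma multilinear_sum k (a : Defs.form R d k) v i0 n (c : 'I_n -> R) u :
  multilinear a -> a (upd v i0 (\sum_i c i *: u i)) = \sum_i c i * a (upd v i0 (u i)).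
Proof.
move=> ha; have a0 : a (upd v i0 0) = 0.
  have := ha v i0 1 0 0; rewrite scale1r addr0 mul1r.
  by move/eqP; rewrite -subr_eq0 opprD addrA subrr add0r oppr_eq0 => /eqP.
elim: n c u => [|n IH] c u; first by rewrite !big_ord0.
by rewrite !big_ord_recl ha IH.
Qed.

Lemma alternating_eq0 k (a : Defs.form R d k) v i j :
  alternating a -> i != j -> v i = v j -> a v = 0.
Proof.
move=> ha ij e; have := ha v (tperm i j); rewrite odd_tperm ij expr1 mulN1r.
have -> : (fun x => v (tperm i j x)) = v.
  by apply: funext => x; case: tpermP => // ->.
by move=> h; lra.
Qed.

(** Put the combination in slot i0. The power becomes 0, the combination being in the kernel of w;
    by multilinearity it is also c i0 times the original power, since every other term repeats a
    vector. *)
Lemma wpow_dep (w : 'rV[R]_d -> 'rV[R]_d -> R) k (v : 'I_(k * 2) -> 'rV[R]_d)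
    (c : 'I_(k * 2) -> R) i0 :
  (forall u, scalar (w u)) -> (forall v, scalar (fun u => w u v)) ->
  c i0 != 0 -> (forall u, w (\sum_i c i *: v i) u = 0) ->
  (forall u, w u (\sum_i c i *: v i) = 0) -> wpow (of2 w) k v = 0.
Proof.
move=> w1 w2 ci k1 k2.
have ml : multilinear (wpow (of2 w) k).
  by apply: wpow_multilinear; exact: of2_multilinear.
have al := @wpow_alternating (of2 w) k.
have w10 u : w u 0 = 0.
  by have := w1 u (-1) 0 0; rewrite scaler0 addr0 mulN1r addNr.
have w20 u : w 0 u = 0.
  by have := w2 u (-1) 0 0; rewrite scaler0 addr0 mulN1r addNr.
have e1 : wpow (of2 w) k (upd v i0 (\sum_i c i *: v i)) = 0.
  transitivity (wpow (of2 w) k (upd v i0 0)); last first.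
    (* Writing 0 as an empty linear combination lets [multilinear_sum] yield the value 0. *)
    have -> : 0 = \sum_(i < 0) (0 : R) *: (0 : 'rV[R]_d) by rewrite big_ord0.
    by rewrite multilinear_sum // big_ord0.
  by apply: wpow_gram => i j; rewrite /upd; case: eqP; case: eqP;
    rewrite ?k1 ?k2 ?w10 ?w20.
rewrite multilinear_sum // (bigD1 i0) //= big1 ?addr0 in e1; last first.
  move=> i ii; rewrite (@alternating_eq0 _ _ _ i i0) ?mulr0 //.
  by rewrite /upd eqxx (negbTE ii).
move/eqP: e1; rewrite mulf_eq0 (negbTE ci) => /eqP <-.
by congr (wpow _ _ _); apply: funext => i; rewrite /upd; case: eqP => // ->.
Qed.

(** The images under A of 2k vectors lie in a space of dimension less than 2k, so a nontrivial
    combination is killed by A and hence lies in the kernel of w. *)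
Lemma wpow_rank_eq0 (w : 'rV[R]_d -> 'rV[R]_d -> R) k e (A : 'M[R]_(d, e)) v :
  (forall u, scalar (w u)) -> (forall v, scalar (fun u => w u v)) ->
  (forall u u', u *m A = 0 -> w u u' = 0) ->
  (forall u u', u' *m A = 0 -> w u u' = 0) ->
  (\rank A < k * 2)%N -> wpow (of2 w) k v = 0.
Proof.
move=> w1 w2 k1 k2 rA.
pose V := \matrix_(i < k * 2) v i.
have : kermx (V *m A) != 0.
  rewrite -mxrank_eq0 mxrank_ker subn_eq0 -ltnNge.
  exact: leq_ltn_trans (mxrankM_maxr _ _) rA.
case/rowV0Pn => c /sub_kermxP; rewrite mulmxA => cV c0.
have [i0 ci0] : exists i0, c 0 i0 != 0.
  apply/existsP; apply: contraR c0; rewrite negb_exists => /forallP h.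
  by apply/eqP/rowP => i; rewrite mxE; apply/eqP; rewrite -[_ == _]negbK h.
have cE : c *m V = \sum_i c 0 i *: v i.
  by rewrite mulmx_sum_row; apply: eq_bigr => i _; rewrite rowK.
by apply: (wpow_dep w1 w2 ci0) => u; rewrite -cE; [exact: k1 | exact: k2].
Qed.

(* The Gram matrix of a symplectic basis (e_0, f_0, e_1, f_1, ...). *)
Definition std_gram (i j : nat) : R :=
  if i./2 == j./2 then (odd j)%:R - (odd i)%:R else 0.

(** Serves [wpow_std_neq0]: exchanging two symplectic pairs preserves the Gram matrix and, as a
    product of two transpositions, costs no sign. *)
Lemma block_swap k (h : nat) : (h <= k)%N ->
  exists t : 'S_(2 + k * 2), odd_perm t = false /\
    forall i : 'I_(2 + k * 2), (t i : nat) =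
      if (i : nat)./2 == 0%N then (h.*2 + i)%N
      else if (i : nat)./2 == h then (i - h.*2)%N else i.
Proof.
move=> hk.
have [->|h0] := eqVneq h 0%N.
  exists 1%g; split; rewrite ?odd_perm1 // => i; rewrite perm1.
  by case: eqP => //; lia.
have p1 : (h.*2 < 2 + k * 2)%N by lia.
have p2 : ((h.*2).+1 < 2 + k * 2)%N by lia.
pose a0 : 'I_(2 + k * 2) := ord0.
pose a1 : 'I_(2 + k * 2) := @Ordinal (2 + k * 2) 1 isT.
exists (tperm a0 (Ordinal p1) * tperm a1 (Ordinal p2))%g; split.
  rewrite odd_permM !odd_tperm -!val_eqE /=.
  by do 2 (case: eqP; first lia).
move=> i; rewrite permM.
case: (tpermP a0 (Ordinal p1) i) => [->|->|/eqP n1 /eqP n2].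
- have -> : tperm a1 (Ordinal p2) (Ordinal p1) = Ordinal p1.
    by rewrite tpermD // -val_eqE /=; lia.
  by rewrite /=; lia.
- have -> : tperm a1 (Ordinal p2) a0 = a0 by rewrite tpermD // -val_eqE /=; lia.
  by rewrite /=; case: eqP; [lia|]; case: eqP; lia.
case: tpermP => [->|->|/eqP n3 /eqP n4].
- by rewrite /=; lia.
- by rewrite /=; case: eqP; [lia|]; case: eqP; lia.
rewrite -val_eqE /= in n1; rewrite -val_eqE /= in n2.
rewrite -val_eqE /= in n3; rewrite -val_eqE /= in n4.
by case: eqP; [lia|]; case: eqP; lia.
Qed.

Lemma of2_alternating (w : 'rV[R]_d -> 'rV[R]_d -> R) :
  (forall u v, w u v = - w v u) -> alternating (of2 w).
Proof.
move=> sk v t; rewrite /of2.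
have [t0|t0] := eqVneq (t ord0) ord0.
  have -> : t = 1%g.
    apply/permP => i; rewrite perm1; have [->//|i0] := eqVneq i ord0.
    have : t i != ord0 by rewrite -t0 (inj_eq perm_inj).
    by case: (t i) i0 => [[|[|//]] ?]; case: i => [[|[|//]] ?] // _ _; exact: val_inj.
  by rewrite !perm1 odd_perm1 mul1r.
have t1 : t ord0 = ord_max.
  by case: (t ord0) t0 => [[|[|//]] ?] // _; exact: val_inj.
have t2 : t ord_max = ord0.
  have : t ord_max != ord_max by rewrite -t1 (inj_eq perm_inj).
  by case: (t ord_max) => [[|[|//]] ?] // _; exact: val_inj.
have -> : t = tperm ord0 ord_max.
  apply/permP => i; case: tpermP => [->|->|/eqP n1 /eqP n2] //.
  by case: i n1 n2 => [[|[|//]] ?].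
by rewrite tpermL tpermR odd_tperm /= expr1 mulN1r sk.
Qed.

(** A term survives only if the first factor receives the two members of one symplectic pair.
    Exchanging that pair with the first one is an even symmetry of the Gram matrix, so the term
    equals one that preserves the blocks, that is, the identity term. *)
Lemma wpow_std_neq0 (w : 'rV[R]_d -> 'rV[R]_d -> R) k (v : 'I_(k * 2) -> _)
    (c : R) : (forall u v, w u v = - w v u) ->
  c != 0 -> (forall i j, w (v i) (v j) = c * std_gram i j) ->
  wpow (of2 w) k v != 0.
Proof.
move=> sk c0; elim: k v => [|k IH] v hv; first by rewrite oner_eq0.
have al2 := of2_alternating sk; have alk := @wpow_alternating (of2 w) k.
apply: (@wedge_neq0 2 (k * 2) (of2 w) (wpow (of2 w) k)).
  rewrite mulf_neq0 //.
    by rewrite /of2 hv /std_gram /= subr0 mulr1.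
  apply: IH => i j; by rewrite hv /std_gram /= !add0n !negbK eqSS.
move=> s.
pose i0 : 'I_(2 + k * 2) := s (lshift (k * 2) ord0).
pose i1 : 'I_(2 + k * 2) := s (lshift (k * 2) ord_max).
have [e01|n01] := eqVneq (i0 : nat)./2 (i1 : nat)./2; last first.
  by left; rewrite /wedge_term /of2 hv /std_gram (negbTE n01) mulr0 mul0r mulr0.
right.
have hk : ((i0 : nat)./2 <= k)%N by have := ltn_ord i0; lia.
have [t [ot ht]] := block_swap hk.
have htJ i j : std_gram (t i) (t j) = std_gram i j.
  rewrite /std_gram !ht; congr (if _ then _ else _).
    apply/eqP/eqP;
    case: (eqVneq (i : nat)./2 0%N); case: (eqVneq (j : nat)./2 0%N);
    case: (eqVneq (i : nat)./2 (i0 : nat)./2);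
    case: (eqVneq (j : nat)./2 (i0 : nat)./2); lia.
  by congr (_%:R - _%:R); congr nat_of_bool;
    (case: ifP => ?; [|case: ifP => ?]); lia.
have vt i j : w (v (t i)) (v (t j)) = w (v i) (v j) by rewrite !hv htJ.
have -> : wedge_term (of2 w) (wpow (of2 w) k) v s =
          wedge_term (of2 w) (wpow (of2 w) k) v (s * t)%g.
  rewrite /wedge_term odd_permM ot addbF /of2 !permM vt; congr (_ * (_ * _)).
  by apply: wpow_gram => i j; rewrite !permM vt.
apply: wedge_term_block => // i.
suff h : ((s * t)%g (lshift (k * 2) i) < 2)%N.
  by exists (Ordinal h); exact: val_inj.
rewrite permM ht.
have hi : (s (lshift (k * 2) i) : nat)./2 = (i0 : nat)./2.
  by case: i => [[|[|//]] hi];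
   [|rewrite e01]; congr (nat_of_ord (s _))./2; exact: val_inj.
rewrite hi; case: eqP => h0; first by lia.
by rewrite eqxx; lia.
Qed.

Lemma scalar_rowE (f : 'rV[R]_d -> R) u : scalar f ->
  f u = (u *m \col_i f (delta_mx 0 i)) 0 0.
Proof.
move=> hf; have f0 : f 0 = 0 by have := hf (-1) 0 0; rewrite scaler0 addr0 mulN1r addNr.
rewrite mxE {1}(row_sum_delta u).
under [RHS]eq_bigr do rewrite mxE.
elim/big_ind2: _ => // [x x' y y' <- <-|i _].
  by rewrite -[x]scale1r hf mul1r scale1r.
by rewrite -[_ *: _]addr0 hf f0 addr0.
Qed.

(** Gram-Schmidt for a Hermitian structure: split off a unit vector e together with phi e and
    continue in their orthogonal complement inside W, which phi preserves and whose rank drops by at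
    most 2. The bound only asks for \rank W >= 2k - 1: each step uses just that W is nonzero. This
    replaces a parity argument and is what [rank_proj_im_le] relies on. *)
Lemma symplectic_vectors (g : 'rV[R]_d -> 'rV[R]_d -> R) (phi : 'rV[R]_d -> 'rV[R]_d)
    k (W : 'M[R]_d) :
  (forall u, scalar (g u)) -> (forall u v, g u v = g v u) ->
  (forall u, u != 0 -> 0 < g u u) -> linear phi ->
  (forall u, (u <= W)%MS -> (phi u <= W)%MS) ->
  (forall u, (u <= W)%MS -> phi (phi u) = - u) ->
  (forall u v, (u <= W)%MS -> (v <= W)%MS -> g (phi u) (phi v) = g u v) ->
  (k * 2 < \rank W + 2)%N ->
  exists v : 'I_(k * 2) -> 'rV[R]_d, (forall i, (v i <= W)%MS) /\
    forall i j, g (v i) (phi (v j)) = std_gram i j.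
Proof.
move=> g1 gs gp phl; elim: k W => [|k IH] W W1 W2 W3 rW.
  by exists (fun _ => 0); split=> [[]|[]].
have gZ c u v : g u (c *: v) = c * g u v.
  have g0 : g u 0 = 0 by have := g1 u (-1) 0 0; rewrite scaler0 addr0 mulN1r addNr.
  by rewrite -[c *: v]addr0 g1 g0 addr0.
have gN u v : g u (- v) = - g u v by rewrite -scaleN1r gZ mulN1r.
have pZ c v : phi (c *: v) = c *: phi v.
  have p0 : phi 0 = 0 by have := phl (-1) 0 0; rewrite scaler0 addr0 scaleN1r addNr.
  by rewrite -[c *: v]addr0 phl p0 addr0.
have pN v : phi (- v) = - phi v by rewrite -scaleN1r pZ scaleN1r.
have : W != 0 by rewrite -mxrank_eq0; lia.
case/rowV0Pn => e' e'W e'0.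
pose e := (Num.sqrt (g e' e'))^-1 *: e'.
have eW : (e <= W)%MS by rewrite scalemx_sub.
have ee : g e e = 1.
  rewrite gZ gs gZ mulrA -invfM -expr2 sqr_sqrtr ?ltW ?gp // mulVf //.
  by rewrite gt_eqF // gp.
have skew u v : (u <= W)%MS -> (v <= W)%MS -> g u (phi v) = - g v (phi u).
  by move=> uW vW; rewrite -W3 ?W1 // W2 // gN gs.
have epe : g e (phi e) = 0 by have := skew e e eW eW; move=> h; lra.
pose A := row_mx (\col_i g e (delta_mx 0 i)) (\col_i g (phi e) (delta_mx 0 i)).
pose W' := (W :&: kermx A)%MS.
have W'P u : (u <= W')%MS = [&& (u <= W)%MS, g e u == 0 & g (phi e) u == 0].
  rewrite sub_capmx; congr (_ && _); rewrite !(scalar_rowE u (g1 _)).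
  apply/sub_kermxP/andP.
    rewrite mul_mx_row => /eqP; rewrite row_mx_eq0 => /andP[/eqP-> /eqP->].
    by rewrite mxE.
  move=> [/eqP h1 /eqP h2]; rewrite mul_mx_row; apply/eqP; rewrite row_mx_eq0.
  by apply/andP; split; apply/eqP/matrixP => i j; rewrite !ord1 ?h1 ?h2 mxE.
have rW' : (k * 2 < \rank W' + 2)%N.
  have := mxrank_sum_cap W (kermx A); rewrite -/W' mxrank_ker.
  have := rank_leq_col (W + kermx A)%MS; have := rank_leq_col A.
  have := rank_leq_row A; have := rank_leq_row W.
  move: rW; move: (\rank W) (\rank W') (\rank A) (\rank (W + kermx A)%MS).
  by move=> x y z t; lia.
have [|||v [vW vg]] := IH W' _ _ _ rW'.
- move=> u; rewrite !W'P => /and3P[uW /eqP h1 /eqP h2]; rewrite W1 //.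
  rewrite W3 // h1 eqxx andbT; rewrite -W3 ?W1 // W2 // gN h2 oppr0 eqxx.
  by [].
- by move=> u; rewrite W'P => /and3P[uW _ _]; exact: W2.
- by move=> u u'; rewrite !W'P => /and3P[uW _ _] /and3P[u'W _ _]; exact: W3.
(* The second vector is - phi e because g(e, phi (- phi e)) = g(e, e) = 1 is the entry required by
   [std_gram]. *)
pose v' (i : 'I_(2 + k * 2)) := match fintype.split i with
  | inl j => if j == ord0 then e else - phi e | inr j => v j end.
exists v'.
have vWW j : (v j <= W)%MS by have := vW j; rewrite W'P => /and3P[].
have v1 j : g e (v j) = 0 by have := vW j; rewrite W'P => /and3P[_ /eqP].
have v2 j : g (phi e) (v j) = 0 by have := vW j; rewrite W'P => /and3P[_ _ /eqP].
have v'l j : v' (lshift (k * 2) j) = if j == ord0 then e else - phi e.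
  by rewrite /v' -[lshift _ _]/(unsplit (inl _)) unsplitK.
have v'r j : v' (rshift 2 j) = v j.
  by rewrite /v' -[rshift _ _]/(unsplit (inr _)) unsplitK.
split=> [i|].
  case: (split_ordP i) => j ->; rewrite ?v'l ?v'r //.
  by case: eqP => // _; rewrite eqmx_opp W1.
move=> i j; case: (split_ordP i) => i' ->; case: (split_ordP j) => j' ->;
  rewrite ?v'l ?v'r.
- by case: i' => [[|[|//]] hi]; case: j' => [[|[|//]] hj];
    rewrite -!val_eqE /std_gram /= ?pN ?W2 ?opprK ?gN ?epe ?ee ?(gs (- phi e)) ?gN
      ?(gs (phi e)) ?epe ?W3 ?ee ?subr0 ?subrr ?oppr0 ?sub0r.
- have i0 : (i' : nat)./2 = 0%N by have := ltn_ord i'; lia.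
  rewrite /std_gram /= i0 add0n /=; case: eqP => _.
    by rewrite skew // gs v2 oppr0.
  by rewrite gs gN gs W3 // v1 oppr0.
- have j0 : (j' : nat)./2 = 0%N by have := ltn_ord j'; lia.
  rewrite /std_gram /= j0 add0n /=; case: eqP => _; first by rewrite gs v2.
  by rewrite pN W2 // opprK gs v1.
- by rewrite vg /std_gram /= !add0n !negbK eqSS.
Qed.

Lemma wpow_neq0 (g : 'rV[R]_d -> 'rV[R]_d -> R) (phi : 'rV[R]_d -> 'rV[R]_d)
    k (W : 'M[R]_d) (w : 'rV[R]_d -> 'rV[R]_d -> R) (c : R) :
  (forall u, scalar (g u)) -> (forall u v, g u v = g v u) ->
  (forall u, u != 0 -> 0 < g u u) -> linear phi ->
  (forall u, (u <= W)%MS -> (phi u <= W)%MS) ->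
  (forall u, (u <= W)%MS -> phi (phi u) = - u) ->
  (forall u v, (u <= W)%MS -> (v <= W)%MS -> g (phi u) (phi v) = g u v) ->
  (k * 2 < \rank W + 2)%N ->
  (forall u v, w u v = - w v u) -> c != 0 ->
  (forall u v, (u <= W)%MS -> (v <= W)%MS -> w u v = c * g u (phi v)) ->
  exists2 v, (forall i, (v i <= W)%MS) & wpow (of2 w) k v != 0.
Proof.
move=> g1 gs gp phl W1 W2 W3 rW sk c0 wE.
have [v [vW vg]] := symplectic_vectors g1 gs gp phl W1 W2 W3 rW.
by exists v => //; apply: (wpow_std_neq0 sk c0) => i j; rewrite wE ?vg.
Qed.
End Wedge.

Lemma row_mxP (R : realType) d m (A B : 'M[R]_(d, m)) :
  (forall u : 'rV_d, u *m A = u *m B) -> A = B.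
Proof. by move=> h; apply/row_matrixP => i; rewrite !rowE h. Qed.

(** * Linear algebra at a point: an almost contact metric structure and a skew T with T^2 = k P T *)

Section Point.
Variables (R : realType) (d : nat) (g : 'rV[R]_d -> 'rV[R]_d -> R).
Hypothesis g_lin : forall u, scalar (g u).
Hypothesis g_sym : forall u v, g u v = g v u.
Hypothesis g_pos : forall u, u != 0 -> 0 < g u u.

Lemma g0r u : g u 0 = 0.
Proof. by have := g_lin u (-1) 0 0; rewrite scaler0 addr0 mulN1r addNr. Qed.
Lemma gDr u v w : g u (v + w) = g u v + g u w.
Proof. by rewrite -[v]scale1r g_lin mul1r scale1r. Qed.
Lemma gZr c u v : g u (c *: v) = c * g u v.
Proof. by rewrite -[c *: v]addr0 g_lin g0r addr0. Qed.
Lemma gNr u v : g u (- v) = - g u v.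
Proof. by rewrite -scaleN1r gZr mulN1r. Qed.
Lemma gDl u v w : g (v + w) u = g v u + g w u.
Proof. by rewrite ![g _ u]g_sym gDr. Qed.
Lemma gZl c u v : g (c *: v) u = c * g v u.
Proof. by rewrite ![g _ u]g_sym gZr. Qed.
Lemma gNl u v : g (- v) u = - g v u.
Proof. by rewrite ![g _ u]g_sym gNr. Qed.

Lemma g_nondeg u : (forall v, g v u = 0) -> u = 0.
Proof.
move=> h; apply/eqP; apply: contraT => /g_pos.
by rewrite h ltxx.
Qed.

Variables (P T : 'M[R]_d) (E : 'cV[R]_d) (X : 'rV[R]_d) (k : R).
Hypothesis PP : P *m P = E *m X - 1%:M.
Hypothesis XE : X *m E = 1%:M.
Hypothesis XP : X *m P = 0.
Hypothesis PE : P *m E = 0.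
Hypothesis gPP : forall u v, g (u *m P) (v *m P) = g u v - (u *m E) 0 0 * (v *m E) 0 0.
Hypothesis TT : T *m T = k *: (P *m T).
Hypothesis XT : X *m T = 0.
Hypothesis gT : forall u v, g u (v *m T) = - g v (u *m T).
Hypothesis k0 : k != 0.

Lemma mx00 : (0 : 'M[R]_1) 0 0 = 0.
Proof. by rewrite mxE. Qed.

Lemma vPE (v : 'rV_d) : v *m P *m E = 0.
Proof. by rewrite -mulmxA PE mulmx0. Qed.

Lemma vPP (v : 'rV_d) : v *m P *m P = (v *m E) 0 0 *: X - v.
Proof.
by rewrite -mulmxA PP mulmxBr mulmx1 mulmxA {1}[v *m E]mx11_scalar mul_scalar_mx.
Qed.

Lemma g_xi v : g v X = (v *m E) 0 0.
Proof.
have := gPP v X; rewrite XP g0r XE [1%:M _ _]mxE mulr1 => /eqP.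
by rewrite eq_sym subr_eq0 => /eqP.
Qed.

Lemma g_skewP u v : g u (v *m P) = - g v (u *m P).
Proof.
have := gPP u (v *m P); rewrite vPE vPP mx00 mulr0 subr0 => <-.
by rewrite gDr gNr gZr g_xi vPE mx00 mulr0 add0r g_sym.
Qed.

Lemma vTE (u : 'rV_d) : u *m T *m E = 0.
Proof. by rewrite [LHS]mx11_scalar -g_xi g_sym gT XT g0r oppr0 raddf0. Qed.

(** As T is skew, T^2 = k P T is self-adjoint; as P and T are both skew, the adjoint of P T is T
    P. *)
Lemma TP_comm : P *m T = T *m P.
Proof.
apply: row_mxP => u; apply: (scalerI k0); rewrite scalemxAr -TT !mulmxA.
apply/eqP; rewrite -subr_eq0; apply/eqP/g_nondeg => v.
rewrite gDr gNr gZr gT g_sym gT opprK -mulmxA TT -scalemxAr mulmxA gZr gT.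
by rewrite g_sym g_skewP; ring.
Qed.

(* The orthogonal projection onto the image of T; proj_ker is the one onto
   the kernel of T inside the kernel of E. *)
Definition proj_im : 'M[R]_d := - k^-1 *: (T *m P).
Definition proj_ker : 'M[R]_d := 1%:M - E *m X - proj_im.
Let p := proj_im.
Let r := proj_ker.

Lemma TE : T *m E = 0.
Proof. by apply: row_mxP => u; rewrite mulmxA vTE mulmx0. Qed.

(** On the image of the projection T is therefore k times P, so g(u, v T) is k times the fundamental
    form there. *)
Lemma proj_imP : p *m P = k^-1 *: T.
Proof.
rewrite /p /proj_im -scalemxAl -mulmxA PP mulmxBr mulmx1 mulmxA.
by rewrite TE mul0mx sub0r scalerN scaleNr opprK.
Qed.

Lemma P_proj_im : P *m p = k^-1 *: T.
Proof. by rewrite -proj_imP /p /proj_im -scalemxAr -scalemxAl mulmxA TP_comm. Qed.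

Lemma proj_imT : p *m T = T.
Proof.
rewrite /p /proj_im -scalemxAl -mulmxA TP_comm mulmxA TT -scalemxAl scalerA.
rewrite mulNr mulVf // TP_comm -mulmxA PP mulmxBr mulmx1 mulmxA TE mul0mx.
by rewrite sub0r scalerN scaleN1r opprK.
Qed.

Lemma T_proj_im : T *m p = T.
Proof.
rewrite /p /proj_im -scalemxAr mulmxA TT -scalemxAl scalerA mulNr mulVf //.
rewrite -mulmxA -TP_comm mulmxA PP mulmxBl mul1mx -mulmxA XT mulmx0.
by rewrite sub0r scalerN scaleN1r opprK.
Qed.

Lemma proj_im_id : p *m p = p.
Proof. by rewrite {2}/p /proj_im -scalemxAr mulmxA proj_imT. Qed.

Lemma proj_imE : p *m E = 0.
Proof. by rewrite /p /proj_im -scalemxAl -mulmxA PE mulmx0 scaler0. Qed.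

Lemma proj_kerE : r *m E = 0.
Proof. by rewrite /r /proj_ker !mulmxBl mul1mx -mulmxA XE mulmx1 subrr proj_imE subr0. Qed.

Lemma proj_kerT : r *m T = 0.
Proof. by rewrite /r /proj_ker !mulmxBl mul1mx -mulmxA XT mulmx0 subr0 proj_imT subrr. Qed.

Lemma proj_ker_fix m (u : 'M[R]_(m, d)) : u *m E = 0 -> u *m T = 0 -> u *m r = u.
Proof.
move=> uE uT; rewrite /r /proj_ker /proj_im !mulmxBr mulmx1 mulmxA uE mul0mx subr0.
by rewrite -scalemxAr mulmxA uT mul0mx scaler0 subr0.
Qed.

Lemma proj_ker_sub m (u : 'M[R]_(m, d)) : (u <= r)%MS -> u *m E = 0 /\ u *m T = 0.
Proof. by case/submxP => v ->; rewrite -!mulmxA proj_kerE proj_kerT !mulmx0. Qed.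

Lemma proj_ker_id : r *m r = r.
Proof. exact: proj_ker_fix proj_kerE proj_kerT. Qed.

Lemma proj_ker_im : r *m p = 0.
Proof. by rewrite /p /proj_im -scalemxAr mulmxA proj_kerT mul0mx scaler0. Qed.

Lemma P_proj_ker : P *m r = r *m P.
Proof.
rewrite /r /proj_ker !mulmxBr !mulmxBl mulmx1 mul1mx mulmxA PE mul0mx -mulmxA XP.
by rewrite mulmx0 P_proj_im proj_imP.
Qed.

(** The identity is r + p + E X, and E X has rank at most 1. *)
Lemma rank_proj_ker h : (\rank p <= h)%N -> (d <= \rank r + h.+1)%N.
Proof.
move=> hp; rewrite -[X in (X <= _)%N](mxrank1 R d).
have -> : 1%:M = r + (p + E *m X) by rewrite /r /proj_ker addrA !subrK.
apply: leq_trans (mxrank_add _ _) _; rewrite leq_add2l -(addn1 h).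
apply: leq_trans (mxrank_add _ _) _; rewrite leq_add //.
exact: leq_trans (mxrankM_maxr _ _) (rank_leq_row _).
Qed.

Lemma rank_proj_im_ker : (\rank r + \rank p <= d)%N.
Proof. exact: mulmx0_rank_max proj_ker_im. Qed.

Section Rank.
Variable w : 'rV[R]_d -> 'rV[R]_d -> R.
Hypothesis wE : forall u v, w u v = 2^-1 * g u (v *m T).

Lemma w_skew u v : w u v = - w v u.
Proof. by rewrite !wE gT mulrN. Qed.

Lemma w_scalar u : scalar (w u).
Proof. by move=> c v v'; rewrite !wE mulmxDl -scalemxAl g_lin; ring. Qed.

Lemma w_scalarl v : scalar (fun u => w u v).
Proof. by move=> c u u'; rewrite w_skew w_scalar ![w v _]w_skew; ring. Qed.

Lemma w_kerr u v : v *m T = 0 -> w u v = 0.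
Proof. by rewrite wE => ->; rewrite g0r mulr0. Qed.

Lemma w_kerl u v : u *m T = 0 -> w u v = 0.
Proof. by rewrite w_skew => /w_kerr ->; rewrite oppr0. Qed.

Lemma ker_proj_im (u : 'rV_d) : u *m p = 0 -> u *m T = 0.
Proof. by move=> up; rewrite -proj_imT mulmxA up mul0mx. Qed.

(** Together with [rank_proj_im_le] this reads the rank of p off the powers of w, which stands for d
    eta. The kernel of p lies in that of w, so powers of w beyond the rank of p vanish. *)
Lemma rank_proj_im_ge h v : wpow (of2 w) h v != 0 -> (h * 2 <= \rank p)%N.
Proof.
apply: contraR; rewrite -ltnNge => hr; apply/eqP.
apply: (wpow_rank_eq0 _ w_scalar w_scalarl _ _ hr) => u u' /ker_proj_im.
  exact: w_kerl.
exact: w_kerr.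
Qed.

Lemma linear_mulmxr (A : 'M[R]_d) : linear (fun u : 'rV_d => u *m A).
Proof. by move=> c u v; rewrite mulmxDl scalemxAl. Qed.

(** On the image of p the form w is k/2 times the fundamental form, so its power of order h + 1
    would be nonzero if that image had dimension above 2h. *)
Lemma rank_proj_im_le h : (forall v, wpow (of2 w) h.+1 v = 0) -> (\rank p <= h * 2)%N.
Proof.
move=> h0; rewrite leqNgt; apply/negP => hr.
have pfix (u : 'rV_d) : (u <= p)%MS -> u *m p = u /\ u *m E = 0.
  by case/submxP => v ->; rewrite -!mulmxA proj_im_id proj_imE mulmx0.
have [||||||v _] := @wpow_neq0 R d g (mulmx^~ P) h.+1 p w (k / 2) g_lin g_sym g_pos
  (linear_mulmxr P) _ _ _ _ w_skew _ _; last by rewrite h0 eqxx.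
- move=> u /pfix[<- _]; rewrite -mulmxA proj_imP -[T]T_proj_im scalemxAl mulmxA.
  exact: submxMl.
- by move=> u /pfix[_ uE]; rewrite vPP uE mx00 scale0r sub0r.
- by move=> u v /pfix[_ uE] _; rewrite gPP uE mx00 mul0r subr0.
- lia.
- by rewrite mulf_neq0 // invr_neq0 // pnatr_eq0.
move=> u v _ /pfix[<- _]; rewrite wE -!mulmxA proj_imT proj_imP -scalemxAr gZr.
by field.
Qed.
End Rank.

Section SymplecticPart.
Variables (h m : nat) (th : 'rV[R]_d -> 'rV[R]_d -> R).
Hypothesis dE : d = (1 + h * 2 + m * 2)%N.
Hypothesis rp : \rank p = (h * 2)%N.
Hypothesis thE : forall u v, th u v = g u (v *m r *m P).

(** The projection [proj_ker] is self-adjoint and commutes with the skew P. *)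
Lemma th_skew u v : th u v = - th v u.
Proof.
rewrite !thE -!mulmxA -P_proj_ker mulmxA.
have gp u' v' : g u' (v' *m p) = g (u' *m p) v'.
  rewrite /p /proj_im -!scalemxAr gZr gZl -{1}TP_comm !mulmxA; congr (_ * _).
  by rewrite gT g_sym g_skewP opprK g_sym.
have gr u' v' : g u' (v' *m r) = g (u' *m r) v'.
  rewrite /r /proj_ker !(mulmxBr, mulmxBl) !mulmx1 -/p !gDr !gNr !gDl !gNl gp !mulmxA.
  rewrite [v' *m E]mx11_scalar [u' *m E]mx11_scalar !mul_scalar_mx gZr gZl.
  by rewrite g_xi (g_sym X) g_xi [X in _ - X - _]mulrC.
by rewrite gr g_skewP -mulmxA -P_proj_ker mulmxA.
Qed.

Lemma th_scalar u : scalar (th u).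
Proof. by move=> c v v'; rewrite !thE !(mulmxDl, g_lin) -!scalemxAl g_lin. Qed.

Lemma th_scalarl v : scalar (fun u => th u v).
Proof. by move=> c u u'; rewrite th_skew th_scalar ![th v _]th_skew; ring. Qed.

Lemma th_kerr u v : v *m r = 0 -> th u v = 0.
Proof. by rewrite thE => ->; rewrite mul0mx g0r. Qed.

Lemma th_kerl u v : u *m r = 0 -> th u v = 0.
Proof. by rewrite th_skew => /th_kerr ->; rewrite oppr0. Qed.

Lemma th_pow_eq0 v : wpow (of2 th) m.+1 v = 0.
Proof.
apply: (wpow_rank_eq0 _ th_scalar th_scalarl (A := r)).
- exact: th_kerl.
- exact: th_kerr.
(* The ranks give \rank r <= 2m + 1, which is already below 2(m + 1). *)
by have := rank_proj_im_ker; rewrite rp {3}dE; lia.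
Qed.

Lemma th_pow_neq0 : exists2 v, (forall i, (v i <= r)%MS) & wpow (of2 th) m v != 0.
Proof.
have rfix (u : 'rV_d) : (u <= r)%MS -> u *m r = u /\ u *m E = 0.
  by case/submxP => v ->; rewrite -!mulmxA proj_ker_id proj_kerE mulmx0.
apply: (@wpow_neq0 R d g (mulmx^~ P) m r th 1 g_lin g_sym g_pos (linear_mulmxr P)).
- by move=> u /rfix[<- _]; rewrite -mulmxA -P_proj_ker mulmxA submxMl.
- by move=> u /rfix[_ uE]; rewrite vPP uE mx00 scale0r sub0r.
- by move=> u v /rfix[_ uE] _; rewrite gPP uE mx00 mul0r subr0.
- have := @rank_proj_ker (h * 2); rewrite rp => /(_ (leqnn _)); have := dE; lia.
- exact: th_skew.
- exact: oner_neq0.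
by move=> u v _ /rfix[vr _]; rewrite thE vr mul1r.
Qed.

(** The form is evaluated on Xb, on vectors z derived from v0 and on vectors v1 of the image of r.
    The 1-form Eb vanishes on z and v1, and wb vanishes when an argument is in v1, so the block
    criterion applies twice. *)
Lemma volume_neq0 (Eb : 'cV[R]_d) (Xb : 'rV[R]_d) (wb : 'rV[R]_d -> 'rV[R]_d -> R) v0 :
  Xb *m Eb = 1%:M -> Xb *m r = 0 -> (forall u, scalar (wb u)) ->
  (forall u v, wb u v = - wb v u) ->
  (forall u, wb u Xb = 0) -> (forall u v, (v <= r)%MS -> wb u v = 0) ->
  r *m Eb = 0 -> wpow (of2 wb) h v0 != 0 ->
  exists v, wedge (of1 (fun u => (u *m Eb) 0 0))
    (wedge (wpow (of2 wb) h) (wpow (of2 th) m)) v != 0.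
Proof.
move=> XbEb Xbr wbl wbs wbX wbr rEb v0n.
have [v1 v1r v1n] := th_pow_neq0.
have wbN u : wb u 0 = 0 by apply: wbr; exact: sub0mx.
have wbD u v v' : wb u (v + v') = wb u v + wb u v' by rewrite -[v]scale1r wbl mul1r scale1r.
have wbZ u c v : wb u (c *: v) = c * wb u v by rewrite -[c *: v]addr0 wbl wbN addr0.
(* The components in the image of r and along Xb are in the kernel of wb; removing them keeps the
   Gram matrix of wb and brings z into the kernel of Eb. *)
pose z i := v0 i - v0 i *m r - (v0 i *m Eb) 0 0 *: Xb.
have zw u i : wb u (z i) = wb u (v0 i).
  rewrite /z !wbD -scaleNr wbZ wbX mulr0 addr0 -scaleN1r wbZ.
  by rewrite (wbr u (v0 i *m r)) ?submxMl // mulr0 addr0.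
have zr i : z i *m r = 0.
  by rewrite /z !mulmxBl -mulmxA proj_ker_id subrr -scalemxAl Xbr scaler0 subr0.
have zE i : z i *m Eb = 0.
  rewrite /z !mulmxBl -mulmxA rEb mulmx0 subr0 -scalemxAl XbEb.
  by rewrite scalemx1 -mx11_scalar subrr.
have zn : wpow (of2 wb) h z != 0.
  rewrite -(@wpow_gram _ _ wb wb h v0) // => i j.
  by rewrite zw wbs [in RHS]wbs zw.
pose v (i : 'I_(1 + (h * 2 + m * 2))) := match fintype.split i with
  | inl _ => Xb
  | inr j => match fintype.split j with inl i1 => z i1 | inr i2 => v1 i2 end
  end.
have vl i : v (lshift _ i) = Xb.
  by rewrite /v -[lshift _ _]/(unsplit (inl _)) unsplitK.
have vm i : v (rshift _ (lshift _ i)) = z i.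
  rewrite /v -[rshift _ _]/(unsplit (inr _)) unsplitK.
  by rewrite -[lshift _ _]/(unsplit (inl _)) unsplitK.
have vr i : v (rshift _ (rshift _ i)) = v1 i.
  rewrite /v -[rshift _ _]/(unsplit (inr _)) unsplitK.
  by rewrite -[rshift _ _]/(unsplit (inr _)) unsplitK.
have v1Eb i : v1 i *m Eb = 0.
  by have /submxP[y ->] := v1r i; rewrite -mulmxA rEb mulmx0.
exists v; apply: wedge_block_neq0.
- move=> w t; have -> : t = 1%g by apply/permP => i; rewrite !ord1.
  by rewrite /of1 perm1 odd_perm1 mul1r.
- exact: wedge_alternating.
- move=> u [i [j]]; rewrite /of1 ord1 => ->.
  by case: (split_ordP j) => j' ->; rewrite ?vm ?vr ?zE ?v1Eb mx00.
- by rewrite /of1 vl XbEb mxE oner_eq0.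
apply: wedge_block_neq0.
- exact: wpow_alternating.
- exact: wpow_alternating.
- move=> u [i [j uij]].
  (* A vector of v1 pairs to 0 with everything under wb, so it may be replaced by the zero
     vector. *)
  rewrite (@wpow_gram _ _ wb wb h _ (upd (fun x => v (rshift 1 (u x))) i 0)).
    have -> : 0 = \sum_(i < 0) (0 : R) *: (0 : 'rV[R]_d) by rewrite big_ord0.
    rewrite multilinear_sum ?big_ord0 //; apply: wpow_multilinear.
    apply: of2_multilinear => // x c y y'.
    by rewrite wbs wbl ![wb x _]wbs; ring.
  have k1 y x : x = i -> wb y (v (rshift 1 (u x))) = 0.
    by move=> ->; rewrite uij vr wbr.
  move=> x y; rewrite /upd; case: eqP => [/k1 hx|_]; case: eqP => [/k1 hy|_] //.
  + by rewrite hy wbN.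
  + by rewrite wbs hx wbs wbN.
  + by rewrite hy wbN.
- by rewrite (_ : (fun i => _) = z) //; apply: funext => i; rewrite vm.
by rewrite (_ : (fun i => _) = v1) //; apply: funext => i; rewrite vr.
Qed.
End SymplecticPart.
End Point.

(** * The algebra of 3-quasi-Sasakian structures *)

Section Derivations.
Variables (K : comPzRingType) (d : nat) (der : 'I_d -> K -> K).
Hypothesis derD : forall i a b, der i (a + b) = der i a + der i b.
Hypothesis derM : forall i a b, der i (a * b) = der i a * b + a * der i b.
Hypothesis derC : forall i j a, der i (der j a) = der j (der i a).

Lemma der0 i : der i 0 = 0.
Proof. by apply: (addrI (der i 0)); rewrite -derD !addr0. Qed.

Lemma derN i a : der i (- a) = - der i a.
Proof. by apply: (addrI (der i a)); rewrite -derD !subrr der0. Qed.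

Lemma derB i a b : der i (a - b) = der i a - der i b.
Proof. by rewrite derD derN. Qed.

Lemma der1 i : der i 1 = 0.
Proof.
have := derM i 1 1; rewrite !mulr1 mul1r => h.
by apply: (addrI (der i 1)); rewrite addr0 -h.
Qed.

Lemma der_sum i (I : finType) (f : I -> K) : der i (\sum_j f j) = \sum_j der i (f j).
Proof.
elim/big_rec2: _ => [|j x y _ <-]; first exact: der0.
by rewrite derD.
Qed.

(** The second-order terms are symmetric because the derivations commute, and cancel. *)
Lemma bracket_der (X Y : 'I_d -> K) (t : K) :
  \sum_i X i * der i (\sum_j Y j * der j t) - \sum_i Y i * der i (\sum_j X j * der j t)
  = \sum_j (\sum_i X i * der i (Y j) - \sum_i Y i * der i (X j)) * der j t.
Proof.
have e (A B : 'I_d -> K) : \sum_i A i * der i (\sum_j B j * der j t) =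
    \sum_j (\sum_i A i * der i (B j)) * der j t
    + \sum_i \sum_j A i * B j * der i (der j t).
  under eq_bigr do rewrite der_sum mulr_sumr.
  under [X in X + _]eq_bigr do rewrite mulr_suml.
  rewrite [X in X + _]exchange_big -big_split /=; apply: eq_bigr => i _.
  rewrite -big_split /=; apply: eq_bigr => j _.
  by rewrite derM mulrDr !mulrA.
rewrite (e X Y) (e Y X).
have -> : \sum_i \sum_j X i * Y j * der i (der j t) =
          \sum_i \sum_j Y i * X j * der i (der j t).
  rewrite exchange_big; apply: eq_bigr => i _; apply: eq_bigr => j _.
  by rewrite (derC j i) (mulrC (X j)).
rewrite opprD addrACA subrr addr0 -sumrB; apply: eq_bigr => j _.
by rewrite mulrBl.
Qed.

(** With f an evaluation and t a coordinate of a transition map, this expresses the chart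
    independence of the bracket. *)
Lemma bracket_der_morph (S : comPzRingType) (f : {rmorphism K -> S})
    (X Y : 'I_d -> K) (t : K) :
  \sum_i f (X i) * f (der i (\sum_j Y j * der j t))
    - \sum_i f (Y i) * f (der i (\sum_j X j * der j t))
  = \sum_j (\sum_i f (X i) * f (der i (Y j)) - \sum_i f (Y i) * f (der i (X j))) * f (der j t).
Proof.
have h (A B : 'I_d -> K) : f (\sum_i A i * B i) = \sum_i f (A i) * f (B i).
  by rewrite rmorph_sum; apply: eq_bigr => i _; rewrite rmorphM.
rewrite -!h -rmorphB bracket_der h; apply: eq_bigr => j _.
by rewrite rmorphB !h.
Qed.

Definition dmx m n i (A : 'M[K]_(m, n)) := map_mx (der i) A.

Lemma dmx_mul m n p i (A : 'M[K]_(m, n)) (B : 'M[K]_(n, p)) :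
  dmx i (A *m B) = dmx i A *m B + A *m dmx i B.
Proof.
apply/matrixP => a b; rewrite !mxE der_sum -big_split /=.
by apply: eq_bigr => j _; rewrite derM !mxE.
Qed.

Definition dirmx m n (X : 'rV[K]_d) (A : 'M[K]_(m, n)) := \sum_i X 0 i *: dmx i A.

Definition jac (X : 'rV[K]_d) : 'M[K]_d := \matrix_(i, j) der i (X 0 j).

Definition grad (k : K) : 'cV[K]_d := \col_i der i k.

Lemma dirmxE m n X (A : 'M[K]_(m, n)) a b : dirmx X A a b = \sum_i X 0 i * der i (A a b).
Proof. by rewrite summxE; apply: eq_bigr => i _; rewrite !mxE. Qed.

Lemma dirmx_mul m n p X (A : 'M[K]_(m, n)) (B : 'M[K]_(n, p)) :
  dirmx X (A *m B) = dirmx X A *m B + A *m dirmx X B.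
Proof.
rewrite /dirmx mulmx_suml mulmx_sumr -big_split /=; apply: eq_bigr => i _.
by rewrite dmx_mul scalerDr scalemxAl scalemxAr.
Qed.

(* The Lie derivative along X of a tensor whose row and column indices transform
   with the matrices a and b: with J = jac X, these are (J, J) for endomorphisms,
   (0, J) for vector fields, (J, 0) for 1-forms and (J, -J^T) for bilinear forms. *)
Definition lie_mx m n X (a : 'M[K]_m) (b : 'M[K]_n) (A : 'M[K]_(m, n)) :=
  locked (dirmx X A + a *m A - A *m b).

(** The contracted index contributes - A b B from the first factor and A b B from the second. One
    Leibniz rule thus covers compositions, contractions and outer products of all tensor types. *)
Lemma lie_mx_mul m n p X a b c (A : 'M[K]_(m, n)) (B : 'M[K]_(n, p)) :
  lie_mx X a c (A *m B) = lie_mx X a b A *m B + A *m lie_mx X b c B.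
Proof.
rewrite /lie_mx -!lock dirmx_mul !mulmxBl !mulmxBr !mulmxDl !mulmxDr -!mulmxA.
have e (V : zmodType) (x y z u w : V) : x + y + z - w = (x + z - u) + (y + u - w).
  by rewrite (addrC y u) -!addrA addKr (addrCA y).
exact: e.
Qed.

Lemma lie_mx_tr m n X a b (A : 'M[K]_(m, n)) :
  (lie_mx X a b A)^T = lie_mx X (- b^T) (- a^T) A^T.
Proof.
have e : (dirmx X A)^T = dirmx X A^T.
  by apply/matrixP => i j; rewrite mxE !dirmxE; apply: eq_bigr => l _; rewrite mxE.
by rewrite /lie_mx -!lock !linearB /= linearD /= !trmx_mul e mulNmx mulmxN opprK addrAC.
Qed.

Lemma lie_mxD m n X a b (A B : 'M[K]_(m, n)) :
  lie_mx X a b (A + B) = lie_mx X a b A + lie_mx X a b B.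
Proof.
have e : dirmx X (A + B) = dirmx X A + dirmx X B.
  apply/matrixP => i j; rewrite [RHS]mxE !dirmxE -big_split; apply: eq_bigr => l _.
  by rewrite mxE derD mulrDr.
by rewrite /lie_mx -!lock e mulmxDl mulmxDr opprD (addrACA (dirmx X A)) [LHS]addrACA.
Qed.

Lemma lie_mx0 m n X a b : lie_mx X a b (0 : 'M[K]_(m, n)) = 0.
Proof. by apply: (addrI (lie_mx X a b 0)); rewrite -lie_mxD !addr0. Qed.

Lemma lie_mxN m n X a b (A : 'M[K]_(m, n)) : lie_mx X a b (- A) = - lie_mx X a b A.
Proof. by apply: (addrI (lie_mx X a b A)); rewrite -lie_mxD !subrr lie_mx0. Qed.

Lemma lie_mxB m n X a b (A B : 'M[K]_(m, n)) :
  lie_mx X a b (A - B) = lie_mx X a b A - lie_mx X a b B.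
Proof. by rewrite lie_mxD lie_mxN. Qed.

Lemma lie_mxZ m n X a b k (A : 'M[K]_(m, n)) :
  lie_mx X a b (k *: A) = (X *m grad k) 0 0 *: A + k *: lie_mx X a b A.
Proof.
rewrite /lie_mx -!lock scalerBr scalerDr !addrA -scalemxAl -scalemxAr; congr (_ + _ - _).
apply/matrixP => i j; rewrite !(mxE, dirmxE) mulr_suml mulr_sumr -big_split.
by apply: eq_bigr => l _; rewrite !mxE derM /=; ring.
Qed.

Definition lieV X (Y : 'rV[K]_d) := lie_mx X 0 (jac X) Y.
Definition lieP X (P : 'M[K]_d) := lie_mx X (jac X) (jac X) P.
Definition lieE X (E : 'cV[K]_d) := lie_mx X (jac X) 0 E.
Definition lieG X (G : 'M[K]_d) := lie_mx X (jac X) (- (jac X)^T) G.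

Lemma lieV_jac X Y : lieV X Y = X *m jac Y - Y *m jac X.
Proof.
rewrite /lieV /lie_mx -lock mul0mx addr0; congr (_ - _).
by apply/matrixP => i j; rewrite !ord1 dirmxE mxE; apply: eq_bigr => l _; rewrite mxE.
Qed.

Lemma lieV_anti X Y : lieV X Y = - lieV Y X.
Proof. by rewrite !lieV_jac opprB. Qed.

Lemma lieV_id X : lieV X X = 0.
Proof. by rewrite lieV_jac subrr. Qed.

Lemma lieG_mulT X G P : lieG X (G *m P^T) = lieG X G *m P^T + G *m (lieP X P)^T.
Proof. by rewrite lie_mx_tr -lie_mx_mul. Qed.

Lemma lieE_mulT X G Y : lieE X (G *m Y^T) = lieG X G *m Y^T + G *m (lieV X Y)^T.
Proof. by rewrite lie_mx_tr trmx0 oppr0 -lie_mx_mul. Qed.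

Definition dd (E : 'cV[K]_d) : 'M[K]_d := \matrix_(i, j) (der i (E j 0) - der j (E i 0)).

Definition closed_mx (B : 'M[K]_d) := forall i j l,
  der i (B j l) + der j (B l i) + der l (B i j) = 0.

Lemma dd_closed E : closed_mx (dd E).
Proof.
move=> i j l; rewrite !mxE !derB (derC j i) (derC l j) (derC l i); ring.
Qed.

Lemma dd_tr E : (dd E)^T = - dd E.
Proof. by apply/matrixP => i j; rewrite !mxE opprB. Qed.

Lemma dd0 : dd 0 = 0.
Proof. by apply/matrixP => i j; rewrite !mxE !der0 subrr. Qed.

Lemma ddN E : dd (- E) = - dd E.
Proof. by apply/matrixP => i j; rewrite !mxE !derN -opprD opprB addrC. Qed.

Lemma ddZ k E : dd (k *: E) = k *: dd E + grad k *m E^T - E *m (grad k)^T.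
Proof.
apply/matrixP => i j; rewrite !mxE !big_ord1 !mxE !derM; ring.
Qed.

Lemma closed_mx_scale (k : K) (W A B : 'M[K]_d) : (forall i, der i k = 0) ->
  k *: W = k *: A - B -> closed_mx A -> closed_mx B -> closed_mx (k *: W).
Proof.
move=> k0 -> cA cB i j l; rewrite !mxE !derB !derM !k0 !mul0r !add0r.
have -> (a b c a' b' c' : K) : k * a - a' + (k * b - b') + (k * c - c') =
    k * (a + b + c) - (a' + b' + c') by ring.
by rewrite cA cB mulr0 subr0.
Qed.

(** Cartan's formula L_X = d i_X + i_X d, whose second term is 0 on a closed form. *)
Lemma cartan_2form X B : closed_mx B -> B^T = - B -> lieG X B = dd (X *m B)^T.
Proof.
move=> cB sB; have sk i j : B i j = - B j i by rewrite -[in LHS](trmxK B) sB !mxE.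
apply/matrixP => i j; rewrite /lieG /lie_mx -lock mulmxN opprK !(mxE, dirmxE) !der_sum.
rewrite -!big_split -sumrB /=; apply: eq_bigr => l _; rewrite !mxE !derM.
have := cB l i j; rewrite (sk j l) derN => e; rewrite (sk i l).
have -> : der l (B i j) = der i (B l j) - der j (B l i).
  by apply/eqP; rewrite -subr_eq0 -[X in _ == X]e; apply/eqP; ring.
ring.
Qed.

(** Cartan's formula again: E(X) = 1 has zero differential, and the sign comes from X standing in
    the second argument of [dd]. *)
Lemma cartan_1form X E : X *m E = 1%:M -> lieE X E = - (dd E *m X^T).
Proof.
move=> XE; apply/matrixP => i j; rewrite !ord1 /lieE /lie_mx -lock mulmx0 subr0.
have h : \sum_l (der i (X 0 l) * E l 0 + X 0 l * der i (E l 0)) = 0.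
  transitivity (der i ((X *m E) 0 0)); last by rewrite XE mxE der1.
  by rewrite mxE der_sum; apply: eq_bigr => l _; rewrite derM.
rewrite !(mxE, dirmxE) -big_split -sumrN /=; apply/eqP; rewrite -subr_eq0 -sumrB.
apply/eqP; rewrite -[RHS]h; apply: eq_bigr => l _; rewrite !mxE; ring.
Qed.

(* The even permutations of three indices are the cyclic shifts of Z/3. *)
Definition cyc (a b c : 'I_3) := (b == a + 1) && (c == a + 2%:R).

Lemma cyc_rot a b c : cyc a b c -> cyc b c a.
Proof. by case/andP => /eqP-> /eqP->; case: a => [[|[|[|]]]]. Qed.

Lemma cycE a b c : cyc a b c -> a = c + 1 /\ b = c + 2%:R.
Proof.
case/andP => /eqP-> /eqP->; case: a => [[|[|[|//]]] h];
  by split; apply/eqP.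
Qed.

(* Tangent vectors are row vectors: phi_a u = u *m P a, xi_a = X a, eta_a u = u *m E a
   and g(u, v) = u *m G *m v^T; then 2 d eta_a is dd (E a). *)
Section ThreeStructure.
Variables (P : 'I_3 -> 'M[K]_d) (X : 'I_3 -> 'rV[K]_d) (E : 'I_3 -> 'cV[K]_d).
Variable G : 'M[K]_d.
Hypothesis Gsym : G^T = G.
Hypothesis Gcan : forall m (A : 'M[K]_(d, m)), G *m A = 0 -> A = 0.
Hypothesis PP : forall a, P a *m P a = E a *m X a - 1%:M.
Hypothesis XE : forall a, X a *m E a = 1%:M.
Hypothesis XP : forall a, X a *m P a = 0.
Hypothesis PGP : forall a, P a *m G *m (P a)^T = G - E a *m (E a)^T.
Hypothesis normal : forall a,
  lieP (X a) (P a) *m P a + (dd (E a) *m (X a)^T) *m X a = 0.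
Hypothesis Phi_closed : forall a, closed_mx (G *m (P a)^T).
Hypothesis tri : forall a b c, cyc a b c ->
  [/\ P c = P b *m P a - E b *m X a, P c = - (P a *m P b) + E a *m X b,
      X c = X b *m P a, X c = - (X a *m P b) &
      E c = P b *m E a /\ E c = - (P a *m E b)].

Lemma Gcan2 (A B : 'M[K]_d) : G *m A^T = G *m B^T -> A = B.
Proof.
move=> e; apply: (can_inj (@trmxK _ _ _)).
by apply/eqP; rewrite -subr_eq0; apply/eqP/Gcan; rewrite mulmxBr e subrr.
Qed.

(** P commutes with P^2 = E X - 1, so P E X = E X P = 0, and X E = 1 cancels X. *)
Lemma P_E0 a : P a *m E a = 0.
Proof.
have : P a *m (P a *m P a) = P a *m P a *m P a by rewrite mulmxA.
rewrite PP mulmxBr mulmxBl mulmx1 mul1mx -[E a *m X a *m _]mulmxA XP mulmx0 => /eqP.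
rewrite subr_eq subrK mulmxA => /eqP h.
by rewrite -[LHS]mulmx1 -(XE a) mulmxA h mul0mx.
Qed.

Lemma EXG a : E a = G *m (X a)^T.
Proof.
have := congr1 (mulmx (X a)) (PGP a); rewrite !mulmxA XP !mul0mx mulmxBr mulmxA XE mul1mx.
by move/esym/eqP; rewrite subr_eq0 => /eqP h; rewrite -[LHS]trmxK -h trmx_mul Gsym.
Qed.

Lemma XG a : X a *m G = (E a)^T.
Proof. by rewrite EXG trmx_mul trmxK Gsym. Qed.

Lemma PG a : P a *m G = - (G *m (P a)^T).
Proof.
have := congr1 (mulmx (P a)) (PGP a).
rewrite mulmxBr [P a *m (E a *m _)]mulmxA P_E0 mul0mx subr0 !mulmxA PP => <-.
rewrite !mulmxBl mul1mx -[E a *m X a *m G]mulmxA XG -mulmxA -trmx_mul P_E0 trmx0.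
by rewrite mulmx0 sub0r.
Qed.

(** The hypothesis [normal] is normality with xi_a as second argument; applying eta_a to it kills
    the first term, as eta_a phi_a = 0. *)
Lemma ddE_X a : dd (E a) *m (X a)^T = 0.
Proof.
have := congr1 (mulmxr (E a)) (normal a).
by rewrite /= mulmxDl -!mulmxA P_E0 mulmx0 add0r XE mulmx1 mul0mx.
Qed.

Lemma lieE_self a : lieE (X a) (E a) = 0.
Proof. by rewrite cartan_1form // ddE_X oppr0. Qed.

(** By [ddE_X] normality reads (L phi) P = 0, so L phi = (L phi) E X by P^2 = E X - 1.
    Differentiating P E = 0, where L E = 0, gives (L phi) E = 0. *)
Lemma lieP_self a : lieP (X a) (P a) = 0.
Proof.
have := normal a; rewrite ddE_X mul0mx addr0 => h.
have : lieP (X a) (P a) *m (P a *m P a) = 0 by rewrite mulmxA h mul0mx.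
rewrite PP mulmxBr mulmx1 mulmxA => /eqP; rewrite subr_eq0 => /eqP <-.
have : lieE (X a) (P a *m E a) = 0 by rewrite P_E0 /lieE lie_mx0.
by rewrite /lieE (lie_mx_mul _ _ (jac (X a))) -/(lieE _ _) lieE_self mulmx0 addr0 => ->; rewrite mul0mx.
Qed.

Lemma Phi_skew a : (G *m (P a)^T)^T = - (G *m (P a)^T).
Proof. by rewrite trmx_mul trmxK Gsym PG. Qed.

(** Cartan's formula for the closed form Phi_b, whose contraction with xi_a is eta_a phi_b. *)
Lemma lieG_Phi a b : lieG (X a) (G *m (P b)^T) = dd (P b *m E a).
Proof.
rewrite cartan_2form; [|exact: Phi_closed|exact: Phi_skew].
by rewrite mulmxA XG trmx_mul !trmxK.
Qed.

(** The Killing property. L g vanishes against the image of phi_a because Phi_a and phi_a are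
    preserved, and against xi_a because eta_a and xi_a are; by P^2 = E X - 1 these directions
    span. *)
Lemma lieG_G a : lieG (X a) G = 0.
Proof.
have h : lieG (X a) G *m (P a)^T = 0.
  have := lieG_Phi a a; rewrite P_E0 dd0 lieG_mulT lieP_self trmx0 mulmx0 addr0.
  by [].
have h2 : lieG (X a) G *m (X a)^T = 0.
  have := lieE_self a; rewrite EXG lieE_mulT lieV_id trmx0 mulmx0 addr0.
  by [].
have := congr1 (mulmxr (P a)^T) h; rewrite /= mul0mx -mulmxA -trmx_mul PP.
rewrite linearB /= trmx1 mulmxBr mulmx1 trmx_mul mulmxA h2 mul0mx sub0r.
by move/eqP; rewrite oppr_eq0 => /eqP.
Qed.

Definition Tmx (c : 'I_3) := lieP (X (c + 1)) (P (c + 2%:R)).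

Lemma lieP_T a b c : cyc a b c -> lieP (X a) (P b) = Tmx c.
Proof. by move=> /cycE[-> ->]. Qed.

Lemma lieG_lieP a b : dd (P b *m E a) = G *m (lieP (X a) (P b))^T.
Proof. by rewrite -lieG_Phi lieG_mulT lieG_G mul0mx add0r. Qed.

(** Since eta_c = eta_a phi_b for (a, b, c) cyclic, 2 d eta_c is the Lie derivative of Phi_b along
    the Killing field xi_a. *)
Lemma ddE_T c : dd (E c) = G *m (Tmx c)^T.
Proof.
have h : cyc (c + 1) (c + 2%:R) c by case: c => [[|[|[|]]]].
by have [_ _ _ _ [-> _]] := tri h; rewrite lieG_lieP (lieP_T h).
Qed.

(** The other expression eta_c = - eta_b phi_a gives 2 d eta_c a second time, and nondegeneracy of G
    compares the two. *)
Lemma lieP_NT a b c : cyc a b c -> lieP (X b) (P a) = - Tmx c.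
Proof.
move=> h; apply: Gcan2; rewrite -lieG_lieP linearN /= mulmxN -ddE_T.
by have [_ _ _ _ [_ ->]] := tri h; rewrite ddN opprK.
Qed.

Lemma TG c : Tmx c *m G = - dd (E c).
Proof. by rewrite -dd_tr ddE_T trmx_mul trmxK Gsym. Qed.

Lemma XTself c : X c *m Tmx c = 0.
Proof.
apply: (can_inj (@trmxK _ _ _)); rewrite trmx0 trmx_mul; apply: Gcan.
by rewrite mulmxA -ddE_T ddE_X.
Qed.

Lemma X_E a b c : cyc a b c -> X c *m E a = 0 /\ X c *m E b = 0.
Proof.
move=> h; have [_ _ h3 h4 _] := tri h; split.
  by rewrite h3 -mulmxA P_E0 mulmx0.
by rewrite h4 mulNmx -mulmxA P_E0 mulmx0 oppr0.
Qed.

Lemma X_P a b c : cyc a b c -> X c *m P a = - X b /\ X c *m P b = X a.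
Proof.
move=> h; have [_ _ h3 h4 _] := tri h.
have [_ hb] := X_E (cyc_rot (cyc_rot h)); have [ha _] := X_E (cyc_rot h).
split.
  by rewrite h3 -mulmxA PP mulmxBr mulmx1 mulmxA hb mul0mx sub0r.
by rewrite h4 mulNmx -mulmxA PP mulmxBr mulmx1 mulmxA ha mul0mx sub0r opprK.
Qed.

Lemma lieE_E a b : lieE (X a) (E b) = G *m (lieV (X a) (X b))^T.
Proof. by rewrite EXG lieE_mulT lieG_G mul0mx add0r. Qed.

Lemma lieV_E a b : X b *m E a = 0 -> lieV (X a) (X b) *m E a = 0.
Proof.
move=> h; have : lie_mx (X a) 0 0 (X b *m E a) = 0 by rewrite h lie_mx0.
rewrite (lie_mx_mul _ _ (jac (X a))) -/(lieE _ _) lieE_self mulmx0 addr0.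
by [].
Qed.

Lemma lieV_P a b c : cyc a b c -> lieV (X c) (X a) = - (lieV (X a) (X b) *m P a).
Proof.
move=> h; rewrite lieV_anti; congr (- _); have [_ _ h3 _ _] := tri h.
rewrite h3 /lieV (lie_mx_mul _ _ (jac (X a))) -/(lieP _ _) lieP_self mulmx0 addr0.
by [].
Qed.

Definition kap a b c := (lieV (X a) (X b) *m E c) 0 0.

Lemma kap_rot a b c : cyc a b c -> kap a b c = kap c a b.
Proof.
move=> h; rewrite /kap (lieV_P h); have [_ _ _ _ [_ ->]] := tri h.
by rewrite mulmxN mulNmx mulmxA.
Qed.

(** Here and in [relation2] one of the two product formulas for phi_c is differentiated along xi_a,
    which preserves phi_a, xi_a and eta_a; the derivative of phi_c itself is - T_b. *)
Lemma relation1 a b c : cyc a b c ->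
  - Tmx b = Tmx c *m P a - lieE (X a) (E b) *m X a.
Proof.
move=> h; rewrite -(lieP_NT (cyc_rot (cyc_rot h))); have [-> _ _ _ _] := tri h.
rewrite /lieP lie_mxB (lie_mx_mul _ _ (jac (X a))) -/(lieP _ _) (lieP_T h).
rewrite -/(lieP _ _) lieP_self mulmx0 addr0 (lie_mx_mul _ _ 0).
by rewrite -/(lieE _ _) -/(lieV _ _) lieV_id mulmx0 addr0.
Qed.

Lemma relation2 a b c : cyc a b c ->
  - Tmx b = - (P a *m Tmx c) + E a *m lieV (X a) (X b).
Proof.
move=> h; rewrite -(lieP_NT (cyc_rot (cyc_rot h))); have [_ -> _ _ _] := tri h.
rewrite /lieP lie_mxD lie_mxN (lie_mx_mul _ _ (jac (X a))) -/(lieP _ _) (lieP_self a).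
rewrite -/(lieP _ _) (lieP_T h) mul0mx add0r (lie_mx_mul _ _ 0).
by rewrite -/(lieE _ _) -/(lieV _ _) lieE_self mul0mx add0r.
Qed.

(** The vector xi_c T_b is computed twice: by [relation1] it is a multiple of xi_a, and xi_c P_c = 0
    differentiated along xi_a makes it - [xi_c, xi_a] P_c. Applying P_c once more recovers the
    bracket, which is orthogonal to xi_c. *)
Lemma lieV_kap a b c : cyc a b c -> lieV (X c) (X a) = kap a b c *: X b.
Proof.
move=> h; have h1 := cyc_rot h; have h2 := cyc_rot h1.
have e1 : X c *m Tmx b = kap a b c *: X a.
  have := congr1 (mulmx (X c)) (relation1 h).
  rewrite mulmxN mulmxBr !mulmxA XTself mul0mx sub0r => /oppr_inj ->.
  rewrite lieE_E mulmxA XG -trmx_mul [_ *m E c]mx11_scalar tr_scalar_mx.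
  by rewrite mul_scalar_mx.
have e2 : X c *m Tmx b = - (lieV (X c) (X a) *m P c).
  have : lieV (X a) (X c *m P c) = 0 by rewrite XP /lieV lie_mx0.
  rewrite /lieV (lie_mx_mul _ _ (jac (X a))) -/(lieV _ _) -/(lieP _ _) (lieP_NT h2).
  rewrite lieV_anti mulNmx mulmxN => /eqP; rewrite addr_eq0 opprK => /eqP e.
  by rewrite -e.
have := congr1 (mulmxr (P c)) (etrans (esym e2) e1).
rewrite /= mulNmx -mulmxA PP mulmxBr mulmx1 mulmxA lieV_E; last first.
  by have [_] := X_E h1.
rewrite mul0mx sub0r opprK => ->; rewrite -scalemxAl.
by have [_ ->] := X_P h1.
Qed.

Let k := kap 0 1 2%:R.

Lemma kapE a b c : cyc a b c -> kap a b c = k.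
Proof.
move=> h; case/andP: (h) => /eqP eb /eqP ec; subst b c.
have c0 : cyc 0 1 2%:R by [].
have c1 := cyc_rot c0; have c2 := cyc_rot c1.
case: a h => [[|[|[|//]]] ha] h.
- have -> : Ordinal ha = 0 by apply/eqP.
  by rewrite !add0r.
- have -> : Ordinal ha = 1 by apply/eqP.
  have -> : 1 + 1 = 2%:R :> 'I_3 by [].
  have -> : 1 + 2%:R = 0 :> 'I_3 by apply/eqP.
  by rewrite /k (kap_rot c0) (kap_rot c2).
have -> : Ordinal ha = 2%:R by apply/eqP.
have -> : 2%:R + 1 = 0 :> 'I_3 by apply/eqP.
have -> : 2%:R + 2%:R = 1 :> 'I_3 by apply/eqP.
by rewrite /k (kap_rot c0).
Qed.

Lemma lieV_X a b c : cyc a b c -> lieV (X a) (X b) = k *: X c.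
Proof. by move=> h; rewrite -(kapE (cyc_rot h)) -lieV_kap //; exact: cyc_rot. Qed.

Lemma lieE_X a b c : cyc a b c -> lieE (X a) (E b) = k *: E c.
Proof. by move=> h; rewrite lieE_E (lieV_X h) linearZ /= -scalemxAr -EXG. Qed.

Lemma Tmx_l a b c : cyc a b c -> Tmx b = - (Tmx c *m P a) + k *: (E c *m X a).
Proof.
by move=> h; rewrite -[LHS]opprK (relation1 h) (lieE_X h) opprB addrC scalemxAl.
Qed.

Lemma Tmx_r a b c : cyc a b c -> Tmx b = P a *m Tmx c - k *: (E a *m X c).
Proof.
by move=> h; rewrite -[LHS]opprK (relation2 h) (lieV_X h) opprD opprK scalemxAr.
Qed.

(** The first identity comes from [Tmx_l], the second from xi_a P_a = 0 differentiated along
    xi_c. *)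
Lemma XT a b c : cyc a b c -> X c *m Tmx b = k *: X a /\ X a *m Tmx b = - (k *: X c).
Proof.
move=> h; have h1 := cyc_rot h; have h2 := cyc_rot h1; split.
  have hca := X_E h2; rewrite (Tmx_l h) mulmxDr mulmxN mulmxA XTself mul0mx oppr0 add0r.
  by rewrite -scalemxAr mulmxA XE mul1mx.
have : lieV (X c) (X a *m P a) = 0 by rewrite XP /lieV lie_mx0.
rewrite /lieV (lie_mx_mul _ _ (jac (X c))) -/(lieV _ _) -/(lieP _ _) (lieP_T h2).
rewrite (lieV_X h2) -scalemxAl => /eqP; rewrite addrC addr_eq0 => /eqP ->.
by have [_ _ <- _ _] := tri h.
Qed.

Lemma XddE a c : X a *m dd (E c) = - (X a *m Tmx c *m G).
Proof. by rewrite -mulmxA TG mulmxN opprK. Qed.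

(** Differentiate i_(xi_b) (2 d eta_c) = k eta_a along xi_a, which preserves eta_a. On the left the
    bracket k xi_c is in the kernel of d eta_c, and the Lie derivative of 2 d eta_c is - 2 d(k
    eta_b), where the derivatives of k appear. *)
Lemma grad_kE a b c : cyc a b c ->
  (X a *m grad k) 0 0 *: (E a)^T = (grad k)^T - (X b *m grad k) 0 0 *: (E b)^T.
Proof.
move=> h; have h1 := cyc_rot h; have h2 := cyc_rot h1.
have [XaTc XbTc] := XT h1.
have XaF : X a *m dd (E c) = - (k *: (E b)^T).
  by rewrite XddE XaTc -scalemxAl XG.
have XbF : X b *m dd (E c) = k *: (E a)^T.
  by rewrite XddE XbTc mulNmx opprK -scalemxAl XG.
have XbFb : X b *m dd (E b) = 0 by rewrite XddE XTself mul0mx oppr0.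
have e1 : lieG (X a) (dd (E c)) = - dd (k *: E b).
  rewrite cartan_2form; [|exact: dd_closed|exact: dd_tr].
  by rewrite XaF linearN linearZ /= trmxK ddN.
have e2 : lie_mx (X a) 0 (- (jac (X a))^T) (X b *m dd (E c)) =
          (X a *m grad k) 0 0 *: (E a)^T.
  rewrite XbF lie_mxZ; have := lie_mx_tr (X a) (jac (X a)) 0 (E a).
  rewrite -/(lieE _ _) lieE_self !trmx0 oppr0 => <-.
  by rewrite scaler0 addr0.
rewrite -e2 (lie_mx_mul _ _ (jac (X a))) -/(lieV _ _) -/(lieG _ _) (lieV_X h) e1.
rewrite -scalemxAl XddE XTself mul0mx oppr0 scaler0 add0r.
rewrite mulmxN ddZ mulmxBr mulmxDr -scalemxAr XbFb scaler0 add0r !mulmxA XE mul1mx.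
by rewrite opprB [X in _ - X *m _]mx11_scalar mul_scalar_mx.
Qed.

(** On xi_c, where eta_a and eta_b vanish, [grad_kE] gives xi_c(k) = 0. By rotation the three
    derivatives vanish, and the formula reduces to dk = 0. *)
Lemma grad_k : grad k = 0.
Proof.
have step a b c : cyc a b c -> X c *m grad k = 0.
  move=> h; have := congr1 (mulmxr (X c)^T) (grad_kE h).
  have [ha hb] := X_E h; rewrite /= mulmxBl -!scalemxAl -!trmx_mul ha hb trmx0.
  by rewrite !scaler0 subr0 -[0 in LHS]trmx0 => /esym/trmx_inj.
have h : cyc 0 1 2%:R by [].
have := grad_kE h; rewrite (step _ _ _ (cyc_rot h)) (step _ _ _ (cyc_rot (cyc_rot h))).
by rewrite mxE !scale0r subr0 -[0 in LHS]trmx0 => /esym/trmx_inj.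
Qed.

(** By Cartan's formula the Lie derivative of 2 d eta_b along xi_a is 2 d(k eta_c), and dk = 0 takes
    k out of d; as g is preserved, this is a statement on T_b. *)
Lemma lieP_TT a b c : cyc a b c -> lieP (X a) (Tmx b) = k *: Tmx c /\ lieP (X a) (Tmx a) = 0.
Proof.
move=> h; have [_ XaTb] := XT h; split; apply: Gcan2.
  transitivity (lieG (X a) (dd (E b))).
    by rewrite ddE_T lieG_mulT lieG_G mul0mx add0r.
  rewrite cartan_2form; [|exact: dd_closed|exact: dd_tr].
  rewrite XddE XaTb mulNmx opprK -scalemxAl XG linearZ /= trmxK ddZ grad_k.
  by rewrite trmx0 mulmx0 mul0mx subr0 addr0 linearZ /= -scalemxAr -ddE_T.
transitivity (lieG (X a) (dd (E a))).
  by rewrite ddE_T lieG_mulT lieG_G mul0mx add0r.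
rewrite cartan_2form; [|exact: dd_closed|exact: dd_tr].
by rewrite XddE XTself mul0mx oppr0 !trmx0 dd0 mulmx0.
Qed.

Lemma cyc_ex b : exists a c, cyc a b c.
Proof. by exists (b + 2%:R), (b + 1); case: b => [[|[|[|]]]]. Qed.

(** Differentiate T_a = P_c T_b - k E_c X_b along xi_a, which kills T_a and turns phi_c into - T_b:
    this expresses T_b^2 through P_c T_c. *)
Lemma T_sqr b : Tmx b *m Tmx b = k *: (P b *m Tmx b).
Proof.
have [a [c h]] := cyc_ex b; have h1 := cyc_rot h; have h2 := cyc_rot h1.
have [LTb LTa] := lieP_TT h.
have eL : lieE (X a) (E c) = - (k *: E b).
  by rewrite lieE_E lieV_anti (lieV_X h2) linearN /= linearZ /= mulmxN -scalemxAr -EXG.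
have e : Tmx b *m Tmx b = k *: (P c *m Tmx c) + (k * k) *: (E b *m X b) - (k * k) *: (E c *m X c).
  have := LTa; rewrite (Tmx_r h2) /lieP lie_mxB (lie_mx_mul _ _ (jac (X a))).
  rewrite -/(lieP _ (P c)) -/(lieP _ (Tmx b)) LTb (lieP_NT h2) lie_mxZ grad_k mulmx0.
  rewrite [(0 : 'M[K]_1) 0 0]mxE scale0r add0r (lie_mx_mul _ _ 0) -/(lieE _ _) -/(lieV _ _).
  rewrite eL (lieV_X h) [- (k *: E b) *m _]mulNmx -!scalemxAr -scalemxAl scalerDr scalerN !scalerA mulNmx.
  move/eqP; rewrite -addrA addrC addr_eq0 opprK => /eqP <-.
  by rewrite opprD opprK addrA.
(* P_b T_b is expanded by T_b = P_a T_c - k E_a X_c and the quaternionic relation for P_b P_a; the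
   outer products then match those of [e]. *)
rewrite e (Tmx_r h) mulmxBr mulmxA -scalemxAr mulmxA.
have [e1 _ _ _ [eE _]] := tri h; rewrite -eE.
have -> : P b *m P a = P c + E b *m X a by rewrite e1 subrK.
rewrite mulmxDl -mulmxA; have [-> _] := XT h1.
by rewrite -scalemxAr scalerBr scalerDr !scalerA.
Qed.

Lemma XT_all a b : X a *m Tmx b = k *: (X a *m P b).
Proof.
have [->|ab] := eqVneq a b; first by rewrite XTself XP scaler0.
have [a' [c' h]] := cyc_ex b; have [e1 e2] := XT h; have [f1 f2] := X_P h.
have : a = a' \/ a = c'.
  case/cycE: h => ea eb; move: ab; rewrite ea {e1 e2 f1 f2 ea}.
  by case: a => [[|[|[|//]]] ha]; case: b eb => [[|[|[|//]]] hb] /eqP;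
    case: c' => [[|[|[|//]]] hc] // _ _; (by left; apply/eqP) || (by right; apply/eqP).
case=> ->; last by rewrite e1 f2.
by rewrite e2; have [_ _ _ -> _] := tri h; rewrite scalerN opprK.
Qed.

End ThreeStructure.
End Derivations.

(** * Passing between identities at points and identities of functions *)

Section Pointwise.
Variables (K : comPzRingType) (F : fieldType) (d : nat) (der : 'I_d -> K -> K).
Variables (S : Type) (f : S -> {rmorphism K -> F}).
Hypothesis derD : forall i a b, der i (a + b) = der i a + der i b.
Hypothesis derM : forall i a b, der i (a * b) = der i a * b + a * der i b.
Hypothesis derC : forall i j a, der i (der j a) = der j (der i a).
Hypothesis sep : forall k, (forall s, f s k = 0) -> k = 0.

Lemma map_mx_sep m n (A B : 'M[K]_(m, n)) :
  (forall s, map_mx (f s) A = map_mx (f s) B) -> A = B.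
Proof.
move=> h; apply/matrixP => i j; apply/eqP; rewrite -subr_eq0; apply/eqP/sep => s.
by have /matrixP/(_ i j) := h s; rewrite !mxE rmorphB => ->; rewrite subrr.
Qed.

Variables (P : 'I_3 -> 'M[K]_d) (X : 'I_3 -> 'rV[K]_d) (E : 'I_3 -> 'cV[K]_d).
Variable G : 'M[K]_d.
Let p s a := map_mx (f s) (P a).
Let x s a := map_mx (f s) (X a).
Let e s a := map_mx (f s) (E a).
Let g s := map_mx (f s) G.
Hypothesis Gsym : forall s, (g s)^T = g s.
Hypothesis Gunit : forall s (u : 'rV[F]_d), u *m g s = 0 -> u = 0.
Hypothesis PP : forall s a, p s a *m p s a = e s a *m x s a - 1%:M.
Hypothesis XE : forall s a, x s a *m e s a = 1%:M.
Hypothesis PGP : forall s a, p s a *m g s *m (p s a)^T = g s - e s a *m (e s a)^T.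
Hypothesis normal : forall s a,
  (map_mx (f s) (dirmx der (X a) (P a)) + map_mx (f s) (jac der (X a)) *m p s a
     - p s a *m map_mx (f s) (jac der (X a))) *m p s a
  + (map_mx (f s) (dd der (E a)) *m (x s a)^T) *m x s a = 0.
Hypothesis closed : forall s a i j l,
  f s (der i ((G *m (P a)^T) j l)) + f s (der j ((G *m (P a)^T) l i))
  + f s (der l ((G *m (P a)^T) i j)) = 0.
Hypothesis tri : forall s a b c, cyc a b c ->
  [/\ p s c = p s b *m p s a - e s b *m x s a,
      p s c = - (p s a *m p s b) + e s a *m x s b,
      x s c = x s b *m p s a, x s c = - (x s a *m p s b) &
      e s c = p s b *m e s a /\ e s c = - (p s a *m e s b)].

(** From phi^2 xi = 0 one gets phi xi = t xi with t^2 = 0. The absence of nilpotents in F is used,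
    so the identity is obtained at points before it is lifted to K. *)
Lemma xp0 s a : x s a *m p s a = 0.
Proof.
have h0 : x s a *m p s a *m p s a = 0.
  by rewrite -mulmxA PP mulmxBr mulmx1 mulmxA XE mul1mx subrr.
have h1 : x s a *m p s a = (x s a *m p s a *m e s a) *m x s a.
  have := congr1 (mulmxr (p s a)) h0; rewrite /= mul0mx -mulmxA PP mulmxBr mulmx1 mulmxA.
  by move/eqP; rewrite subr_eq0 => /eqP/esym.
have [t et] : exists t, x s a *m p s a = t *: x s a.
  exists ((x s a *m p s a *m e s a) 0 0).
  by rewrite {1}h1 {1}[_ *m e s a]mx11_scalar mul_scalar_mx.
rewrite et; move: h0; rewrite et -scalemxAl et scalerA => h0.
have : t * t = 0.
  have := congr1 (fun w => (w *m e s a) 0 0) h0.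
  by rewrite -scalemxAl XE mul0mx !mxE eqxx mulr1.
by move/eqP; rewrite mulf_eq0 orbb => /eqP ->; rewrite scale0r.
Qed.

(** Hypotheses on values lift to K by [sep], the derivations act there, and the conclusions are
    evaluated again. The last conclusion, from [Tmx_l], makes the kernels for different indices
    comparable. *)
Theorem flat_structure : exists (k : K) (T : 'I_3 -> 'M[K]_d),
  [/\ forall i, der i k = 0,
      forall s a, map_mx (f s) (dd der (E a)) = g s *m (map_mx (f s) (T a))^T,
      forall s a, map_mx (f s) (T a) *m map_mx (f s) (T a)
                  = f s k *: (p s a *m map_mx (f s) (T a)),
      forall s a b, x s a *m map_mx (f s) (T b) = f s k *: (x s a *m p s b) &
      forall s a b c (v : 'rV_d), cyc a b c -> v *m e s c = 0 ->
        v *m map_mx (f s) (T c) = 0 -> v *m map_mx (f s) (T b) = 0].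
Proof.
have hGsym : G^T = G by apply: map_mx_sep => s; rewrite -map_trmx; exact: Gsym.
have hGcan m (A : 'M[K]_(d, m)) : G *m A = 0 -> A = 0.
  move=> GA; apply: map_mx_sep => s; rewrite map_mx0.
  apply: trmx_inj; rewrite trmx0; apply/row_matrixP => i; rewrite row0.
  apply: (@Gunit s); rewrite -row_mul -[g s]Gsym -trmx_mul -map_mxM GA map_mx0.
  by rewrite trmx0 row0.
have hPP a : P a *m P a = E a *m X a - 1%:M.
  by apply: map_mx_sep => s; rewrite map_mxM PP map_mxB map_mxM map_mx1.
have hXE a : X a *m E a = 1%:M.
  by apply: map_mx_sep => s; rewrite map_mxM XE map_mx1.
have hXP a : X a *m P a = 0.
  by apply: map_mx_sep => s; rewrite map_mxM map_mx0; exact: xp0.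
have hPGP a : P a *m G *m (P a)^T = G - E a *m (E a)^T.
  by apply: map_mx_sep => s; rewrite map_mxB !map_mxM -!map_trmx; exact: PGP.
have hnormal a : lieP der (X a) (P a) *m P a + (dd der (E a) *m (X a)^T) *m X a = 0.
  apply: map_mx_sep => s; rewrite map_mxD !map_mxM map_mx0 /lieP /lie_mx -lock.
  by rewrite map_mxB map_mxD !map_mxM -map_trmx; exact: normal.
have hclosed a : closed_mx der (G *m (P a)^T).
  by move=> i j l; apply: sep => s; rewrite !rmorphD; exact: closed.
have htri a b c : cyc a b c ->
  [/\ P c = P b *m P a - E b *m X a, P c = - (P a *m P b) + E a *m X b,
      X c = X b *m P a, X c = - (X a *m P b) &
      E c = P b *m E a /\ E c = - (P a *m E b)].
  move=> h; split; [| | | |split]; apply: map_mx_sep => s;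
    have [h1 h2 h3 h4 [h5 h6]] := tri s h;
    by rewrite ?(map_mxB, map_mxD, map_mxN) ?map_mxM.
exists (kap der X E 0 1 2%:R), (Tmx der P X); split.
- move=> i; have := grad_k derD derM derC hGsym hGcan hPP hXE hXP hPGP hnormal hclosed htri.
  by move/colP/(_ i); rewrite !mxE.
- move=> s a.
  by rewrite (ddE_T derD derM hGsym hPP hXE hXP hPGP hnormal hclosed htri) map_mxM -map_trmx.
- move=> s a; rewrite -map_mxM.
  rewrite (T_sqr derD derM derC hGsym hGcan hPP hXE hXP hPGP hnormal hclosed htri).
  by rewrite map_mxZ map_mxM.
- move=> s a b; rewrite /x /p -!map_mxM -map_mxZ.
  by rewrite (XT_all derD derM hGsym hGcan hPP hXE hXP hPGP hnormal hclosed htri).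
move=> s a b c v h ve vT.
rewrite (Tmx_l derD derM hGsym hGcan hPP hXE hXP hPGP hnormal hclosed htri h).
rewrite map_mxD map_mxN map_mxZ !map_mxM mulmxDr mulmxN mulmxA vT mul0mx oppr0 add0r.
by rewrite -scalemxAr mulmxA ve mul0mx scaler0.
Qed.

End Pointwise.

(** * The common horizontal kernel of the forms d eta_a and the projection onto it *)

Section ThetaFormula.
Variables (R : realType) (d : nat) (g : 'rV[R]_d -> 'rV[R]_d -> R).
Hypothesis g_lin : forall u, scalar (g u).
Hypothesis g_sym : forall u v, g u v = g v u.
Hypothesis g_pos : forall u, u != 0 -> 0 < g u u.
Variables (P T : 'I_3 -> 'M[R]_d) (E : 'I_3 -> 'cV[R]_d) (X : 'I_3 -> 'rV[R]_d) (k : R).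
Hypothesis PP : forall a, P a *m P a = E a *m X a - 1%:M.
Hypothesis XE : forall a, X a *m E a = 1%:M.
Hypothesis XP : forall a, X a *m P a = 0.
Hypothesis gPP : forall a u v,
  g (u *m P a) (v *m P a) = g u v - (u *m E a) 0 0 * (v *m E a) 0 0.
Hypothesis tri : forall a b c, cyc a b c ->
  [/\ P c = P b *m P a - E b *m X a, P c = - (P a *m P b) + E a *m X b,
      X c = X b *m P a, X c = - (X a *m P b) &
      E c = P b *m E a /\ E c = - (P a *m E b)].
Hypothesis TT : forall a, T a *m T a = k *: (P a *m T a).
Hypothesis XT : forall a b, X a *m T b = k *: (X a *m P b).
Hypothesis gT : forall a u v, g u (v *m T a) = - g v (u *m T a).
Hypothesis rot : forall a b c (v : 'rV_d), cyc a b c -> v *m E c = 0 ->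
  v *m T c = 0 -> v *m T b = 0.

(** Skewness gives g(u T, u T) = - g(u, u T^2), and T^2 = 0 when k = 0. *)
Lemma T_eq0 a : k = 0 -> T a = 0.
Proof.
move=> k0; apply: row_mxP => u; rewrite mulmx0; apply/eqP; apply: contraT => /g_pos.
by rewrite gT -mulmxA TT k0 scale0r mulmx0 (g0r g_lin) oppr0 ltxx.
Qed.

Hypothesis k0 : k != 0.

Let PE a : P a *m E a = 0 := P_E0 PP XE XP a.
Let XTa a : X a *m T a = 0. Proof. by rewrite XT XP scaler0. Qed.
Let gxi a v : g v (X a) = (v *m E a) 0 0.
Proof. exact: (g_xi g_lin (XE a) (XP a) (gPP a)). Qed.
Let gskew a u v : g u (v *m P a) = - g v (u *m P a).
Proof. exact: (g_skewP g_lin g_sym (PP a) (XE a) (XP a) (PE a) (gPP a)). Qed.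

Lemma E00 (u : 'rV[R]_d) (e : 'cV[R]_d) : (u *m e) 0 0 = 0 -> u *m e = 0.
Proof. by move=> h; rewrite [LHS]mx11_scalar h raddf0. Qed.

(* The triples (c, b, a) and (b, c, a) are the two cyclic orders. *)
Lemma X_mulP a c : a != c -> exists b s, X a = s *: (X b *m P c).
Proof.
move=> ac; have [b [h|h]] : exists b, cyc c b a \/ cyc b c a.
  exists (- a - c).
  by case: a c ac => [[|[|[|//]]] ha] [[|[|[|//]]] hc] // _;
    first [left; by vm_compute | right; by vm_compute].
- by exists b, 1; rewrite scale1r; have [_ _ -> _ _] := tri h.
by exists b, (-1); rewrite scaleN1r; have [_ _ _ -> _] := tri h.
Qed.

(** For a different from c, xi_a is a multiple of phi_c xi_b = k^-1 xi_b T_c, so eta_a(u) = g(u,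
    xi_a) is by skewness a multiple of g(xi_b, u T_c) = 0. *)
Lemma ker_E a c (u : 'rV_d) : u *m E c = 0 -> u *m T c = 0 -> u *m E a = 0.
Proof.
have [->//|/X_mulP[b [s e]] uE uT] := eqVneq a c.
apply: E00; rewrite -gxi e (_ : X b *m P c = k^-1 *: (X b *m T c)).
  by rewrite !(gZr g_lin) gT uT (g0r g_lin) oppr0 !mulr0.
by rewrite XT scalerA mulVf // scale1r.
Qed.

(** The hypothesis [rot] passes from the index c to c - 1; a second application, allowed by [ker_E],
    reaches the remaining index. *)
Lemma ker_T a c (u : 'rV_d) : u *m E c = 0 -> u *m T c = 0 -> u *m T a = 0.
Proof.
move=> uE uT; have uE' b := ker_E b uE uT.
have [->//|ac] := eqVneq a c.
have h1 : u *m T (c - 1) = 0.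
  by apply: (rot (a := c - 1 - 1) (c := c)) uT => //; case: (c) => [[|[|[|//]]] ?]; vm_compute.
have h2 : u *m T (c - 1 - 1) = 0.
  by apply: (rot (a := c - 1 - 1 - 1) (c := c - 1)) h1 => //; case: (c) => [[|[|[|//]]] ?]; vm_compute.
have : a = c - 1 \/ a = c - 1 - 1.
  by case: a c ac {uE uT h1 h2} => [[|[|[|//]]] ha] [[|[|[|//]]] hc] // _;
    first [left; exact/eqP | right; exact/eqP].
by case=> ->.
Qed.

Lemma XE_all a b : X a *m E b = (a == b)%:R%:M.
Proof.
have [->|/X_mulP[b' [s ->]]] := eqVneq a b; first exact: XE.
by rewrite -scalemxAl -mulmxA PE mulmx0 scaler0 raddf0.
Qed.

Notation r c := (proj_ker (P c) (T c) (E c) (X c) k).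

Lemma proj_ker_horizontal a c (v : 'rV_d) : v *m r c *m E a = 0.
Proof.
apply: (@ker_E a c); rewrite -mulmxA.
  by rewrite proj_kerE // mulmx0.
by rewrite (proj_kerT g_lin g_sym g_pos) // mulmx0.
Qed.

(** v - v r is a multiple of xi_c plus a vector of the image of T; u is orthogonal to the latter
    because T is skew and u T = 0. *)
Lemma proj_ker_orthogonal c (u v : 'rV_d) : u *m E c = 0 -> u *m T c = 0 ->
  g u (v - v *m r c) = 0.
Proof.
move=> uE uT; rewrite /proj_ker !mulmxBr mulmx1 !opprB addrCA [v + (_ - v)]addrC subrK mulmxA.
rewrite [v *m E c]mx11_scalar mul_scalar_mx (gDr g_lin) (gZr g_lin) gxi uE (mx00 R).
rewrite mulr0 addr0 /proj_im -scalemxAr (gZr g_lin) mulmxA gskew g_sym gT opprK.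
rewrite -mulmxA (TP_comm g_lin g_sym g_pos (PP c) (XE c) (XP c) (PE c) (gPP c) (TT c) (gT c) k0).
by rewrite mulmxA uT mul0mx (g0r g_lin) mulr0.
Qed.

Lemma proj_ker_P c (v : 'rV_d) : v *m r c *m P c = v *m P c - k^-1 *: (v *m T c).
Proof.
rewrite /proj_ker !mulmxBr mulmx1 !mulmxBl mulmxA -[v *m E c *m X c *m _]mulmxA XP.
rewrite mulmx0 subr0 -[v *m proj_im _ _ _ *m _]mulmxA.
by rewrite (@proj_imP R d g g_lin g_sym _ _ _ _ k (PP c) (XE c) (XP c) (gPP c) (XTa c) (gT c)) -scalemxAr.
Qed.

(** By [XT] the endomorphism T_c acts on xi_b as k P_c, so [proj_im] acts on it as - P^2 = 1 - E
    X. *)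
Lemma X_proj_ker b c : X b *m r c = 0.
Proof.
rewrite /proj_ker /proj_im !mulmxBr mulmx1 -scalemxAr !mulmxA XT -scalemxAl scalerA.
rewrite mulNr mulVf // scaleN1r opprK -[X b *m P c *m P c]mulmxA PP mulmxBr mulmx1 mulmxA.
by rewrite addrC addrA subrK subrr.
Qed.

End ThetaFormula.

(** * Smooth functions on open sets *)

Section Lines.
Variables (R : realType) (V W : normedModType R).

Lemma is_derive_line (f : V -> W) p v r : derivable f (p + r *: v) v ->
  is_derive r 1 (fun t : R => f (p + t *: v)) ('D_v f (p + r *: v)).
Proof.
move=> df; rewrite /derive.
have e : (fun h : R => h^-1 *: (f (h *: v + (p + r *: v)) - f (p + r *: v))) =
    (fun h => h^-1 *: (f (p + (h *: 1 + r) *: v) - f (p + r *: v))).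
  by apply: funext => h; rewrite [h *: 1]mulr1 scalerDl addrCA.
apply: DeriveDef.
  by move: df; rewrite /derivable e.
by rewrite /derive e.
Qed.
End Lines.

Section Calculus.
Variables (R : realType) (d : nat).
Notation V := 'rV[R]_d.

Lemma mvt_line (f : V -> R^o) p v :
  (forall r : R, 0 <= r <= 1 -> derivable f (p + r *: v) v) ->
  exists2 r : R, 0 <= r <= 1 & f (p + v) - f p = 'D_v f (p + r *: v).
Proof.
move=> df; have [||r r01 e] := @MVT_segment R (fun t => f (p + t *: v))
    (fun r => 'D_v f (p + r *: v)) 0 1 ler01.
- move=> x /[!in_itv] /= /andP[x0 x1]; apply: is_derive_line.
  by apply: df; rewrite !ltW.
- apply: derivable_within_continuous => x /[!in_itv] /= x01.
  by have [] := is_derive_line (df _ x01).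
exists r; first by move: r01; rewrite in_itv.
by move: e; rewrite scale1r scale0r addr0 subr0 mulr1.
Qed.

(** Derivability is assumed along v only, so no differential is at hand; the chain rule is applied
    to t -> c t on the line through a. *)
Lemma derive_scale (f : V -> R^o) a v (c : R) : derivable f a v ->
  derivable f a (c *: v) /\ 'D_(c *: v) f a = c * 'D_v f a.
Proof.
move=> df; have df0 : derivable f (a + 0 *: v) v by rewrite scale0r addr0.
have h0 : derivable (fun t : R => f (a + t *: v)) (( *:%R ^~ c) (0 : R)) 1.
  by rewrite /= scale0r; have [] := is_derive_line df0.
have h1 : derivable ( *:%R ^~ c : R -> R) 0 1.
  by apply/derivable1_diffP; apply: ex_diff.
have e : (fun t : R => f (a + t *: (c *: v))) = (fun t : R => f (a + t *: v)) \o ( *:%R ^~ c : R -> R).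
  by apply: funext => t /=; rewrite scalerA.
have h2 : derivable (fun t : R => f (a + t *: (c *: v))) 0 1.
  rewrite e; apply/derivable1_diffP; apply: differentiable_comp.
    exact/derivable1_diffP/h1.
  exact/derivable1_diffP/h0.
have e2 : (fun h : R => h^-1 *: (f (h *: (c *: v) + a) - f a)) =
   (fun h : R => h^-1 *: (f (a + (h *: 1 + 0) *: (c *: v)) - f (a + 0 *: (c *: v)))).
  apply: funext => h; rewrite [h *: 1]mulr1 addr0 scale0r addr0. by rewrite [_ + a]addrC.
split; first by move: h2; rewrite /derivable -e2.
rewrite /derive e2 -/(derive (fun t : R => f (a + t *: (c *: v))) 0 1) -derive1E e.
rewrite derive1_comp // !derive1E mulrC; congr (_ * _).
  by rewrite deriveE ?diff_val ?scale1r //; apply/derivable1_diffP.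
rewrite scale0r; by have [_] := is_derive_line df0; rewrite scale0r addr0.
Qed.

(** The increment is telescoped along the coordinate axes; on each edge the mean value theorem and
    continuity replace it by the partial derivative at a, up to e' |h|. *)
Lemma partial_differentiable (f : V -> R^o) a :
  (\forall x \near a, forall j, derivable f x (delta_mx 0 j)) ->
  (forall j, {for a, continuous (fun x => 'D_(delta_mx 0 j) f x)}) ->
  differentiable f a /\ forall v, 'd f a v = \sum_j v 0 j * 'D_(delta_mx 0 j) f a.
Proof.
move=> df cf.
pose L (v : V) : R^o := \sum_j v 0 j * 'D_(delta_mx 0 j) f a.
have Llin : linear L.
  move=> c u v; rewrite /L scaler_sumr -big_split; apply: eq_bigr => j _.
  by rewrite !mxE mulrDl -mulrA.
pose LM := GRing.isLinear.Build _ _ _ _ _ Llin.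
pose Lf : {linear V -> R^o} := HB.pack L LM.
have Lc : continuous Lf.
  have -> : (Lf : V -> R^o) =
      \sum_j (fun v : V => v 0 j * 'D_(delta_mx 0 j) f a : R^o).
    by apply: funext => v; rewrite fct_sumE.
  move=> x; apply/differentiable_continuous/differentiable_sum => j.
  by apply: differentiableM; [exact: differentiable_coord|exact: differentiable_cst].
have key : f \o shift a = cst (f a) + Lf +o_ 0 id.
  apply/eqaddoP => _/posnumP[e].
  (* There are d edges; d + 1 keeps the denominator positive when d = 0. *)
  pose e' := e%:num / (d.+1)%:R.
  have e'0 : 0 < e' by rewrite divr_gt0.
  have cfe : \forall x \near a, forall j, `|'D_(delta_mx 0 j) f a - 'D_(delta_mx 0 j) f x| <= e'.
    apply: (@filter_forall V 'I_d (fun j x => `|'D_(delta_mx 0 j) f a - 'D_(delta_mx 0 j) f x| <= e') (nbhs a) _) => j.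
    by move/cvgrPdist_le : (cf j) => /(_ _ e'0).
  have [r r0 hr] : exists2 r : R, 0 < r & forall x, `|x| < r -> 
      (forall j, derivable f (a + x) (delta_mx 0 j)) /\
      (forall j, `|'D_(delta_mx 0 j) f a - 'D_(delta_mx 0 j) f (a + x)| <= e').
    have hh := filterI df cfe.
    have [r /= r0 hr] := (nbhs_ballP a _).1 (hh (nbhs_filter a)).
    exists r => // x xr; apply: hr; rewrite -ball_normE /ball_ /=.
    by rewrite opprD addrA subrr sub0r normrN.
  near=> h.
  have hlt : `|h| < r by near: h; exact: (@pseudometric_normed_Zmodule.nbhs0_lt _ V r r0).
  have nb (x : V) : (forall i, `|x 0 i| <= `|h|) -> `|x| < r.
    move=> hx; apply: le_lt_trans hlt; rewrite [leLHS]/Num.Def.normr/= mx_normrE.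
    by apply: bigmax_le => // -[i j] _ /=; rewrite ord1.
  have hi i : `|h 0 i| <= `|h|.
    rewrite [leRHS]/Num.Def.normr/= mx_normrE.
    exact: (le_bigmax _ (fun ij => `|h ij.1 ij.2|) (0, i)).
  pose tr (k : nat) : V := \row_i (if (i < k)%N then h 0 i else 0).
  have step (k : 'I_d) : `|f (a + tr k.+1) - f (a + tr k) - h 0 k * 'D_(delta_mx 0 k) f a| <= e' * `|h|.
    have -> : tr k.+1 = tr k + h 0 k *: delta_mx 0 k.
      apply/rowP => i; rewrite !mxE eqxx /= ltnS leq_eqVlt.
      have [->|ik] := eqVneq i k; first by rewrite eqxx ltnn add0r mulr1.
      by rewrite (_ : (i == k :> nat) = false) ?mulr0 ?addr0 //; apply/negbTE.
    have sm (r' : R) : 0 <= r' <= 1 -> `|tr k + r' *: (h 0 k *: delta_mx 0 k)| < r.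
      move=> /andP[r0' r1']; apply: nb => i; rewrite !mxE eqxx /=.
      have [->|ik] := eqVneq i k.
        rewrite ltnn add0r mulr1 normrM ger0_norm //.
        by apply: le_trans (hi k); rewrite ler_piMl.
      by rewrite !mulr0 addr0; case: ifP => _; rewrite ?normr0 ?normr_ge0 ?hi.
    have [|t t01 ] := @mvt_line f (a + tr k) (h 0 k *: delta_mx 0 k).
      move=> t t01; rewrite -addrA; apply: (proj1 (derive_scale _ _)).
      exact: (hr _ (sm _ t01)).1.
    rewrite addrA => ->; have [h1 h2] := hr _ (sm _ t01).
    rewrite -addrA in h1 h2 *; rewrite (proj2 (derive_scale _ (h1 k))) -mulrBr normrM mulrC.
    by rewrite ler_pM // distrC.
  have -> : (f \o shift a - (cst (f a) + Lf)) h =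
      \sum_(k < d) (f (a + tr k.+1) - f (a + tr k) - h 0 k * 'D_(delta_mx 0 k) f a).
    rewrite sumrB; have := @telescope_sumr _ 0 d (fun k => f (a + tr k)) (leq0n _).
    rewrite big_mkord => ->.
    have -> : tr 0%N = 0 by apply/rowP => i; rewrite !mxE.
    have -> : tr d = h by apply/rowP => i; rewrite !mxE ltn_ord.
    by rewrite addr0 /= fctE /= opprD addrA (addrC h).
  apply: le_trans (ler_norm_sum _ _ _) _.
  apply: le_trans (ler_sum _ (fun k _ => step k)) _.
  rewrite sumr_const card_ord -mulr_natl mulrA ler_wpM2r //.
  rewrite /e' mulrCA ler_piMr // ler_pdivrMr ?ltr0Sn // mul1r ler_nat.
  exact: leqnSn.
split; last by move=> v; rewrite (diff_unique Lc key).
by apply/diff_locallyP; rewrite (diff_unique Lc key).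
Unshelve. all: by end_near. Qed.
End Calculus.

Section CkGeneral.
Variables (R : realType) (d : nat) (W : normedModType R).
Notation V := 'rV[R]_d.
Implicit Types (A B : set V) (f g : V -> W).

Lemma open_near A (P : set V) a : open A -> A a -> (forall x, A x -> P x) ->
  \forall x \near a, P x.
Proof. by move=> oA Aa h; apply: filterS h _; exact: open_nbhs_nbhs. Qed.

Lemma derivable_ext A f g a v : open A -> A a -> (forall x, A x -> f x = g x) ->
  derivable f a v -> derivable g a v.
Proof. by move=> oA Aa h; apply: near_eq_derivable; exact: (open_near oA Aa h). Qed.

Lemma derive_ext A f g a v : open A -> A a -> (forall x, A x -> f x = g x) ->
  'D_v f a = 'D_v g a.
Proof. by move=> oA Aa h; apply: near_eq_derive; exact: (open_near oA Aa h). Qed.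

Lemma continuous_ext A f g a : open A -> A a -> (forall x, A x -> f x = g x) ->
  {for a, continuous f} -> {for a, continuous g}.
Proof.
move=> oA Aa h; rewrite /prop_for /continuous_at -(h a) // => fc.
apply: cvg_trans fc; apply: (@near_eq_cvg _ _ (nbhs a) (nbhs_filter a)).
exact: open_near oA Aa h.
Qed.

Lemma Ck_continuous k A f a : Ck k A f -> A a -> {for a, continuous f}.
Proof. by case: k => [|k] [h _]; exact: h. Qed.

Lemma Ck_sub k A B f : A `<=` B -> Ck k B f -> Ck k A f.
Proof.
elim: k f => [|k IH] f AB [h1 h2]; split=> //; try by move=> a /AB; exact: h1.
by move=> v; have [h3 h4] := h2 v; split; [move=> a /AB; exact: h3|exact: IH].
Qed.

Lemma Ck_ext k A f g : open A -> (forall x, A x -> f x = g x) -> Ck k A f -> Ck k A g.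
Proof.
move=> oA; elim: k f g => [|k IH] f g fg [h1 h2]; split=> //.
- by move=> a Aa; exact: continuous_ext oA Aa fg (h1 _ Aa).
- by move=> a Aa; exact: continuous_ext oA Aa fg (h1 _ Aa).
move=> v; have [h3 h4] := h2 v; split.
  by move=> a Aa; apply: derivable_ext oA Aa fg (h3 a Aa).
by apply: IH h4 => x Ax; exact: derive_ext oA Ax fg.
Qed.

Lemma Ck_pred k A f : Ck k.+1 A f -> Ck k A f.
Proof.
elim: k f => [|k IH] f [h1 h2]; split=> // v.
have [h3 h4] := h2 v; split=> //; exact: IH.
Qed.

Lemma CkD k A f g : open A -> Ck k A f -> Ck k A g -> Ck k A (fun x => f x + g x).
Proof.
move=> oA; elim: k f g => [|k IH] f g [f1 f2] [g1 g2]; split=> //.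
- by move=> a Aa; exact: continuousD (f1 _ Aa) (g1 _ Aa).
- by move=> a Aa; exact: continuousD (f1 _ Aa) (g1 _ Aa).
move=> v; have [f3 f4] := f2 v; have [g3 g4] := g2 v; split.
  by move=> a Aa; apply: derivableD; [exact: f3|exact: g3].
apply: (Ck_ext oA _ (IH _ _ f4 g4)) => x Ax.
by rewrite [RHS](@deriveD _ _ _ f g) //; [exact: f3|exact: g3].
Qed.

Lemma Ck_cst k A (c : W) : Ck k A (cst c).
Proof.
elim: k c => [|k IH] c; split=> //; try by move=> a _; exact: cst_continuous.
move=> v; split; first by move=> a _; exact: (@derivable_cst R V W c a v).
by rewrite (_ : (fun a => _) = cst 0) //; apply: funext => x; rewrite derive_cst.
Qed.

Lemma CkZ k A f (c : R) : open A -> Ck k A f -> Ck k A (fun x => c *: f x).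
Proof.
move=> oA; elim: k f => [|k IH] f [f1 f2]; split=> //.
- by move=> a Aa; exact: continuousZl_tmp (f1 _ Aa).
- by move=> a Aa; exact: continuousZl_tmp (f1 _ Aa).
move=> v; have [f3 f4] := f2 v; split.
  by move=> a Aa; apply: (@derivableZ _ _ _ f); exact: f3.
apply: (Ck_ext oA _ (IH _ f4)) => x Ax.
by rewrite [RHS](@deriveZ _ _ _ f) //; exact: f3.
Qed.

Lemma Ck_sum k A (I : Type) (r : seq I) (f : I -> V -> W) : open A ->
  (forall i, Ck k A (f i)) -> Ck k A (fun x => \sum_(i <- r) f i x).
Proof.
move=> oA hf; elim: r => [|i r IH].
  by under eq_fun do rewrite big_nil; exact: Ck_cst.
by under eq_fun do rewrite big_cons; exact: CkD.
Qed.

Lemma Coo_derive A f v : Coo A f -> Coo A ('D_v f).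
Proof. by move=> h k; have [_ /(_ v)[]] := h k.+1. Qed.

Lemma Coo_derivable A f a v : Coo A f -> A a -> derivable f a v.
Proof. by move=> h Aa; have [_ /(_ v)[h1 _]] := h 1%N; exact: h1. Qed.

Lemma Coo_continuous A f a : Coo A f -> A a -> {for a, continuous f}.
Proof. by move=> h; have := @Ck_continuous 0 A f a (h 0%N). Qed.

Lemma Coo_ext A f g : open A -> (forall x, A x -> f x = g x) -> Coo A f -> Coo A g.
Proof. by move=> oA fg h k; exact: Ck_ext oA fg (h k). Qed.

Lemma Coo_sub A B f : A `<=` B -> Coo B f -> Coo A f.
Proof. by move=> AB h k; exact: Ck_sub AB (h k). Qed.

End CkGeneral.

Section CkReal.
Variables (R : realType) (d : nat).
Notation V := 'rV[R]_d.
Implicit Types (A B : set V).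

Lemma CkM k A (f g : V -> R^o) : open A -> Ck k A f -> Ck k A g ->
  Ck k A (fun x => f x * g x : R^o).
Proof.
move=> oA; elim: k f g => [|k IH] f g hf hg.
  case: hf hg => [f1 f2] [g1 g2]; split=> //.
  by move=> a Aa; exact: continuousM (f1 _ Aa) (g1 _ Aa).
have hf' := Ck_pred hf; have hg' := Ck_pred hg.
case: hf hg => [f1 f2] [g1 g2]; split.
  by move=> a Aa; exact: continuousM (f1 _ Aa) (g1 _ Aa).
move=> v; have [f3 f4] := f2 v; have [g3 g4] := g2 v; split.
  by move=> a Aa; apply: (@derivableM _ _ f g); [exact: f3|exact: g3].
apply: (Ck_ext oA _ (CkD oA (IH _ _ hf' g4) (IH _ _ hg' f4))) => x Ax.
by rewrite [RHS](@deriveM _ _ f g) //; [exact: f3|exact: g3].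
Qed.

Lemma Ck1_differentiable A (f : V -> R^o) a : open A -> Ck 1 A f -> A a ->
  differentiable f a.
Proof.
move=> oA [_ h] Aa; apply: (proj1 (partial_differentiable _ _)).
  apply: open_near oA Aa _ => x Ax j; exact: (h _).1.
by move=> j; have [_ [h2 _]] := h (delta_mx 0 j); exact: h2.
Qed.

Lemma Ck_coord k m A (f : V -> 'rV[R]_m) j : open A -> Ck k A f ->
  Ck k A (fun x => f x 0 j : R^o).
Proof.
move=> oA; elim: k f => [|k IH] f [f1 f2]; split=> //.
- move=> a Aa; apply: (@continuous_comp _ _ _ f (fun M : 'rV[R]_m => M 0 j)).
    exact: f1.
  exact: coord_continuous.
- move=> a Aa; apply: (@continuous_comp _ _ _ f (fun M : 'rV[R]_m => M 0 j)).
    exact: f1.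
  exact: coord_continuous.
move=> v; have [f3 f4] := f2 v; split.
  by move=> a /f3 /derivable_mxP /(_ 0 j).
by apply: (Ck_ext oA _ (IH _ f4)) => x /f3 h; rewrite derive_mx // mxE.
Qed.

Lemma Ck_row k m A (f : V -> 'rV[R]_m) : open A ->
  (forall j, Ck k A (fun x => f x 0 j : R^o)) -> Ck k A f.
Proof.
move=> oA hf.
suff h j : Ck k A (fun x => f x 0 j *: (delta_mx 0 j : 'rV[R]_m)).
  by apply: Ck_ext oA _ (Ck_sum (index_enum 'I_m) oA h) => x _; rewrite -row_sum_delta.
suff gen (f' : V -> R^o) : Ck k A f' -> Ck k A (fun x => f' x *: (delta_mx 0 j : 'rV[R]_m)).
  exact: (gen (fun x => f x 0 j)).
move: {f hf} f' => f.
have cZ (g : V -> R^o) a : {for a, continuous g} ->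
    {for a, continuous (fun x => g x *: (delta_mx 0 j : 'rV[R]_m))}.
  exact: continuousZr_tmp.
elim: k f => [|k IH] f [f1 f2].
  by split=> [a Aa|]; [apply: cZ; exact: f1|exact: I].
split=> [a Aa|v]; first by apply: cZ; exact: f1.
have [f3 f4] := f2 v.
have dv a : A a -> is_derive a v (fun x => f x *: (delta_mx 0 j : 'rV[R]_m))
   ('D_v f a *: (delta_mx 0 j : 'rV[R]_m)).
  move=> /f3 h; have dM : derivable (fun x => f x *: (delta_mx 0 j : 'rV[R]_m)) a v.
    apply/derivable_mxP => i i'; under eq_fun do rewrite mxE mulrC.
    exact: (@derivableZ _ _ _ f).
  apply: DeriveDef => //; rewrite derive_mx //; apply/matrixP => i i'; rewrite !mxE.
  under eq_fun do rewrite mxE mulrC.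
  by rewrite (@deriveZ _ _ _ f) // [RHS]mulrC mxE.
split; first by move=> a /dv[].
by apply: (Ck_ext oA _ (IH _ f4)) => x /dv[_ ->].
Qed.

Lemma Ck1_differentiable_row m A (f : V -> 'rV[R]_m) a : open A -> Ck 1 A f -> A a ->
  differentiable f a.
Proof.
move=> oA hf Aa.
have -> : f = \sum_(j < m) (fun x => f x 0 j *: (delta_mx 0 j : 'rV[R]_m)).
  by apply: funext => x; rewrite fct_sumE -row_sum_delta.
apply: differentiable_sum => j; apply: differentiableZl.
exact: (Ck1_differentiable oA (Ck_coord j oA hf) Aa).
Qed.

End CkReal.

Section Coo.
Variables (R : realType) (d : nat).
Notation V := 'rV[R]_d.
Implicit Types (A B : set V).

Lemma derive_partial A (f : V -> R^o) a v : open A -> Ck 1 A f -> A a ->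
  'D_v f a = \sum_j v 0 j * 'D_(delta_mx 0 j) f a.
Proof.
move=> oA hf Aa; rewrite deriveE; last exact: Ck1_differentiable oA hf Aa.
case: hf => _ h; apply: (proj2 (partial_differentiable _ _)).
  apply: open_near oA Aa _ => x Ax j; exact: (h _).1.
by move=> j; have [_ [h2 _]] := h (delta_mx 0 j); exact: h2.
Qed.

Lemma derive_comp (V1 V2 W : normedModType R) (f : V2 -> W) (g : V1 -> V2) a v :
  differentiable g a -> differentiable f (g a) ->
  'D_v (f \o g) a = 'D_('D_v g a) f (g a).
Proof.
move=> dg df; rewrite !deriveE //; last exact: differentiable_comp.
by rewrite diff_comp.
Qed.

(** Induction on k for all smooth f at once: the chain rule gives a sum of products of derivatives
    of g with partial derivatives of f composed with g, to which the induction hypothesis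
    applies. *)
Lemma Ck_comp k A B (f : V -> R^o) (g : V -> V) : open A -> open B ->
  (forall x, A x -> B (g x)) -> Coo B f -> Coo A g -> Ck k A (f \o g : V -> R^o).
Proof.
move=> oA oB gAB; elim: k f => [|k IH] f hf hg.
  split=> [a Aa|//]; apply: continuous_comp.
    exact: Coo_continuous hg Aa.
  exact: Coo_continuous hf (gAB _ Aa).
have dg x : A x -> differentiable g x by move=> Ax; exact: Ck1_differentiable_row oA (hg 1%N) Ax.
have df x : A x -> differentiable f (g x).
  by move=> Ax; exact: Ck1_differentiable oB (hf 1%N) (gAB _ Ax).
split=> [a Aa|v].
  apply: continuous_comp; first exact: Coo_continuous hg Aa.
  exact: Coo_continuous hf (gAB _ Aa).
split=> [a Aa|].
  apply: diff_derivable; apply: differentiable_comp; [exact: dg|exact: df].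
apply: (@Ck_ext _ _ _ k A (fun x => \sum_j ('D_v g x 0 j * ('D_(delta_mx 0 j) f \o g) x : R^o))) => //.
  move=> x Ax; rewrite (derive_comp _ (dg _ Ax) (df _ Ax)).
  by rewrite (derive_partial _ oB (hf 1%N) (gAB _ Ax)).
apply: Ck_sum => // j; apply: CkM => //.
  by apply: Ck_coord => //; exact: Coo_derive.
by apply: IH => //; exact: Coo_derive.
Qed.

Lemma Coo_comp A B (f : V -> R^o) (g : V -> V) : open A -> open B ->
  (forall x, A x -> B (g x)) -> Coo B f -> Coo A g -> Coo A (f \o g : V -> R^o).
Proof. by move=> oA oB gAB hf hg k; exact: Ck_comp hf hg. Qed.

Lemma Coo_coord m A (f : V -> 'rV[R]_m) j : open A -> Coo A f ->
  Coo A (fun x => f x 0 j : R^o).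
Proof. by move=> oA h k; exact: Ck_coord. Qed.

Lemma Coo_row m A (f : V -> 'rV[R]_m) : open A ->
  (forall j, Coo A (fun x => f x 0 j : R^o)) -> Coo A f.
Proof. by move=> oA h k; apply: Ck_row => // j; exact: h. Qed.

Lemma Coo_comp_row m A B (f : V -> 'rV[R]_m) (g : V -> V) : open A -> open B ->
  (forall x, A x -> B (g x)) -> Coo B f -> Coo A g -> Coo A (f \o g).
Proof.
move=> oA oB gAB hf hg; apply: Coo_row => // j.
by apply: (@Coo_comp A B (fun x => f x 0 j) g) => //; exact: Coo_coord.
Qed.

(** The second difference of f on the parallelogram spanned by t u and t v is symmetric in u and v.
    Two mean values in either order make it t^2 times a mixed derivative at a nearby point, and
    continuity compares these with the values at a. *)
Lemma schwarz A (f : V -> R^o) a u v : open A -> Coo A f -> A a ->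
  'D_u ('D_v f) a = 'D_v ('D_u f) a.
Proof.
move=> oA hf Aa.
have cv : {for a, continuous ('D_u ('D_v f))}.
  by apply: Coo_continuous Aa; do 2 apply: Coo_derive.
have cu : {for a, continuous ('D_v ('D_u f))}.
  by apply: Coo_continuous Aa; do 2 apply: Coo_derive.
have mixed (b u' v' : V) : (forall r s : R, 0 <= r <= 1 -> 0 <= s <= 1 -> A (b + r *: u' + s *: v')) ->
   exists r s : R, [/\ 0 <= r <= 1, 0 <= s <= 1 &
     f (b + u' + v') - f (b + u') - (f (b + v') - f b) =
     'D_v' ('D_u' f) (b + r *: u' + s *: v')].
  move=> hA; pose h x : R^o := f (x + v') - f x.
  have dsh (x : V) : A (x + v') -> is_derive x u' (fun y => f (y + v')) ('D_u' f (x + v')).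
    move=> Ax; have e : (fun t : R => t^-1 *: (f (t *: u' + (x + v')) - f (x + v'))) =
        (fun t : R => t^-1 *: (f (t *: u' + x + v') - f (x + v'))).
      by apply: funext => t; rewrite addrA.
    apply: DeriveDef; last by rewrite /derive e.
    by have := Coo_derivable (v:=u') hf Ax; rewrite /derivable e.
  have dh r : 0 <= r <= 1 -> is_derive (b + r *: u') u' h
     ('D_u' f (b + r *: u' + v') - 'D_u' f (b + r *: u')).
    move=> r01; have := hA r 1 r01; rewrite scale1r lexx ler01 => /(_ isT) A1.
    have := hA r 0 r01; rewrite scale0r addr0 lexx ler01 => /(_ isT) A0.
    apply: (@is_deriveB _ _ _ (fun y => f (y + v')) f).
      exact: dsh.
    exact: (derivableP (Coo_derivable hf A0)).
  have [|r r01 e1] := @mvt_line _ _ h b u'; first by move=> r /dh[].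
  have [|s s01 e2] := @mvt_line _ _ ('D_u' f) (b + r *: u') v'.
    by move=> s s01; apply: Coo_derivable (hA _ _ r01 s01); exact: Coo_derive.
  exists r, s; split=> //; rewrite -e2.
  by have [_ <-] := dh _ r01; rewrite -e1 /h.
apply/eqP; rewrite -subr_eq0 -normr_eq0 eq_le normr_ge0 andbT.
apply/ler_addgt0Pr => e e0; rewrite add0r.
have e20 : 0 < e / 2 by rewrite divr_gt0.
have h1 : \forall x \near a, [/\ A x, `|'D_u ('D_v f) a - 'D_u ('D_v f) x| <= e / 2 &
   `|'D_v ('D_u f) a - 'D_v ('D_u f) x| <= e / 2].
  have n1 := open_nbhs_nbhs (conj oA Aa).
  have n2 : \forall x \near a, `|'D_u ('D_v f) a - 'D_u ('D_v f) x| <= e / 2.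
    by move/cvgrPdist_le : cv => /(_ _ e20).
  have n3 : \forall x \near a, `|'D_v ('D_u f) a - 'D_v ('D_u f) x| <= e / 2.
    by move/cvgrPdist_le : cu => /(_ _ e20).
  by apply: filterS3 n1 n2 n3.
have [r /= r0 hr] := (nbhs_ballP a _).1 h1.
have {}hr x : `|x| < r -> [/\ A (a + x), `|'D_u ('D_v f) a - 'D_u ('D_v f) (a + x)| <= e / 2 &
   `|'D_v ('D_u f) a - 'D_v ('D_u f) (a + x)| <= e / 2].
  move=> xr; apply: hr; rewrite -ball_normE /ball_ /=.
  by rewrite opprD addrA subrr sub0r normrN.
(* The summand 1 keeps N positive when u = v = 0. *)
pose N := 1 + `|u| + `|v|.
have N0 : 0 < N by rewrite /N -addrA ltr_pwDl // addr_ge0.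
pose t := r / (2 * N).
have t0 : 0 < t by rewrite divr_gt0 // mulr_gt0.
have tN : t * (`|u| + `|v|) < r.
  have tNe : t * N = r / 2 by rewrite /t; field; rewrite gt_eqF.
  apply: (@le_lt_trans _ _ (t * N)).
    apply: ler_wpM2l; first exact: ltW.
    by rewrite /N -addrA lerDr ler01.
  by rewrite tNe ltr_pdivrMr // mulr_natr mulr2n ltrDl.
have small (s1 s2 : R) : 0 <= s1 <= 1 -> 0 <= s2 <= 1 -> `|s1 *: (t *: u) + s2 *: (t *: v)| < r.
  have nz s (w : V) : 0 <= s <= 1 -> `|s *: (t *: w)| <= t * `|w|.
    move=> /andP[a1 a2]; rewrite scalerA normrZ ger0_norm; last by rewrite mulr_ge0 // ltW.
    by apply: ler_wpM2r => //; rewrite ler_piMl // ltW.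
  move=> h2 h3; apply: le_lt_trans tN; rewrite mulrDr.
  by apply: le_trans (ler_normD _ _) _; rewrite lerD ?nz.
have [|r1 [s1 [r101 s101 e1]]] := mixed a (t *: u) (t *: v).
  by move=> r' s' h2 h3; rewrite -addrA; have [] := hr _ (small _ _ h2 h3).
have [|r2 [s2 [r201 s201 e2]]] := mixed a (t *: v) (t *: u).
  by move=> r' s' h2 h3; rewrite -addrA (addrC (r' *: _)); have [] := hr _ (small _ _ h3 h2).
have DD (u' v' : V) (s : R) x : A x -> 'D_(s *: v') ('D_(s *: u') f) x = s * s * 'D_v' ('D_u' f) x.
  move=> Ax; rewrite (derive_ext (g := fun y => s *: ('D_u' f y : R^o)) _ oA Ax); last first.
    by move=> y Ay; rewrite (proj2 (derive_scale _ (Coo_derivable (v:=u') hf Ay))).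
  have h2 := Coo_derivable (v:=v') (Coo_derive u' hf) Ax.
  have [h3 h4] := derive_scale s h2.
  transitivity (s * 'D_(s *: v') ('D_u' f) x); last by rewrite h4 mulrA.
  exact: (@deriveZ R V R^o ('D_u' f) s x (s *: v') h3).
rewrite -(addrA a (r1 *: _)) in e1.
rewrite -(addrA a (r2 *: _)) (addrC (r2 *: _)) in e2.
have [A1 _ B1] := hr _ (small _ _ r101 s101).
have [A2 B2 _] := hr _ (small _ _ s201 r201).
rewrite (DD _ _ _ _ A1) in e1; rewrite (DD _ _ _ _ A2) in e2.
have ee : 'D_v ('D_u f) (a + (r1 *: (t *: u) + s1 *: (t *: v))) =
          'D_u ('D_v f) (a + (s2 *: (t *: u) + r2 *: (t *: v))).
  apply: (@mulfI _ (t * t)); first by rewrite mulf_neq0 // gt_eqF.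
  have swap (x y z w : R) : x - y - (z - w) = x - z - (y - w) by ring.
  have auv : a + t *: u + t *: v = a + t *: v + t *: u := addrAC _ _ _.
  apply: etrans (esym e1) _; apply: etrans _ e2; rewrite auv; exact: swap.
rewrite (splitr e); apply: le_trans (lerD B2 B1); rewrite -ee.
set x := 'D_u _ a; set y := 'D_v _ a; set z := 'D_v _ _.
by rewrite [X in _ <= _ + X]distrC; apply: le_trans (ler_normD _ _); rewrite addrA subrK.
Qed.

End Coo.

Record open_set (R : realType) (d : nat) := OpenSet {
  open_set_set :> set 'rV[R]_d;
  open_set_open : open open_set_set
}.

(* Elements vanish outside O, so that Leibniz equality is equality on O. *)
Record smf (R : realType) (d : nat) (O : open_set R d) := Smf {
  smf_fun :> 'rV[R]_d -> R^o;
  smf_Coo : Coo O smf_fun;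
  smf_out : forall a, ~ open_set_set O a -> smf_fun a = 0
}.

Section SmoothFunctions.
Variables (R : realType) (d : nat) (O : open_set R d).
Notation V := 'rV[R]_d.
Notation inO := (open_set_set O).

Let oO : open (open_set_set O) := @open_set_open _ _ O.

HB.instance Definition _ := gen_eqMixin (smf O).
HB.instance Definition _ := gen_choiceMixin (smf O).

Lemma smf_ext (x y : smf O) : (forall a, inO a -> x a = y a) -> x = y.
Proof.
case: x y => [x hx ox] [y hy oy] /= e.
have exy : x = y.
  by apply: funext => a; have [/e//|na] := pselect (inO a); rewrite ox ?oy.
by rewrite -exy in hy oy *; congr Smf; exact: Prop_irrelevance.
Qed.

Definition mask (f : V -> R^o) : V -> R^o := fun a => if pselect (inO a) then f a else 0.

Lemma maskE f a : inO a -> mask f a = f a.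
Proof. by rewrite /mask; case: pselect. Qed.

Lemma mask_Coo f : Coo O f -> Coo O (mask f).
Proof.
by move=> hf; apply: Coo_ext hf; [exact: oO|move=> a /maskE ->].
Qed.

Lemma mask_out f a : ~ inO a -> mask f a = 0.
Proof. by rewrite /mask; case: pselect. Qed.

Definition smf_mk f (hf : Coo O f) : smf O := Smf (mask_Coo hf) (@mask_out f).

Lemma smf_mkE f (hf : Coo O f) a : inO a -> smf_mk hf a = f a.
Proof. exact: maskE. Qed.

Lemma CooD (f g : V -> R^o) : Coo O f -> Coo O g -> Coo O (fun x => f x + g x : R^o).
Proof. by move=> hf hg k; apply: CkD => //; exact: oO. Qed.

Lemma CooN (f : V -> R^o) : Coo O f -> Coo O (fun x => - f x : R^o).
Proof.
move=> hf k; under eq_fun do rewrite -mulN1r.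
by apply: (@CkZ _ _ _ k O f (-1)) => //; exact: oO.
Qed.

Lemma CooM (f g : V -> R^o) : Coo O f -> Coo O g -> Coo O (fun x => f x * g x : R^o).
Proof. by move=> hf hg k; apply: CkM => //; exact: oO. Qed.

Lemma Coo_cst (c : R) : Coo O (cst c : V -> R^o).
Proof. by move=> k; exact: Ck_cst. Qed.

Definition smf0 := smf_mk (Coo_cst 0).
Definition smf1 := smf_mk (Coo_cst 1).
Definition smfD (x y : smf O) := smf_mk (CooD (smf_Coo x) (smf_Coo y)).
Definition smfN (x : smf O) := smf_mk (CooN (smf_Coo x)).
Definition smfM (x y : smf O) := smf_mk (CooM (smf_Coo x) (smf_Coo y)).

Lemma smfDA : associative smfD.
Proof. by move=> x y z; apply: smf_ext => a Oa; rewrite !smf_mkE // addrA. Qed.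
Lemma smfDC : commutative smfD.
Proof. by move=> x y; apply: smf_ext => a Oa; rewrite !smf_mkE // addrC. Qed.
Lemma smf0D : left_id smf0 smfD.
Proof. by move=> x; apply: smf_ext => a Oa; rewrite !smf_mkE // add0r. Qed.
Lemma smfND : left_inverse smf0 smfN smfD.
Proof. by move=> x; apply: smf_ext => a Oa; rewrite !smf_mkE // addNr. Qed.

HB.instance Definition _ := GRing.isZmodule.Build (smf O) smfDA smfDC smf0D smfND.

Lemma smfMA : associative smfM.
Proof. by move=> x y z; apply: smf_ext => a Oa; rewrite !smf_mkE // mulrA. Qed.
Lemma smfMC : commutative smfM.
Proof. by move=> x y; apply: smf_ext => a Oa; rewrite !smf_mkE // mulrC. Qed.
Lemma smf1M : left_id smf1 smfM.
Proof. by move=> x; apply: smf_ext => a Oa; rewrite !smf_mkE // mul1r. Qed.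
Lemma smfMDl : left_distributive smfM smfD.
Proof. by move=> x y z; apply: smf_ext => a Oa; rewrite !smf_mkE // mulrDl. Qed.

HB.instance Definition _ := GRing.Zmodule_isComPzRing.Build (smf O) smfMA smfMC smf1M smfMDl.

(** Membership in O is an argument because at a point outside O the function 1 of the ring takes the
    value 0, and evaluation is not a ring morphism. *)
Definition ev a (Oa : inO a) (x : smf O) : R := x a.

Section Eval.
Variables (a : V) (Oa : inO a).

Lemma ev_zmod_morphism : zmod_morphism (ev Oa).
Proof.
by move=> x y; rewrite [LHS](smf_mkE _ Oa) [- y]/(smfN y) (smf_mkE _ Oa).
Qed.

Lemma ev_monoid_morphism : monoid_morphism (ev Oa).
Proof. by split=> [|x y]; rewrite [LHS](smf_mkE _ Oa). Qed.

HB.instance Definition _ := GRing.isZmodMorphism.Build (smf O) R (ev Oa) ev_zmod_morphism.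
HB.instance Definition _ := GRing.isMonoidMorphism.Build (smf O) R (ev Oa) ev_monoid_morphism.
End Eval.

(* Sealed behind Qed: unfolding derivatives makes unification explode. *)
Fact sder_ex (i : 'I_d) (x : smf O) :
  {y : smf O | forall a, inO a -> y a = 'D_(delta_mx 0 i) x a}.
Proof.
by exists (smf_mk (Coo_derive (delta_mx 0 i) (smf_Coo x))) => a; exact: smf_mkE.
Qed.

Definition sder i x := sval (sder_ex i x).

Lemma sderE i x a : inO a -> sder i x a = 'D_(delta_mx 0 i) x a.
Proof. exact: svalP (sder_ex i x) a. Qed.

Lemma sderD i x y : sder i (x + y) = sder i x + sder i y.
Proof.
apply: smf_ext => a Oa; rewrite sderE // [RHS](smf_mkE _ Oa) !sderE //.
rewrite -(@deriveD _ _ _ x y); try exact: Coo_derivable (smf_Coo _) Oa.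
by apply: (derive_ext _ oO Oa) => b Ob; rewrite [LHS](smf_mkE _ Ob).
Qed.

Lemma sderM i x y : sder i (x * y) = sder i x * y + x * sder i y.
Proof.
apply: smf_ext => a Oa; rewrite sderE // [RHS](smf_mkE _ Oa).
rewrite [sder i x * y]/(smfM _ _) [x * sder i y]/(smfM _ _) !(smf_mkE _ Oa) addrC.
rewrite (sderE i x Oa) (sderE i y Oa).
rewrite [X in _ + X]mulrC -(@deriveM _ _ x y); try exact: Coo_derivable (smf_Coo _) Oa.
by apply: (derive_ext _ oO Oa) => b Ob; rewrite [LHS](smf_mkE _ Ob).
Qed.

Lemma sderC i j x : sder i (sder j x) = sder j (sder i x).
Proof.
apply: smf_ext => a Oa.
apply: etrans (sderE i (sder j x) Oa) _.
apply: etrans _ (esym (sderE j (sder i x) Oa)).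
have -> : 'D_(delta_mx 0 i) (sder j x) a = 'D_(delta_mx 0 i) ('D_(delta_mx 0 j) x) a.
  by apply: (derive_ext _ oO Oa) => b Ob; exact: sderE.
have -> : 'D_(delta_mx 0 j) (sder i x) a = 'D_(delta_mx 0 j) ('D_(delta_mx 0 i) x) a.
  by apply: (derive_ext _ oO Oa) => b Ob; exact: sderE.
exact: schwarz oO (smf_Coo x) Oa.
Qed.

Lemma derive_smf (x : smf O) a v : inO a -> 'D_v (x : V -> R^o) a = \sum_i v 0 i * sder i x a.
Proof.
move=> Oa; rewrite (derive_partial _ oO (smf_Coo x 1%N) Oa).
by apply: eq_bigr => i _; rewrite sderE.
Qed.

End SmoothFunctions.

(** * Fields and forms in a chart *)

Section Charts.
Variables (R : realType) (d : nat) (M : manifold R d).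
Notation V := 'rV[R]_d.
Implicit Types (p q r x y : M) (U : set M) (X Y : vfield M).

Definition img U p : set V := chart p @` (U `&` chart_dom p).

Lemma img_open U p : open U -> open (img U p).
Proof.
move=> oU; rewrite openE => a [y [Uy py] <-].
have pa : (chart p @` chart_dom p) (chart p y) by exists y.
have n1 := open_nbhs_nbhs (conj (@chart_open R d M p) pa).
have n2 : nbhs (chart p y) (chart_inv p @^-1` U).
  apply: (chart_inv_continuous pa); rewrite chartK //.
  exact: (open_nbhs_nbhs (conj oU Uy)).
apply: filterS (filterI n1 n2) => _ [[z pz <-]] /=; rewrite /preimage /= chartK // => Uz.
by exists z.
Qed.

Lemma imgP U p a : img U p a ->
  [/\ U (chart_inv p a), chart_dom p (chart_inv p a) & chart p (chart_inv p a) = a].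
Proof. by move=> [y [Uy py] <-]; rewrite chartK. Qed.

Lemma img_in U p y : U y -> chart_dom p y -> img U p (chart p y).
Proof. by exists y. Qed.

Definition trans p q : V -> V := chart q \o chart_inv p.

Lemma trans_Coo p q : Coo (img (chart_dom q) p) (trans p q).
Proof. by rewrite /img setIC; exact: chart_smooth. Qed.

Lemma transE p q y : chart_dom p y -> trans p q (chart p y) = chart q y.
Proof. by move=> py; rewrite /trans /= chartK. Qed.

Lemma trans_differentiable p q y : chart_dom p y -> chart_dom q y ->
  differentiable (trans p q) (chart p y).
Proof.
move=> py qy; apply: (Ck1_differentiable_row (img_open (@chart_dom_open R d M q))).
  exact: trans_Coo.
exact: img_in.
Qed.

Lemma derive_linear (W1 W2 : normedModType R) (f : W1 -> W2) a :
  differentiable f a -> linear (fun v => 'D_v f a).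
Proof. by move=> df c u v; rewrite !deriveE // linearP. Qed.

Lemma trans_chain p q r y u : chart_dom p y -> chart_dom q y -> chart_dom r y ->
  'D_u (trans p q) (chart p y) = 'D_('D_u (trans p r) (chart p y)) (trans r q) (chart r y).
Proof.
move=> py qy ry; rewrite -[in RHS](transE r py) -derive_comp; last 2 first.
- exact: trans_differentiable.
- by rewrite transE //; exact: trans_differentiable.
apply: (derive_ext (A := img (chart_dom r) p)).
- exact: img_open (@chart_dom_open R d M r).
- exact: img_in.
by move=> a /imgP[rz pz e]; rewrite /trans /= chartK.
Qed.

Lemma trans_id p y u : chart_dom p y -> 'D_u (trans p p) (chart p y) = u.
Proof.
move=> py; rewrite -[RHS](@derive_id R V (chart p y) u).
apply: (derive_ext (A := img (chart_dom p) p)).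
- exact: img_open (@chart_dom_open R d M p).
- exact: img_in.
by move=> a /imgP[rz pz e].
Qed.

Lemma components_trans p q X y : chart_dom p y -> chart_dom q y ->
  components q X y = 'D_(components p X y) (trans p q) (chart p y).
Proof.
move=> py qy; apply: trans_chain => //; exact: chart_dom_center.
Qed.

Lemma components_ext x u p y : chart_dom x y -> chart_dom p y ->
  components p (ext x u) y = 'D_u (trans x p) (chart x y).
Proof.
by move=> xy py; rewrite [RHS](@trans_chain x p y) //; exact: chart_dom_center.
Qed.

Lemma components_ext_id x u y : chart_dom x y -> components x (ext x u) y = u.
Proof. by move=> xy; rewrite components_ext // trans_id. Qed.

Lemma ext_components x X y : chart_dom x y -> ext x (components x X y) y = X y.
Proof.
move=> xy; have yy := chart_dom_center y.
by rewrite -[RHS](trans_id _ yy) (@trans_chain y y x).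
Qed.

Lemma components_self x X : components x X x = X x.
Proof. by rewrite /components -/(trans x x) trans_id //; exact: chart_dom_center. Qed.

Lemma ext_self x u : ext x u x = u.
Proof. by rewrite /ext -/(trans x x) trans_id //; exact: chart_dom_center. Qed.

Lemma ext_linear x y : chart_dom x y -> linear (fun u => ext x u y).
Proof.
by move=> xy; apply: derive_linear; apply: trans_differentiable => //; exact: chart_dom_center.
Qed.

Lemma components_ext_eq p X Y y : X y = Y y -> components p X y = components p Y y.
Proof. by rewrite /components => ->. Qed.

Lemma componentsP (p y : M) : chart_dom p y ->
  linear (fun u : V => components p (fun _ => u) y).
Proof.
by move=> xy; apply: derive_linear; apply: trans_differentiable => //; exact: chart_dom_center.
Qed.

Lemma ext_smooth x u : smooth_field (chart_dom x) (ext x u).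
Proof.
move=> p; have ox := @chart_dom_open R d M x; have op := @chart_dom_open R d M p.
apply: (@Coo_ext _ _ _ _ ('D_u (trans x p) \o trans p x)).
- exact: (img_open ox).
- move=> a /imgP[xa pa e] /=; rewrite components_ext // -{1}e transE //.
apply: (@Coo_comp_row _ _ _ _ (img (chart_dom p) x)).
- exact: (img_open ox).
- exact: (img_open op).
- by move=> a /imgP[xa pa e]; rewrite -e transE //; exact: img_in.
- by apply: Coo_derive; exact: trans_Coo.
- exact: trans_Coo.
Qed.

(** The definition reads f in the preferred chart of y; the chain rule moves it to the chart of
    x. *)
Lemma vapply_chart x X (f : M -> R) y : chart_dom x y ->
  differentiable (f \o chart_inv x : V -> R^o) (chart x y) ->
  vapply X f y = 'D_(components x X y) (f \o chart_inv x : V -> R^o) (chart x y).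
Proof.
move=> xy df; have yy := chart_dom_center y.
rewrite /components -/(trans y x) -[in RHS](transE x yy) -derive_comp; last 2 first.
- exact: trans_differentiable.
- by rewrite transE.
apply: (derive_ext (A := img (chart_dom x) y)).
- exact: img_open (@chart_dom_open R d M x).
- exact: img_in.
by move=> a /imgP[rz pz e]; rewrite /trans /= chartK.
Qed.

End Charts.

Section SmfCoord.
Variables (R : realType) (d : nat) (O : open_set R d).
Notation V := 'rV[R]_d.
Notation inO := (open_set_set O).

Lemma ev_mk (f : V -> R^o) (hf : Coo inO f) a (Oa : inO a) : ev Oa (smf_mk hf) = f a.
Proof. exact: smf_mkE. Qed.

Definition smf_row m (f : V -> 'rV[R]_m) (hf : Coo inO f) : 'rV[smf O]_m :=
  \row_j smf_mk (Coo_coord j (@open_set_open _ _ O) hf).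

Lemma ev_row m (f : V -> 'rV[R]_m) (hf : Coo inO f) a (Oa : inO a) :
  map_mx (ev Oa) (smf_row hf) = f a.
Proof. by apply/rowP => j; rewrite !mxE ev_mk. Qed.

Lemma ev_rowE m (f : V -> 'rV[R]_m) (hf : Coo inO f) a (Oa : inO a) j :
  ev Oa (smf_row hf 0 j) = f a 0 j.
Proof. by rewrite mxE ev_mk. Qed.

Lemma derive_coord m (f : V -> 'rV[R]_m) a v l : derivable f a v ->
  ('D_v f a) 0 l = 'D_v (fun x => f x 0 l : R^o) a.
Proof. by move=> h; rewrite derive_mx // mxE. Qed.

Lemma ev_derive (x : smf O) a (Oa : inO a) v :
  'D_v (x : V -> R^o) a = \sum_i v 0 i * ev Oa (sder i x).
Proof. exact: derive_smf. Qed.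

Lemma derive_mk (f : V -> R^o) (hf : Coo inO f) a (Oa : inO a) v :
  'D_v f a = \sum_i v 0 i * ev Oa (sder i (smf_mk hf)).
Proof.
rewrite -ev_derive; apply: (derive_ext _ (@open_set_open _ _ O) Oa) => b Ob.
by rewrite smf_mkE.
Qed.

Lemma derive_row m (f : V -> 'rV[R]_m) (hf : Coo inO f) a (Oa : inO a) v l :
  ('D_v f a) 0 l = \sum_i v 0 i * ev Oa (sder i (smf_row hf 0 l)).
Proof.
rewrite derive_coord; last exact: Coo_derivable hf Oa.
by rewrite mxE; exact: derive_mk.
Qed.

End SmfCoord.

(** * Lie bracket, exterior derivative and tensors read in one fixed chart *)

Section Transport.
Variables (R : realType) (d : nat) (M : manifold R d).
Notation V := 'rV[R]_d.
Implicit Types (p q r x y : M) (U : set M) (X Y : vfield M).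

(** Chart independence of the bracket, since [lie] uses the preferred chart at y. Components in that
    chart are sums of W_j d_j t with t the transition map; differentiating them creates second
    derivatives of t, which cancel in the commutator. *)
Lemma lie_chart U x X Y y : open U -> smooth_field U X -> smooth_field U Y ->
  U y -> chart_dom x y ->
  lie X Y y = ext x ('D_(components x X y) (components x Y \o chart_inv x) (chart x y)
                     - 'D_(components x Y y) (components x X \o chart_inv x) (chart x y)) y.
Proof.
move=> oU sX sY Uy xy; have yy := chart_dom_center y.
have oUy : open (U `&` chart_dom y) by apply: openI => //; exact: (@chart_dom_open R d M y).
pose O := OpenSet (img_open (p := x) oUy); set a := chart x y; set b := chart y y.
have Oa : open_set_set O a by apply: img_in.
have sub1 : open_set_set O `<=` img (chart_dom y) x.
  by move=> _ [z [[Uz yz] xz] <-]; exact: img_in.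
have sub2 : open_set_set O `<=` img U x.
  by move=> _ [z [[Uz yz] xz] <-]; exact: img_in.
have tC : Coo O (trans x y) := Coo_sub sub1 (@trans_Coo R d M x y).
(* The inner sum is component l of W in the chart of y, written as a smooth function in the chart of
   x so that [bracket_der_morph] applies. *)
have aux (Z W : vfield M) (sW : smooth_field U W) l :
    ('D_(Z y) (components y W \o chart_inv y) b) 0 l =
    \sum_i components x Z y 0 i * ev Oa (sder i (\sum_j smf_row (Coo_sub sub2 (sW x)) 0 j *
       sder j (smf_row tC 0 l))).
  rewrite derive_coord; last first.
    by apply: Coo_derivable (sW y) _; exact: img_in.
  rewrite -ev_derive; set Psi := \sum_j _.
  have PsiE c (Oc : open_set_set O c) : Psi c = ('D_(components x W (chart_inv x c)) (trans x y) c) 0 l.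
    rewrite (derive_row tC Oc) -[LHS]/(ev Oc Psi) /Psi rmorph_sum; apply: eq_bigr => j _.
    by rewrite rmorphM; congr (_ * _); exact: (ev_rowE (Coo_sub sub2 (sW x)) Oc j).
  have dPsi : differentiable (Psi : V -> R^o) a.
    exact: Ck1_differentiable (@open_set_open _ _ O) (smf_Coo Psi 1%N) Oa.
  rewrite /components -/(trans y x) /a -(transE x yy) -derive_comp; last 2 first.
  - exact: trans_differentiable.
  - by rewrite transE.
  apply: (derive_ext (A := img (U `&` chart_dom x) y)).
  - by apply: img_open; apply: openI => //; exact: (@chart_dom_open R d M x).
  - exact: img_in.
  move=> c /imgP[[Uz xz] yz ce].
  have Oc : open_set_set O (chart x (chart_inv y c)) by apply: img_in.
  by apply: etrans _ (esym (PsiE _ Oc)); rewrite (chartK xz) -components_trans.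
apply/rowP => l.
have L : lie X Y y 0 l = ('D_(X y) (components y Y \o chart_inv y) b) 0 l
     - ('D_(Y y) (components y X \o chart_inv y) b) 0 l.
  by rewrite /lie mxE [X in _ + X]mxE.
apply: etrans L _; apply: etrans (congr2 (fun s t : R => s - t) (aux X Y sY l) (aux Y X sX l)) _.
rewrite /ext -/(trans x y); apply: etrans _ (esym (derive_row tC Oa _ l)).
set t := smf_row tC 0 l.
have cX j : components x X y 0 j = ev Oa (smf_row (Coo_sub sub2 (sX x)) 0 j).
  by rewrite (ev_rowE (Coo_sub sub2 (sX x)) Oa) /= chartK.
have cY j : components x Y y 0 j = ev Oa (smf_row (Coo_sub sub2 (sY x)) 0 j).
  by rewrite (ev_rowE (Coo_sub sub2 (sY x)) Oa) /= chartK.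
set XX := fun j => smf_row (Coo_sub sub2 (sX x)) 0 j in cX *.
set YY := fun j => smf_row (Coo_sub sub2 (sY x)) 0 j in cY *.
have bk := bracket_der_morph (@sderD R d O) (@sderM R d O) (@sderC R d O) (ev Oa) XX YY t.
transitivity (\sum_i ev Oa (XX i) * ev Oa (sder i (\sum_j YY j * sder j t))
   - \sum_i ev Oa (YY i) * ev Oa (sder i (\sum_j XX j * sder j t))).
  by congr (_ - _); apply: eq_bigr => i _; [rewrite cX|rewrite cY].
apply: etrans bk _; apply: eq_bigr => j _; congr (_ * _).
rewrite [RHS]mxE [X in _ = _ + X]mxE; congr (_ - _).
  apply: etrans _ (esym (derive_row (Coo_sub sub2 (sY x)) Oa _ j)).
  by apply: eq_bigr => i _; rewrite cX.
apply: etrans _ (esym (derive_row (Coo_sub sub2 (sX x)) Oa _ j)).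
by apply: eq_bigr => i _; rewrite cY.
Qed.

End Transport.

Section Dform.
Variables (R : realType) (d : nat) (M : manifold R d).
Notation V := 'rV[R]_d.
Implicit Types (p q r x y : M) (U : set M) (X Y : vfield M).

Lemma scalar_sum (f : V -> R) (I : finType) (c : I -> R) (u : I -> V) : scalar f ->
  f (\sum_i c i *: u i) = \sum_i c i * f (u i).
Proof.
move=> hf; have f0 : f 0 = 0 by have := hf (-1) 0 0; rewrite scaler0 addr0 mulN1r addNr.
elim/big_rec2: _ => // i y1 y2 _ <-; exact: hf.
Qed.

Lemma linear_sum_delta (f : V -> V) u : linear f ->
  f u = \sum_j u 0 j *: f (delta_mx 0 j).
Proof.
move=> hf; have f0 : f 0 = 0 by have := hf (-1) 0 0; rewrite scaler0 addr0 scaleN1r addNr.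
rewrite {1}(row_sum_delta u); elim/big_rec2: _ => // i y1 y2 _ <-; exact: hf.
Qed.

Definition hat (eta : M -> V -> R) x (w : V) : V -> R^o :=
  fun a => eta (chart_inv x a) (ext x w (chart_inv x a)).

Lemma hat_Coo eta x w : one_form eta -> Coo (img (chart_dom x) x) (hat eta x w).
Proof.
by move=> [_ h]; apply: (h (chart_dom x) (ext x w) (@chart_dom_open R d M x) (@ext_smooth R d M x w) x).
Qed.

Lemma derive_sumM (A : set V) n (f h : 'I_n -> V -> R^o) a z : A a ->
  (forall i, Coo A (f i)) -> (forall i, Coo A (h i)) ->
  'D_z (fun c => \sum_i f i c * h i c : R^o) a =
  \sum_i ('D_z (f i) a * h i a + f i a * 'D_z (h i) a).
Proof.
move=> Aa hf hh.
have -> : (fun c => \sum_i f i c * h i c : R^o) = \sum_i (f i * h i).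
  by apply: funext => c; rewrite fct_sumE.
have df i := Coo_derivable (v := z) (hf i) Aa.
have dh i := Coo_derivable (v := z) (hh i) Aa.
rewrite (derive_sum (fun i => derivableM (df i) (dh i))); apply: eq_bigr => i _.
by apply: etrans (deriveM (df i) (dh i)) _; rewrite addrC; congr (_ + _); exact: mulrC.
Qed.

Lemma hatE eta x a w : one_form eta -> chart_dom x (chart_inv x a) ->
  hat eta x w a = \sum_j w 0 j * hat eta x (delta_mx 0 j) a.
Proof.
move=> [eta_lin _] xa.
by rewrite /hat (linear_sum_delta w (ext_linear xa)) (scalar_sum _ _ (eta_lin _)).
Qed.

Lemma components_at x y w (Az : vfield M) : chart_dom x y -> Az y = ext x w y ->
  components x Az y = w.
Proof.
move=> xy e; exact: etrans (components_ext_eq x (Y := ext x w) e) (components_ext_id w xy).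
Qed.

Lemma lie_chart_at U x X Y y u v : open U -> smooth_field U X -> smooth_field U Y ->
  U y -> chart_dom x y -> components x X y = u -> components x Y y = v ->
  lie X Y y = ext x ('D_u (components x Y \o chart_inv x) (chart x y)
                     - 'D_v (components x X \o chart_inv x) (chart x y)) y.
Proof. by move=> oU sX sY Uy xy <- <-; exact: lie_chart Uy xy. Qed.

Lemma lie_flat U x X Y y a u v b c : open U -> smooth_field U X -> smooth_field U Y ->
  U y -> chart_dom x y -> chart x y = a -> components x X y = u -> components x Y y = v ->
  'D_u (components x Y \o chart_inv x) a = b ->
  'D_v (components x X \o chart_inv x) a = c -> lie X Y y = ext x (b - c) y.
Proof.
move=> oU sX sY Uy xy <- cu cv <- <-.
exact: (lie_chart_at oU sX sY Uy xy cu cv).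
Qed.

Lemma vapply_ext eta x y z w (Az Aw : vfield M) : one_form eta -> chart_dom x y ->
  smooth_field (chart_dom y) Aw -> Az y = ext x z y -> Aw y = ext x w y ->
  vapply Az (fun q => eta q (Aw q)) y = 'D_z (hat eta x w) (chart x y) +
     eta y (ext x ('D_z (components x Aw \o chart_inv x) (chart x y)) y).
Proof.
move=> heta xy sAw eAz eAw; have [eta_lin eta_sm] := heta.
have yy := chart_dom_center y; have oy := @chart_dom_open R d M y.
set a := chart x y; pose A := img (chart_dom y) x.
have oA : open A := img_open (p := x) oy.
have Aa : A a by exact: img_in.
have ax : img (chart_dom x) x a by exact: img_in.
have sub : A `<=` img (chart_dom x) x by move=> _ [q [yq xq] <-]; exact: img_in.
have fC : Coo A ((fun q => eta q (Aw q)) \o chart_inv x : V -> R^o) := eta_sm _ _ oy sAw x.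
rewrite (vapply_chart Az xy (Ck1_differentiable oA (fC 1%N) Aa)).
rewrite (components_at xy eAz).
have bC : Coo A (components x Aw \o chart_inv x) := sAw x.
have bjC j : Coo A (fun c => (components x Aw (chart_inv x c)) 0 j : R^o) := Coo_coord j oA bC.
have hC j : Coo A (hat eta x (delta_mx 0 j)) := Coo_sub sub (hat_Coo x _ heta).
transitivity ('D_z (fun c => \sum_j (components x Aw (chart_inv x c)) 0 j *
                                     hat eta x (delta_mx 0 j) c : R^o) a).
  apply: (derive_ext _ oA Aa) => c /imgP[yc xc _].
  by rewrite -(hatE _ heta xc) /hat ext_components.
rewrite (derive_sumM z Aa bjC hC) big_split addrC /=; congr (_ + _).
  rewrite (linear_sum_delta _ (ext_linear xy)) (scalar_sum _ _ (eta_lin _)).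
  apply: eq_bigr => j _; congr (_ * _); last by rewrite /hat /a (chartK xy).
  exact: esym (derive_coord j (Coo_derivable bC Aa)).
rewrite /a (chartK xy) (components_at xy eAw).
transitivity ('D_z (fun c => \sum_j cst (w 0 j) c * hat eta x (delta_mx 0 j) c : R^o) a).
  rewrite (@derive_sumM A _ (fun j => cst (w 0 j))) // => [|j k]; last exact: Ck_cst.
  by apply: eq_bigr => j _; rewrite derive_cst mul0r add0r.
by apply: (derive_ext _ oA Aa) => c /imgP[yc xc _]; rewrite (hatE w heta xc).
Qed.

Lemma scalarB (f : V -> R) a b : scalar f -> f (b - a) = f b - f a.
Proof. by move=> hf; have := hf (-1) a b; rewrite scaleN1r mulN1r [- a + b]addrC [RHS]addrC. Qed.

Lemma form_extB eta x y a' b' : (forall z, scalar (eta z)) -> chart_dom x y ->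
  eta y (ext x (b' - a') y) = eta y (ext x b' y) - eta y (ext x a' y).
Proof.
move=> eta_lin xy; apply: (@scalarB (fun w => eta y (ext x w y))) => c u v.
by rewrite (ext_linear xy) eta_lin.
Qed.

(** Tensoriality of d eta: only the values u and v enter, so the fields [ext] of one chart may be
    exchanged for those of another. *)
Lemma dfields_chart eta x y u v (A B : vfield M) : one_form eta -> chart_dom x y ->
  smooth_field (chart_dom y) A -> smooth_field (chart_dom y) B ->
  A y = ext x u y -> B y = ext x v y ->
  dfields eta A B y =
  2^-1 * ('D_u (hat eta x v) (chart x y) - 'D_v (hat eta x u) (chart x y)).
Proof.
move=> heta xy sA sB eA eB; have [eta_lin _] := heta.
have yy := chart_dom_center y; have oy := @chart_dom_open R d M y.
have h1 := vapply_ext heta xy sB eA eB.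
have h2 := vapply_ext heta xy sA eB eA.
have h4 := lie_chart_at oy sA sB yy xy (components_at xy eA) (components_at xy eB).
have h5 := etrans (congr1 (eta y) h4) (form_extB _ _ eta_lin xy).
have e (v1 v2 l D1 D2 e1 e2 : R) : v1 = D1 + e1 -> v2 = D2 + e2 -> l = e1 - e2 ->
  v1 - v2 - l = D1 - D2 by move=> -> -> ->; ring.
by rewrite /dfields (e _ _ _ _ _ _ _ h1 h2 h5).
Qed.

Lemma dform_chart eta x y u v : one_form eta -> chart_dom x y ->
  dform eta y (ext x u y) (ext x v y) =
  2^-1 * ('D_u (hat eta x v) (chart x y) - 'D_v (hat eta x u) (chart x y)).
Proof.
move=> heta xy; apply: (dfields_chart heta xy); first exact: ext_smooth.
- exact: ext_smooth.
- exact: ext_self.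
- exact: ext_self.
Qed.

End Dform.

Section Matrices.
Variables (R : realType) (d : nat).
Notation V := 'rV[R]_d.

Lemma bilin_mxP (A B : 'M[R]_d) :
  (forall u v : V, (u *m A *m v^T) 0 0 = (u *m B *m v^T) 0 0) -> A = B.
Proof.
move=> h; apply/matrixP => i j; have := h (delta_mx 0 i) (delta_mx 0 j).
by rewrite -!rowE trmx_delta -!colE !mxE.
Qed.

Lemma bilin_sum (g : V -> V -> R) u v : (forall u, scalar (g u)) ->
  (forall v, scalar (fun u => g u v)) ->
  g u v = (u *m (\matrix_(i, j) g (delta_mx 0 i) (delta_mx 0 j)) *m v^T) 0 0.
Proof.
move=> g1 g2; rewrite {1}(row_sum_delta u) (scalar_sum _ _ (g2 v)) -mulmxA mxE.
apply: eq_bigr => i _; congr (_ * _); rewrite {1}(row_sum_delta v) (scalar_sum _ _ (g1 _)) mxE.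
by apply: eq_bigr => j _; rewrite !mxE mulrC.
Qed.
End Matrices.

Section Flat.
Variables (R : realType) (d : nat) (M : manifold R d) (x : M).
Notation V := 'rV[R]_d.

Definition dom_set := OpenSet (img_open (p := x) (@chart_dom_open R d M x)).
Notation O := dom_set.

Lemma dom_setP a : open_set_set O a -> chart_dom x (chart_inv x a) /\ chart x (chart_inv x a) = a.
Proof. by case/imgP. Qed.

Lemma ext_inj u v y : chart_dom x y -> ext x u y = ext x v y -> u = v.
Proof.
move=> xy e; have h1 : components x (ext x u) y = u by exact: components_ext_id.
have h2 : components x (ext x u) y = v by exact: components_at.
by rewrite -h1.
Qed.

Section FlatP.
Variables (phi : M -> V -> V) (hphi : tensor11 phi).

Lemma flatP_Coo (u : V) : Coo O (components x (fun y => phi y (ext x u y)) \o chart_inv x).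
Proof.
have [_ h] := hphi; exact: (h _ _ (@chart_dom_open R d M x) (ext_smooth x u) x).
Qed.

Definition flatP : 'M[smf O]_d := \matrix_(i, j) smf_row (flatP_Coo (delta_mx 0 i)) 0 j.

Lemma flatPE a (Oa : open_set_set O a) u :
  ext x (u *m map_mx (ev Oa) flatP) (chart_inv x a) = phi (chart_inv x a) (ext x u (chart_inv x a)).
Proof.
have [xy _] := dom_setP Oa; set y := chart_inv x a in xy *.
pose f (u : V) := components x (fun y => phi y (ext x u y)) y.
have [phi_lin _] := hphi.
have fl : linear f.
  move=> c v w; rewrite /f /components (ext_linear xy) phi_lin.
  exact: (componentsP xy).
have -> : u *m map_mx (ev Oa) flatP = f u.
  rewrite (linear_sum_delta _ fl) mulmx_sum_row; apply: eq_bigr => i _; congr (_ *: _).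
  by apply/rowP => j; rewrite mxE [LHS]mxE [flatP _ _]mxE ev_rowE.
by rewrite /f ext_components.
Qed.
End FlatP.

Section FlatX.
Variables (X : vfield M) (hX : smooth_field setT X).

Lemma flatX_Coo : Coo O (components x X \o chart_inv x).
Proof.
apply: Coo_sub (hX x) => _ [y [xy _] <-]; exact: img_in.
Qed.

Definition flatX : 'rV[smf O]_d := smf_row flatX_Coo.

Lemma flatX_components a (Oa : open_set_set O a) :
  map_mx (ev Oa) flatX = components x X (chart_inv x a).
Proof. exact: ev_row. Qed.

Lemma flatXE a (Oa : open_set_set O a) : ext x (map_mx (ev Oa) flatX) (chart_inv x a) = X (chart_inv x a).
Proof. by have [xy _] := dom_setP Oa; rewrite flatX_components ext_components. Qed.
End FlatX.

Section FlatE.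
Variables (eta : M -> V -> R) (heta : one_form eta).

Definition flatE : 'cV[smf O]_d := \col_i smf_mk (hat_Coo x (delta_mx 0 i) heta : Coo O _).

Lemma flatEE a (Oa : open_set_set O a) u :
  (u *m map_mx (ev Oa) flatE) 0 0 = eta (chart_inv x a) (ext x u (chart_inv x a)).
Proof.
have [xy _] := dom_setP Oa; rewrite -[RHS]/(hat eta x u a) (hatE _ heta xy) mxE.
by apply: eq_bigr => i _; rewrite mxE [flatE _ _]mxE ev_mk.
Qed.

Lemma flat_dform a (Oa : open_set_set O a) u v :
  2 * dform eta (chart_inv x a) (ext x u (chart_inv x a)) (ext x v (chart_inv x a)) =
  (u *m map_mx (ev Oa) (dd (@sder _ _ O) flatE) *m v^T) 0 0.
Proof.
have [xy ya] := dom_setP Oa.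
have D (z w : V) : 'D_z (hat eta x w) a =
    \sum_i \sum_j z 0 i * (w 0 j * ev Oa (sder i (flatE j 0))).
  transitivity ('D_z (fun c => \sum_j cst (w 0 j) c * hat eta x (delta_mx 0 j) c : R^o) a).
    apply: (derive_ext _ (@open_set_open _ _ O) Oa) => c /dom_setP[xc _].
    exact: hatE.
  rewrite (@derive_sumM R d O d (fun j => cst (w 0 j)) _ a z Oa
    (fun j k => @Ck_cst R d R^o k O (w 0 j)) (fun j => hat_Coo x (delta_mx 0 j) heta)).
  rewrite exchange_big; apply: eq_bigr => j _ /=.
  rewrite derive_cst mul0r add0r (derive_mk (hat_Coo x (delta_mx 0 j) heta : Coo O _) Oa) mulr_sumr.
  by apply: eq_bigr => i _; rewrite [flatE _ _]mxE mulrCA.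
rewrite (dform_chart _ _ heta xy) ya mulrA divff ?pnatr_eq0 // mul1r !D.
rewrite -mulmxA mxE [X in _ - X]exchange_big -sumrB; apply: eq_bigr => i _.
rewrite -sumrB [X in _ = _ * X]mxE mulr_sumr; apply: eq_bigr => j _.
rewrite [X in _ = _ * (X * _)]mxE [dd _ _ _ _]mxE rmorphB [X in _ = _ * (_ * X)]mxE; ring.
Qed.
End FlatE.

Section FlatW.
Variables (w : M -> V -> V -> R) (hw : tensor02 w).

Lemma flatW_Coo (u v : V) :
  Coo O ((fun y => w y (ext x u y) (ext x v y)) \o chart_inv x : V -> R^o).
Proof.
have [_ _ h] := hw.
exact: (h _ _ _ (@chart_dom_open R d M x) (ext_smooth x u) (ext_smooth x v) x).
Qed.

Definition flatW : 'M[smf O]_d :=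
  \matrix_(i, j) smf_mk (flatW_Coo (delta_mx 0 i) (delta_mx 0 j)).

Lemma flatWE a (Oa : open_set_set O a) u v : (u *m map_mx (ev Oa) flatW *m v^T) 0 0 =
  w (chart_inv x a) (ext x u (chart_inv x a)) (ext x v (chart_inv x a)).
Proof.
have [xy _] := dom_setP Oa; have [w1 w2 _] := hw.
rewrite (@bilin_sum R d (fun u v => w (chart_inv x a) (ext x u (chart_inv x a)) (ext x v (chart_inv x a)))).
- congr ((_ *m _ *m _) _ _); apply/matrixP => i j.
  by rewrite mxE [flatW _ _]mxE ev_mk mxE.
- by move=> u' c v1 v2; rewrite (ext_linear xy) w1.
by move=> v' c v1 v2; rewrite (ext_linear xy) w2.
Qed.
End FlatW.

End Flat.

Section FlatLie.
Variables (R : realType) (d : nat) (M : manifold R d) (x : M).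
Notation V := 'rV[R]_d.
Notation O := (dom_set x).
Notation der := (@sder R d O).

Lemma ev_sder_mk (f : V -> R^o) (hf : Coo O f) a (Oa : open_set_set O a) i :
  ev Oa (sder i (smf_mk hf)) = 'D_(delta_mx 0 i) f a.
Proof.
apply: etrans (sderE i (smf_mk hf) Oa) _.
by apply: (derive_ext _ (@open_set_open _ _ O) Oa) => b Ob; rewrite smf_mkE.
Qed.

Lemma derive_flatX X (hX : smooth_field setT X) a (Oa : open_set_set O a) z :
  'D_z (components x X \o chart_inv x) a = z *m map_mx (ev Oa) (jac der (flatX x hX)).
Proof.
apply/rowP => l; rewrite (derive_row (flatX_Coo x hX) Oa) [RHS]mxE.
by apply: eq_bigr => i _; rewrite [X in _ = _ * X]mxE [jac _ _ _ _]mxE.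
Qed.

Lemma derive_const u z a : open_set_set O a ->
  'D_z (components x (ext x u) \o chart_inv x) a = 0.
Proof.
move=> Oa; rewrite -[RHS](@derive_cst R V V u a z).
apply: (derive_ext _ (@open_set_open _ _ O) Oa) => c /dom_setP[xc _].
exact: components_ext_id.
Qed.

Section WithPhi.
Variables (phi : M -> V -> V) (hphi : tensor11 phi).

Lemma components_flatP u a (Oa : open_set_set O a) :
  components x (fun y => phi y (ext x u y)) (chart_inv x a) = u *m map_mx (ev Oa) (flatP x hphi).
Proof.
have [xy _] := dom_setP Oa; apply: components_at => //; exact: esym (flatPE _ _ _).
Qed.

Lemma derive_flatP X (hX : smooth_field setT X) u a (Oa : open_set_set O a) :
  'D_(map_mx (ev Oa) (flatX x hX)) (components x (fun y => phi y (ext x u y)) \o chart_inv x) a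
  = u *m map_mx (ev Oa) (dirmx der (flatX x hX) (flatP x hphi)).
Proof.
apply/rowP => l; set z := map_mx _ _.
rewrite (derive_coord l (Coo_derivable (flatP_Coo x hphi u) Oa)).
transitivity ('D_z (fun c => \sum_j cst (u 0 j) c * (flatP x hphi j l : V -> R^o) c : R^o) a).
  apply: (derive_ext _ (@open_set_open _ _ O) Oa) => c Oc /=.
  by rewrite (components_flatP u Oc) mxE; apply: eq_bigr => j _; rewrite [map_mx _ _ _ _]mxE.
rewrite (@derive_sumM R d O d (fun j => cst (u 0 j)) _ a z Oa
    (fun j k => @Ck_cst R d R^o k O (u 0 j)) (fun j => smf_Coo (flatP x hphi j l))).
rewrite mxE; apply: eq_bigr => j _; rewrite derive_cst mul0r add0r; congr (_ * _).
rewrite (ev_derive _ Oa) [RHS]mxE dirmxE rmorph_sum; apply: eq_bigr => i _.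
by rewrite rmorphM [z _ _]mxE.
Qed.

Lemma lie_ext_flat X (hX : smooth_field setT X) u a (Oa : open_set_set O a) :
  lie (ext x u) X (chart_inv x a) =
  ext x (u *m map_mx (ev Oa) (jac der (flatX x hX))) (chart_inv x a).
Proof.
have [xy ya] := dom_setP Oa; have od := @chart_dom_open R d M x.
have sX : smooth_field (chart_dom x) X.
  by move=> p; apply: Coo_sub (hX p) => _ [q [xq pq] <-]; exact: img_in.
have := lie_flat od (ext_smooth x u) sX xy xy ya (components_ext_id u xy) erefl
  (derive_flatX hX Oa u) (derive_const u _ Oa).
by rewrite subr0.
Qed.

Lemma lie_phi_flat X (hX : smooth_field setT X) u a (Oa : open_set_set O a) :
  lie (fun y => phi y (ext x u y)) X (chart_inv x a) =
  ext x (u *m map_mx (ev Oa) (flatP x hphi) *m map_mx (ev Oa) (jac der (flatX x hX))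
         - u *m map_mx (ev Oa) (dirmx der (flatX x hX) (flatP x hphi))) (chart_inv x a).
Proof.
have [xy ya] := dom_setP Oa; have od := @chart_dom_open R d M x.
have sX : smooth_field (chart_dom x) X.
  by move=> p; apply: Coo_sub (hX p) => _ [q [xq pq] <-]; exact: img_in.
have sP : smooth_field (chart_dom x) (fun y => phi y (ext x u y)).
  by have [_ h] := hphi; exact: (h _ _ od (ext_smooth x u)).
exact: (lie_flat od sP sX xy xy ya (components_flatP u Oa) (esym (flatX_components hX Oa))
  (derive_flatX hX Oa _) (derive_flatP hX u Oa)).
Qed.
End WithPhi.

Lemma lie_zero (X Y : vfield M) y : (forall q, Y q = 0) -> lie X Y y = 0.
Proof.
move=> Y0; have -> : Y = (fun=> 0) by apply: funext.
have e : components y (fun=> 0 : V) \o chart_inv y = cst 0.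
  by apply: funext => c; exact: derive0.
have h1 : 'D_(X y) (components y (fun=> 0 : V) \o chart_inv y) (chart y y) = 0.
  by rewrite e; exact: derive_cst.
have h2 : 'D_0 (components y X \o chart_inv y) (chart y y) = 0 := derive0 _ _.
exact: etrans (congr2 (fun s t : V => s - t) h1 h2) (subr0 _).
Qed.

Lemma lie_ext_ext u v a : open_set_set O a -> lie (ext x u) (ext x v) (chart_inv x a) = 0.
Proof.
move=> Oa; have [xy ya] := dom_setP Oa; have od := @chart_dom_open R d M x.
have -> := lie_flat od (ext_smooth x u) (ext_smooth x v) xy xy ya (components_ext_id u xy)
  (components_ext_id v xy) (derive_const v u Oa) (derive_const u v Oa).
rewrite subrr.
by have := ext_linear xy (-1) 0 0; rewrite scaler0 addr0 scaleN1r addNr.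
Qed.

(** Closedness is tested on the coordinate fields of the chart, whose brackets vanish. *)
Lemma flatW_closed (w : M -> V -> V -> R) (hw : tensor02 w) : closed_form w ->
  forall a (Oa : open_set_set O a) i j l,
  ev Oa (sder i (flatW x hw j l)) + ev Oa (sder j (flatW x hw l i))
    + ev Oa (sder l (flatW x hw i j)) = 0.
Proof.
move=> cw a Oa i j l; have [xy ya] := dom_setP Oa; have [w1 w2 _] := hw.
have od := @chart_dom_open R d M x.
have w0 y v : w y 0 v = 0.
  by have := w2 y v (-1) 0 0; rewrite scaler0 addr0 mulN1r addNr.
have va i' j' l' : vapply (ext x (delta_mx 0 i'))
   (fun y => w y (ext x (delta_mx 0 j') y) (ext x (delta_mx 0 l') y)) (chart_inv x a) =
   ev Oa (sder i' (flatW x hw j' l')).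
  rewrite [flatW _ _ _ _]mxE ev_sder_mk.
  have dw : differentiable ((fun y => w y (ext x (delta_mx 0 j') y) (ext x (delta_mx 0 l') y))
     \o chart_inv x : V -> R^o) (chart x (chart_inv x a)).
    rewrite ya; exact: Ck1_differentiable (@open_set_open _ _ O) (flatW_Coo x hw _ _ 1%N) Oa.
  by rewrite (vapply_chart _ xy dw) (components_ext_id _ xy) ya.
have := cw _ _ _ _ od (ext_smooth x (delta_mx 0 i)) (ext_smooth x (delta_mx 0 j))
  (ext_smooth x (delta_mx 0 l)) _ xy.
have l1 := lie_ext_ext (delta_mx 0 i) (delta_mx 0 j) Oa.
have l2 := lie_ext_ext (delta_mx 0 j) (delta_mx 0 l) Oa.
have l3 := lie_ext_ext (delta_mx 0 l) (delta_mx 0 i) Oa.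
have z (v1 v2 v3 w1' w2' w3' e1 e2 e3 : R) : v1 = e1 -> v2 = e2 -> v3 = e3 ->
    w1' = 0 -> w2' = 0 -> w3' = 0 -> v1 + v2 + v3 - w1' - w2' - w3' = 0 -> e1 + e2 + e3 = 0.
  by move=> -> -> -> -> -> ->; rewrite !subr0.
apply: (z _ _ _ _ _ _ _ _ _ (va i j l) (va j l i) (va l i j)).
- by rewrite l1 w0.
- by rewrite l2 w0.
- by rewrite l3 w0.
Qed.

End FlatLie.

Lemma tensor02_comp (R : realType) (d : nat) (M : manifold R d)
    (g : M -> 'rV[R]_d -> 'rV[R]_d -> R) (L : M -> 'rV[R]_d -> 'rV[R]_d) :
  tensor02 g -> tensor11 L -> tensor02 (fun y u v => g y u (L y v)).
Proof.
move=> [g1 g2 g3] [L1 L2]; split.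
- by move=> y u c v w; rewrite L1 g1.
- by move=> y v c u w; rewrite g2.
move=> U X Y oU sX sY; exact: (g3 U X (fun y => L y (Y y)) oU sX (L2 U Y oU sY)).
Qed.

(** * Closedness of a 2-form from the cyclic identity for its coefficients *)

Section BilinearDerivative.
Variables (R : realType) (d : nat) (O : open_set R d).
Notation V := 'rV[R]_d.
Variables (B : set V) (W : 'M[smf O]_d).
Hypothesis oB : open B.
Hypothesis BO : B `<=` open_set_set O.

Lemma derive_bilinear (Y Z : V -> V) a (Oa : open_set_set O a) z : B a -> Coo B Y -> Coo B Z ->
  'D_z (fun c => \sum_i Y c 0 i * (\sum_j Z c 0 j * (W i j : V -> R^o) c) : R^o) a =
  (('D_z Y a) *m map_mx (ev Oa) W *m (Z a)^T) 0 0
  + (Y a *m map_mx (ev Oa) W *m ('D_z Z a)^T) 0 0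
  + \sum_i \sum_j \sum_l Y a 0 i * Z a 0 j * z 0 l * ev Oa (sder l (W i j)).
Proof.
move=> Ba hY hZ.
have hYi i := Coo_coord i oB hY; have hZi i := Coo_coord i oB hZ.
have hW i j : Coo B (W i j : V -> R^o) := Coo_sub BO (smf_Coo (W i j)).
have hS i : Coo B (fun c => \sum_j Z c 0 j * (W i j : V -> R^o) c : R^o).
  by move=> k; apply: Ck_sum => // j; apply: CkM => //; [exact: hZi|exact: hW].
rewrite (derive_sumM z Ba hYi hS).
have dY i : 'D_z (fun c => Y c 0 i : R^o) a = ('D_z Y a) 0 i.
  by rewrite (derive_coord i (Coo_derivable hY Ba)).
have dZ i : 'D_z (fun c => Z c 0 i : R^o) a = ('D_z Z a) 0 i.
  by rewrite (derive_coord i (Coo_derivable hZ Ba)).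
have dS i : 'D_z (fun c => \sum_j Z c 0 j * (W i j : V -> R^o) c : R^o) a =
    \sum_j ('D_z Z a 0 j * W i j a + Z a 0 j * \sum_l z 0 l * ev Oa (sder l (W i j))).
  rewrite (derive_sumM z Ba hZi (hW i)); apply: eq_bigr => j _.
  by rewrite dZ (ev_derive _ Oa).
rewrite -!mulmxA !mxE -!big_split /=; apply: eq_bigr => i _.
rewrite dY dS !mxE big_split /= mulrDr !mulr_sumr addrA; congr (_ + _ + _).
- by apply: eq_bigr => j _; rewrite !mxE; congr (_ * _); exact: mulrC.
- by apply: eq_bigr => j _; rewrite !mxE; congr (_ * _); exact: mulrC.
by apply: eq_bigr => j _; rewrite mulr_sumr mulr_sumr; apply: eq_bigr => l _; rewrite !mulrA.
Qed.
End BilinearDerivative.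

Section ClosedForm.
Variables (R : realType) (d : nat) (M : manifold R d) (w : M -> 'rV[R]_d -> 'rV[R]_d -> R).
Notation V := 'rV[R]_d.
Hypothesis hw : tensor02 w.
Hypothesis w_skew : forall x u v, w x u v = - w x v u.
Hypothesis flat_cyc : forall x (Ox : open_set_set (dom_set x) (chart x x)) i j l,
  ev Ox (sder i (flatW x hw j l)) + ev Ox (sder j (flatW x hw l i))
  + ev Ox (sder l (flatW x hw i j)) = 0.

Lemma vapply_bilinear U (X Y Z : vfield M) x (Ox : open_set_set (dom_set x) (chart x x)) :
  open U -> U x -> smooth_field U Y -> smooth_field U Z ->
  vapply X (fun y => w y (Y y) (Z y)) x =
  w x ('D_(X x) (components x Y \o chart_inv x) (chart x x)) (Z x)
  + w x (Y x) ('D_(X x) (components x Z \o chart_inv x) (chart x x))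
  + \sum_i \sum_j \sum_l Y x 0 i * Z x 0 j * X x 0 l * ev Ox (sder l (flatW x hw i j)).
Proof.
move=> oU Ux sY sZ; set a := chart x x; set O := dom_set x.
have xx := chart_dom_center x; have ya : chart_inv x a = x by rewrite /a chartK.
have BO : img U x `<=` open_set_set O by move=> _ [y [Uy xy] <-]; exact: img_in.
have Ba : img U x a by exact: img_in.
have w0 u v : w x u v = (u *m map_mx (ev Ox) (flatW x hw) *m v^T) 0 0.
  by rewrite (flatWE hw Ox) ya !ext_self.
have e (F : vfield M) : (components x F \o chart_inv x) a = F x.
  by rewrite /= ya components_self.
rewrite !w0 -(e Y) -(e Z) -(derive_bilinear (flatW x hw) (img_open (p := x) oU) BO Ox _ Ba (sY x) (sZ x)).
apply: (derive_ext _ (img_open (p := x) oU) Ba) => b /imgP[Ub xb cb].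
have Ob : open_set_set O b by apply: BO; rewrite -cb; exact: img_in.
transitivity ((components x Y (chart_inv x b) *m map_mx (ev Ob) (flatW x hw) *m
  (components x Z (chart_inv x b))^T) 0 0).
  by rewrite (flatWE hw Ob) !ext_components.
rewrite -mulmxA mxE; apply: eq_bigr => i _; congr (_ * _); rewrite mxE.
by apply: eq_bigr => j _; rewrite !mxE mulrC.
Qed.
(** Every point is the centre of its preferred chart, so the identity at centres suffices. Terms
    that differentiate the fields cancel against the brackets because w is skew; what remains is the
    cyclic sum of derivatives of the coefficients. *)
Lemma closed_form_flat : closed_form w.
Proof.
move=> U X Y Z oU sX sY sZ x Ux; have [w1 w2 _] := hw.
have Ox : open_set_set (dom_set x) (chart x x) by apply: img_in; exact: chart_dom_center.
pose D (A B : vfield M) := 'D_(A x) (components x B \o chart_inv x) (chart x x).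
pose S (A B C : vfield M) := \sum_i \sum_j \sum_l B x 0 i * C x 0 j * A x 0 l * ev Ox (sder l (flatW x hw i j)).
have v A B C : smooth_field U B -> smooth_field U C ->
    vapply A (fun y => w y (B y) (C y)) x = w x (D A B) (C x) + w x (B x) (D A C) + S A B C.
  exact: vapply_bilinear.
have wB a b c : w x (a - b) c = w x a c - w x b c.
  by rewrite [a - b]addrC -scaleN1r w2 mulN1r addrC.
have L A B C : w x (lie A B x) C = w x (D A B) C - w x (D B A) C by exact: wB.
have rotS (F : 'I_d -> 'I_d -> 'I_d -> R) :
    \sum_i \sum_j \sum_l F i j l = \sum_i \sum_j \sum_l F j l i.
  by rewrite [RHS]exchange_big; apply: eq_bigr => j _; rewrite [RHS]exchange_big.
have cS : S X Y Z + S Y Z X + S Z X Y = 0.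
  rewrite [S Y Z X]rotS [S Z X Y]rotS [\sum_i \sum_j \sum_l X x 0 j * _ * _ * _]rotS.
  rewrite /S -!big_split big1 //= => i _; rewrite -!big_split big1 //= => j _.
  rewrite -!big_split big1 //= => l _.
  have := flat_cyc Ox i j l; set p1 := ev _ _; set p2 := ev _ _; set p3 := ev _ _ => h.
  rewrite -[RHS](mulr0 (Y x 0 i * Z x 0 j * X x 0 l)) -h; ring.
have z (b1 b2 b3 b4 b5 b6 b1' b2' b3' s1 s2 s3 v1 v2 v3 l1 l2 l3 : R) :
    v1 = b1 + b2' + s1 -> v2 = b3 + b1' + s2 -> v3 = b5 + b3' + s3 ->
    b2' = - b2 -> b1' = - b4 -> b3' = - b6 ->
    l1 = b1 - b4 -> l2 = b3 - b6 -> l3 = b5 - b2 -> s1 + s2 + s3 = 0 ->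
    v1 + v2 + v3 - l1 - l2 - l3 = 0.
  by move=> -> -> -> -> -> -> -> -> -> h; rewrite -[RHS]h; ring.
exact: (z _ _ _ _ _ _ _ _ _ _ _ _ _ _ _ _ _ _ (v X Y Z sY sZ) (v Y Z X sZ sX) (v Z X Y sX sY)
  (w_skew _ _ _) (w_skew _ _ _) (w_skew _ _ _) (L X Y (Z x)) (L Y Z (X x)) (L Z X (Y x)) cS).
Qed.
End ClosedForm.

(** * 3-quasi-Sasakian manifolds *)

(* The algebra at one point, where J identifies R^d with the tangent space. *)
Section PointAlgebra.
Variables (R : realType) (d : nat).
Notation V := 'rV[R]_d.
Variable J : V -> V.
Hypothesis Jlin : linear J.
Hypothesis Jinj : injective J.

Lemma J0 : J 0 = 0.
Proof. by have := Jlin (-1) 0 0; rewrite scaler0 addr0 scaleN1r addNr. Qed.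
Lemma JZ c u : J (c *: u) = c *: J u.
Proof. by rewrite -[c *: u]addr0 Jlin J0 addr0. Qed.
Lemma JD u v : J (u + v) = J u + J v.
Proof. by have := Jlin 1 u v; rewrite !scale1r. Qed.
Lemma JN u : J (- u) = - J u.
Proof. by rewrite -[- u]scaleN1r JZ scaleN1r. Qed.

Variables (phi1 phi2 phi3 : V -> V) (p1 p2 p3 : 'M[R]_d).
Hypothesis hp1 : forall u, J (u *m p1) = phi1 (J u).
Hypothesis hp2 : forall u, J (u *m p2) = phi2 (J u).
Hypothesis hp3 : forall u, J (u *m p3) = phi3 (J u).
Variables (eta1 eta2 eta3 : V -> R) (e1 e2 e3 : 'cV[R]_d).
Hypothesis he1 : forall u, (u *m e1) 0 0 = eta1 (J u).
Hypothesis he2 : forall u, (u *m e2) 0 0 = eta2 (J u).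
Hypothesis he3 : forall u, (u *m e3) 0 0 = eta3 (J u).
Variables (xi1 xi2 xi3 : V) (x1 x2 x3 : 'rV[R]_d).
Hypothesis hx1 : J x1 = xi1.
Hypothesis hx2 : J x2 = xi2.
Hypothesis hx3 : J x3 = xi3.
Variables (g : V -> V -> R) (gm : 'M[R]_d).
Hypothesis hg : forall u v, (u *m gm *m v^T) 0 0 = g (J u) (J v).

Lemma outer (u : V) (e : 'cV[R]_d) (x : V) : u *m (e *m x) = (u *m e) 0 0 *: x.
Proof. by rewrite mulmxA {1}[u *m e]mx11_scalar mul_scalar_mx. Qed.

Lemma flat_sq : (forall v, phi1 (phi1 v) = - v + eta1 v *: xi1) -> p1 *m p1 = e1 *m x1 - 1%:M.
Proof.
move=> h; apply: row_mxP => u; apply: Jinj.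
by rewrite mulmxA hp1 hp1 h mulmxBr mulmx1 outer JD JN JZ hx1 he1 addrC.
Qed.

Lemma flat_unit : eta1 xi1 = 1 -> x1 *m e1 = 1%:M.
Proof. by move=> h; rewrite [LHS]mx11_scalar he1 hx1 h. Qed.

Lemma flat_sym : (forall u v, g u v = g v u) -> gm^T = gm.
Proof.
move=> h; apply: bilin_mxP => u v; rewrite hg h -hg.
transitivity ((v *m gm *m u^T)^T 0 0); last by rewrite mxE.
by rewrite !trmx_mul trmxK mulmxA.
Qed.

Lemma flat_compat : (forall u v, g (phi1 u) (phi1 v) = g u v - eta1 u * eta1 v) ->
  p1 *m gm *m p1^T = gm - e1 *m e1^T.
Proof.
move=> h; apply: bilin_mxP => u v.
transitivity ((u *m p1 *m gm *m (v *m p1)^T) 0 0); first by rewrite trmx_mul !mulmxA.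
rewrite hg !hp1 h mulmxBr mulmxBl outer -hg [RHS]mxE [X in _ = _ + X]mxE.
have -> : ((u *m e1) 0 0 *: e1^T *m v^T) 0 0 = eta1 (J u) * eta1 (J v).
  by rewrite -scalemxAl -trmx_mul [LHS]mxE [X in _ * X]mxE !he1.
by [].
Qed.

Lemma flat_unitary (u : V) : (forall u, u != 0 -> 0 < g u u) -> u *m gm = 0 -> u = 0.
Proof.
move=> h ug; apply/eqP; apply: contraT => u0.
have : J u != 0 by apply: contra u0 => /eqP e; apply/eqP/Jinj; rewrite e J0.
by move/h; rewrite -hg ug mul0mx mxE ltxx.
Qed.

Lemma flat_tri1 : (forall u, phi3 u = phi1 (phi2 u) - eta2 u *: xi1) ->
  p3 = p2 *m p1 - e2 *m x1.
Proof.
move=> h; apply: row_mxP => u; apply: Jinj.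
by rewrite hp3 h mulmxBr outer mulmxA JD JN JZ hp1 hp2 hx1 he2.
Qed.

Lemma flat_tri2 : (forall u, phi3 u = - phi2 (phi1 u) + eta1 u *: xi2) ->
  p3 = - (p1 *m p2) + e1 *m x2.
Proof.
move=> h; apply: row_mxP => u; apply: Jinj.
by rewrite hp3 h mulmxDr outer mulmxN mulmxA JD JN JZ hp2 hp1 hx2 he1.
Qed.

Lemma flat_tri3 : xi3 = phi1 xi2 -> x3 = x2 *m p1.
Proof. by move=> h; apply: Jinj; rewrite hp1 hx2 hx3. Qed.

Lemma flat_tri4 : xi3 = - phi2 xi1 -> x3 = - (x1 *m p2).
Proof. by move=> h; apply: Jinj; rewrite JN hp2 hx1 hx3. Qed.

Lemma flat_tri5 : (forall u, eta3 u = eta1 (phi2 u)) -> e3 = p2 *m e1.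
Proof.
move=> h; apply: row_mxP => u; rewrite [LHS]mx11_scalar [RHS]mx11_scalar; congr _%:M.
by rewrite he3 h mulmxA he1 hp2.
Qed.

Lemma flat_tri6 : (forall u, eta3 u = - eta2 (phi1 u)) -> e3 = - (p1 *m e2).
Proof.
move=> h; apply: row_mxP => u; rewrite [LHS]mx11_scalar [RHS]mx11_scalar; congr _%:M.
by rewrite he3 h mulmxN mulmxA [RHS]mxE he2 hp1.
Qed.

(* [j], [dp] and [dde] stand for the values of the Jacobian of [xi1], the
   derivative of [phi1] along [xi1] and the exterior derivative of [eta1]. *)
Lemma flat_normal (j dp dde : 'M[R]_d) (lie1 lie2 : V -> V) (deta : V -> R) :
  (forall u, lie1 u = J (u *m j)) -> (forall u, lie2 u = J (u *m p1 *m j - u *m dp)) ->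
  (forall u, deta u = (u *m dde *m x1^T) 0 0) ->
  (forall u, phi1 (phi1 (lie1 u)) - phi1 (lie2 u) + deta u *: xi1 = 0) ->
  (dp + j *m p1 - p1 *m j) *m p1 + (dde *m x1^T) *m x1 = 0.
Proof.
move=> h1 h2 h3 h; apply: row_mxP => u; apply: Jinj; rewrite mulmx0 J0 -(h u) h1 h2 h3.
rewrite -!hp1 -hx1 -JZ -JN -!JD; congr (J _); rewrite mulmxDr outer mulmxA [u *m (_ *m x1^T)]mulmxA.
congr (_ + _); rewrite -mulmxBl; congr (_ *m _).
by rewrite mulmxBr mulmxDr !mulmxA opprB [RHS]addrCA addrA.
Qed.

End PointAlgebra.

Section ThreeQuasiSasakian.
Variables (R : realType) (d : nat) (M : manifold R d).
Notation V := 'rV[R]_d.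
Variables (phi : 'I_3 -> M -> V -> V) (xi : 'I_3 -> vfield M) (eta : 'I_3 -> M -> V -> R).
Variable g : M -> V -> V -> R.
Hypothesis hq : forall a, quasi_sasakian (phi a) (xi a) (eta a) g.
Hypothesis ht : forall a b c, cyc a b c -> forall y,
   [/\ forall u, phi c y u = phi a y (phi b y u) - eta b y u *: xi a y /\
                 phi c y u = - phi b y (phi a y u) + eta a y u *: xi b y,
       xi c y = phi a y (xi b y) /\ xi c y = - phi b y (xi a y) &
       forall u, eta c y u = eta a y (phi b y u) /\
                 eta c y u = - eta b y (phi a y u)].

Lemma phi_tensor a : tensor11 (phi a).
Proof. by case: (hq a) => [[[]]]. Qed.
Lemma xi_smooth a : smooth_field setT (xi a).
Proof. by case: (hq a) => [[[]]]. Qed.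
Lemma eta_form a : one_form (eta a).
Proof. by case: (hq a) => [[[]]]. Qed.
Lemma g_metric : riemannian_metric g.
Proof. by case: (hq 0) => [[[]]]. Qed.
Lemma g_tensor : tensor02 g.
Proof. by case: g_metric. Qed.
Lemma phi_sq a y u : phi a y (phi a y u) = - u + eta a y u *: xi a y.
Proof. by case: (hq a) => [[]]. Qed.
Lemma eta_xi a y : eta a y (xi a y) = 1.
Proof. by case: (hq a) => [[]]. Qed.
Lemma g_phi a y u v : g y (phi a y u) (phi a y v) = g y u v - eta a y u * eta a y v.
Proof. by case: (hq a) => [[]]. Qed.

Lemma phi_xi a y : phi a y (xi a y) = 0.
Proof.
have [pl _] := phi_tensor a; have pZ := JZ (pl y); have p0 := J0 (pl y).
have h0 : phi a y (phi a y (xi a y)) = 0 by rewrite phi_sq eta_xi scale1r addNr.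
have h1 : phi a y (xi a y) = eta a y (phi a y (xi a y)) *: xi a y.
  by apply/eqP; have := phi_sq a y (phi a y (xi a y)); rewrite h0 p0 => /esym/eqP; rewrite addrC subr_eq0 eq_sym.
set t := eta a y _ in h1; rewrite h1; have : t * t = 0.
  have [el _] := eta_form a; have := h0; rewrite h1 pZ h1 scalerA => /(congr1 (eta a y)).
  have e0 : eta a y 0 = 0 by have := el y (-1) 0 0; rewrite scaler0 addr0 mulN1r addNr.
  have := el y (t * t) (xi a y) 0; rewrite addr0 e0 eta_xi addr0 /= mulr1.
  by move=> -> .
by move/eqP; rewrite mulf_eq0 orbb => /eqP ->; rewrite scale0r.
Qed.

Variable (rk : nat) (theta : 'I_3 -> M -> V -> V).
Hypothesis rk_gt0 : (0 < rk)%N.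
Hypothesis hrank : forall a, has_rank (eta a) rk.
Hypothesis htheta : forall c, is_theta (phi c) xi eta g (theta c).

Variable x : M.
Notation O := (dom_set x).
Notation der := (@sder R d O).
Notation P := (fun a => flatP x (phi_tensor a)).
Notation X := (fun a => flatX x (xi_smooth a)).
Notation E := (fun a => flatE x (eta_form a)).
Notation G := (flatW x g_tensor).

Section AtPoint.
Variables (a : V) (Oa : open_set_set O a).
Notation y := (chart_inv x a).
Notation J := (fun u => ext x u y).
Let xy : chart_dom x y. Proof. by case: (dom_setP Oa). Qed.
Let Jl : linear J := ext_linear xy.
Let Ji : injective J. Proof. by move=> u v; exact: ext_inj. Qed.
Notation fp := (fun b => map_mx (ev Oa) (P b)).
Notation fx := (fun b => map_mx (ev Oa) (X b)).
Notation fe := (fun b => map_mx (ev Oa) (E b)).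
Notation fg := (map_mx (ev Oa) G).
Let hp b u := flatPE (phi_tensor b) Oa u.
Let he b u := flatEE (eta_form b) Oa u.
Let hx b := flatXE (xi_smooth b) Oa.
Let hg u v := flatWE g_tensor Oa u v.

Lemma flatG_sym : fg^T = fg.
Proof. by case: g_metric => _ h _; exact: (flat_sym hg (h y)). Qed.

Lemma flatG_unit (u : V) : u *m fg = 0 -> u = 0.
Proof. by case: g_metric => _ _ h; exact: (flat_unitary Jl Ji hg (h y)). Qed.

Lemma flatP_sq b : fp b *m fp b = fe b *m fx b - 1%:M.
Proof. exact: (flat_sq Jl Ji (hp b) (he b) (hx b) (phi_sq b y)). Qed.

Lemma flatX_E b : fx b *m fe b = 1%:M.
Proof. exact: (flat_unit (he b) (hx b) (eta_xi b y)). Qed.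

Lemma flatPGP b : fp b *m fg *m (fp b)^T = fg - fe b *m (fe b)^T.
Proof. exact: (flat_compat (hp b) (he b) hg (g_phi b y)). Qed.

Lemma flat_tri b1 b2 b3 : cyc b1 b2 b3 ->
  [/\ fp b3 = fp b2 *m fp b1 - fe b2 *m fx b1,
      fp b3 = - (fp b1 *m fp b2) + fe b1 *m fx b2,
      fx b3 = fx b2 *m fp b1, fx b3 = - (fx b1 *m fp b2) &
      fe b3 = fp b2 *m fe b1 /\ fe b3 = - (fp b1 *m fe b2)].
Proof.
move=> h; have [h1 [h2 h3] h4] := ht h y; split; [| | | |split].
- exact: (flat_tri1 Jl Ji (hp b1) (hp b2) (hp b3) (he b2) (hx b1) (fun u => proj1 (h1 u))).
- exact: (flat_tri2 Jl Ji (hp b1) (hp b2) (hp b3) (he b1) (hx b2) (fun u => proj2 (h1 u))).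
- exact: (flat_tri3 Ji (hp b1) (hx b2) (hx b3) h2).
- exact: (flat_tri4 Jl Ji (hp b2) (hx b1) (hx b3) h3).
- exact: (flat_tri5 (hp b2) (he b1) (he b3) (fun u => proj1 (h4 u))).
- exact: (flat_tri6 (hp b1) (he b2) (he b3) (fun u => proj2 (h4 u))).
Qed.

(** Normality is applied to a coordinate field and xi_b; phi_b xi_b = 0 removes the two terms of the
    torsion in which phi_b acts on the second field. *)
Lemma flat_normality b :
  (map_mx (ev Oa) (dirmx der (X b) (P b)) + map_mx (ev Oa) (jac der (X b)) *m fp b
     - fp b *m map_mx (ev Oa) (jac der (X b))) *m fp b
  + (map_mx (ev Oa) (dd der (E b)) *m (fx b)^T) *m fx b = 0.
Proof.
apply: (flat_normal Jl Ji (hp b) (hx b) (lie1 := fun u => lie (ext x u) (xi b) y)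
  (lie2 := fun u => lie (fun z => phi b z (ext x u z)) (xi b) y)
  (deta := fun u => 2 * dform (eta b) y (ext x u y) (xi b y))).
- by move=> u; exact: (lie_ext_flat (xi_smooth b) u Oa).
- by move=> u; exact: (lie_phi_flat (phi_tensor b) (xi_smooth b) u Oa).
- by move=> u; rewrite -(hx b); exact: (flat_dform (eta_form b) Oa).
move=> u; have [_ hn _] := hq b.
have sX : smooth_field (chart_dom x) (xi b).
  by move=> p; apply: Coo_sub (xi_smooth b p) => _ [q [xq pq] <-]; exact: img_in.
have := hn _ _ _ (@chart_dom_open R d M x) (ext_smooth x u) sX y xy.
rewrite /nijenhuis !(@lie_zero R d M _ (fun z => phi b z (xi b z)) y (phi_xi b)).
by have [pl _] := phi_tensor b; rewrite (J0 (pl y)) addr0 subr0.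
Qed.
End AtPoint.

Lemma fundamental_tensor b : tensor02 (fundamental_form g (phi b)).
Proof. exact: tensor02_comp g_tensor (phi_tensor b). Qed.

Lemma Theta_tensor c : tensor02 (Theta g (theta c)).
Proof. by case: (htheta c) => tt _ _; exact: tensor02_comp g_tensor tt. Qed.

Lemma flat_fundamental b : G *m (P b)^T = flatW x (fundamental_tensor b).
Proof.
apply/matrixP => i j; apply: smf_ext => a Oa.
have : map_mx (ev Oa) (G *m (P b)^T) = map_mx (ev Oa) (flatW x (fundamental_tensor b)).
  apply: bilin_mxP => u v; rewrite (flatWE (fundamental_tensor b) Oa) map_mxM -map_trmx.
  rewrite mulmxA -mulmxA -trmx_mul (flatWE g_tensor Oa).
  by rewrite (flatPE (phi_tensor b) Oa).
by move/matrixP/(_ i j); rewrite [LHS]mxE [RHS]mxE.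
Qed.

Lemma flat_closed b a (Oa : open_set_set O a) i j l :
  ev Oa (der i ((G *m (P b)^T) j l)) + ev Oa (der j ((G *m (P b)^T) l i))
  + ev Oa (der l ((G *m (P b)^T) i j)) = 0.
Proof.
by rewrite flat_fundamental; have [_ _ hc] := hq b; exact: (flatW_closed (fundamental_tensor b) hc).
Qed.

(** The ring is that of smooth functions on the image of the chart of x, separated by evaluations at
    its points; k and T belong to this chart. *)
Lemma three_structure_flat : exists (k : smf O) (T : 'I_3 -> 'M[smf O]_d),
  (forall i, der i k = 0) /\ forall a (Oa : open_set_set O a),
  let f := fun n (A : 'M[smf O]_(n, d)) => map_mx (ev Oa) A in
  [/\ forall b, map_mx (ev Oa) (dd der (E b)) = map_mx (ev Oa) G *m (f _ (T b))^T,
      forall b, f _ (T b) *m f _ (T b) = ev Oa k *: (f _ (P b) *m f _ (T b)),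
      forall b c, f _ (X b) *m f _ (T c) = ev Oa k *: (f _ (X b) *m f _ (P c)) &
      forall b1 b2 b3 (v : V), cyc b1 b2 b3 -> v *m map_mx (ev Oa) (E b3) = 0 ->
        v *m f _ (T b3) = 0 -> v *m f _ (T b2) = 0].
Proof.
pose S := {a | open_set_set O a}.
pose f (s : S) : {rmorphism smf O -> R} := ev (svalP s).
have [k [T [h1 h2 h3 h4 h5]]] := @flat_structure (smf O) R d der S f (@sderD _ _ O)
  (@sderM _ _ O) (@sderC _ _ O)
  (fun k h => smf_ext (fun a Oa => etrans (h (exist (fun a => open_set_set O a) a Oa)) (esym (rmorph0 (ev Oa)))))
  P X E G (fun s => flatG_sym (svalP s)) (fun s => @flatG_unit _ (svalP s))
  (fun s => flatP_sq (svalP s)) (fun s => flatX_E (svalP s)) (fun s => flatPGP (svalP s))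
  (fun s => flat_normality (svalP s)) (fun s b => flat_closed b (svalP s))
  (fun s => flat_tri (svalP s)).
exists k, T; split=> // a Oa; pose s : S := exist (fun a => open_set_set O a) a Oa; split.
- exact: h2 s.
- exact: h3 s.
- exact: h4 s.
- exact: h5 s.
Qed.

Section Structure.
Variables (k : smf O) (T : 'I_3 -> 'M[smf O]_d).
Hypothesis hT : forall a (Oa : open_set_set O a),
  let f := fun n (A : 'M[smf O]_(n, d)) => map_mx (ev Oa) A in
  [/\ forall b, map_mx (ev Oa) (dd der (E b)) = map_mx (ev Oa) G *m (f _ (T b))^T,
      forall b, f _ (T b) *m f _ (T b) = ev Oa k *: (f _ (P b) *m f _ (T b)),
      forall b c, f _ (X b) *m f _ (T c) = ev Oa k *: (f _ (X b) *m f _ (P c)) &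
      forall b1 b2 b3 (v : V), cyc b1 b2 b3 -> v *m map_mx (ev Oa) (E b3) = 0 ->
        v *m f _ (T b3) = 0 -> v *m f _ (T b2) = 0].

Section AtPoint.
Variables (a : V) (Oa : open_set_set O a).
Notation y := (chart_inv x a).
Notation J := (fun u => ext x u y).
Let xy : chart_dom x y. Proof. by case: (dom_setP Oa). Qed.
Let Jl : linear J := ext_linear xy.
Let Ji : injective J. Proof. by move=> u v; exact: ext_inj. Qed.
Notation fp := (fun b => map_mx (ev Oa) (P b)).
Notation fx := (fun b => map_mx (ev Oa) (X b)).
Notation fe := (fun b => map_mx (ev Oa) (E b)).
Notation ft := (fun b => map_mx (ev Oa) (T b)).
Notation fg := (map_mx (ev Oa) G).
Notation fk := (ev Oa k).
Let hp b u := flatPE (phi_tensor b) Oa u.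
Let he b u := flatEE (eta_form b) Oa u.
Let hx b := flatXE (xi_smooth b) Oa.
Definition chart_metric := fun u v : V => g y (J u) (J v).
Notation gy := chart_metric.

Lemma chart_metric_scalar u : scalar (gy u).
Proof. by move=> c v w; rewrite /gy Jl; have [h _ _] := g_tensor; rewrite h. Qed.

Lemma chart_metric_sym u v : gy u v = gy v u.
Proof. by case: g_metric => _ h _; exact: h. Qed.

Lemma chart_metric_pos (u : V) : u != 0 -> 0 < gy u u.
Proof.
move=> u0; case: g_metric => _ _; apply.
by apply: contra u0 => /eqP e; apply/eqP/Ji; rewrite e (J0 Jl).
Qed.

Lemma flatX_P b : fx b *m fp b = 0.
Proof. by apply: Ji; rewrite /= hp hx phi_xi (J0 Jl). Qed.

Lemma chart_metric_P b u v :
  gy (u *m fp b) (v *m fp b) = gy u v - (u *m fe b) 0 0 * (v *m fe b) 0 0.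
Proof. by rewrite /gy !hp g_phi !he. Qed.

Lemma dform_T b u v : 2 * dform (eta b) y (J u) (J v) = gy u (v *m ft b).
Proof.
have [h _ _ _] := hT Oa; rewrite (flat_dform (eta_form b) Oa) h /gy.
by rewrite -(flatWE g_tensor Oa) trmx_mul !mulmxA.
Qed.

Lemma chart_metric_T b u v : gy u (v *m ft b) = - gy v (u *m ft b).
Proof.
have e u' v' : gy u' (v' *m ft b) = (u' *m map_mx (ev Oa) (dd der (E b)) *m v'^T) 0 0.
  exact: etrans (esym (dform_T b u' v')) (flat_dform (eta_form b) Oa u' v').
rewrite (e u v) (e v u).
transitivity ((u *m map_mx (ev Oa) (dd der (E b)) *m v^T)^T 0 0); first by rewrite [RHS]mxE.
rewrite !trmx_mul trmxK map_trmx dd_tr map_mxN mulNmx mulmxN mulmxA.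
by rewrite [LHS]mxE.
Qed.

Let TT b : ft b *m ft b = fk *: (fp b *m ft b). Proof. by have [_ h _ _] := hT Oa. Qed.
Let XT b c : fx b *m ft c = fk *: (fx b *m fp c). Proof. by have [_ _ h _] := hT Oa. Qed.
Let rot b1 b2 b3 (v : V) : cyc b1 b2 b3 -> v *m fe b3 = 0 -> v *m ft b3 = 0 -> v *m ft b2 = 0.
Proof. by have [_ _ _ h] := hT Oa; exact: h. Qed.

Lemma ext_surj u : exists v, J v = u.
Proof. by exists (components x (fun=> u) y); exact: ext_components. Qed.

Lemma dform_wpow_neq0 b : exists v, wpow (of2 (dform (eta b) y)) rk v != 0.
Proof.
have [[v h] _] := hrank b y.
have [//|n] := pselect (exists v, wpow (of2 (dform (eta b) y)) rk v != 0).
case/eqP: h; rewrite /wedge big1 ?mulr0 // => s _.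
have -> : wpow (of2 (dform (eta b) y)) rk (fun j => v (s (rshift 1 j))) = 0.
  by apply/eqP; apply: contraT => h; case: n; exists (fun j => v (s (rshift 1 j))).
by rewrite !mulr0.
Qed.

(** At a zero of k every T_a vanishes by [T_eq0], hence so do d eta_0 and its power of order rk > 0,
    against the rank hypothesis at that point. *)
Lemma flat_k_neq0 : fk != 0.
Proof.
apply/eqP => k0; have t0 := T_eq0 chart_metric_scalar chart_metric_pos TT chart_metric_T _ k0.
have w0 : dform (eta 0) y = fun _ _ => 0.
  apply: funext => u; apply: funext => v.
  have [[u' <-] [v' <-]] := (ext_surj u, ext_surj v).
  have := dform_T 0 u' v'; rewrite t0 mulmx0 (g0r chart_metric_scalar) => /eqP.
  by rewrite mulf_eq0 pnatr_eq0 /= => /eqP.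
have [v] := dform_wpow_neq0 0; rewrite w0 (wpow_rank_eq0 (A := (0 : 'M[R]_d))) ?eqxx //.
- by move=> ? ? ? ?; rewrite mulr0 addr0.
- by move=> ? ? ? ?; rewrite mulr0 addr0.
by rewrite mxrank0 muln_gt0 rk_gt0.
Qed.

Let tri b1 b2 b3 (h : cyc b1 b2 b3) := flat_tri Oa h.
Let PP := flatP_sq Oa.
Let XE := flatX_E Oa.

(** The definition of E^(4m) provides one index, and [ker_T] extends it to every c. *)
Lemma distE4m_ker c u : distE4m eta y (J u) -> u *m fe c = 0 /\ u *m ft c = 0.
Proof.
move=> [hH [b hb]]; have uE b' : u *m fe b' = 0 by apply: E00; rewrite he; exact: hH.
have ut : u *m ft b = 0.
  apply: (g_nondeg chart_metric_pos) => v; rewrite -[LHS]opprK -chart_metric_T -(dform_T b u v).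
  by rewrite hb mulr0 oppr0.
split; first exact: uE.
exact: (ker_T chart_metric_scalar XE flatX_P chart_metric_P tri XT chart_metric_T rot flat_k_neq0 c (uE b) ut).
Qed.

Lemma ext_sum (c : 'I_3 -> R) (u : 'I_3 -> V) : J (\sum_b c b *: u b) = \sum_b c b *: J (u b).
Proof.
rewrite /= (big_morph J (JD Jl) (J0 Jl)); apply: eq_bigr => b _; exact: JZ.
Qed.

Notation r c := (proj_ker (fp c) (ft c) (fe c) (fx c) fk).

Lemma distE4m_proj c v : distE4m eta y (J (v *m r c)).
Proof.
split=> [b|].
  rewrite -he (proj_ker_horizontal chart_metric_scalar chart_metric_sym chart_metric_pos PP XE
    flatX_P chart_metric_P tri TT XT chart_metric_T flat_k_neq0).
  exact: mx00.
exists c => u; have [u' <-] := ext_surj u.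
have := dform_T c (v *m r c) u'; rewrite chart_metric_T -mulmxA.
rewrite (proj_kerT chart_metric_scalar chart_metric_sym chart_metric_pos (PP c) (XE c)
  (flatX_P c) _ (chart_metric_P c) (TT c)) ?flat_k_neq0 //.
- by rewrite mulmx0 (g0r chart_metric_scalar) oppr0 => /eqP; rewrite mulf_eq0 pnatr_eq0 => /eqP.
- exact: P_E0 PP XE flatX_P c.
- by rewrite XT flatX_P scaler0.
exact: chart_metric_T.
Qed.

(** Subtracting the vertical components of v - v r leaves a horizontal w. A vector of E^(4m) is
    orthogonal to v - v r and to every xi_b, hence to w. *)
Lemma distE4l3_proj c v : distE4l3 xi eta g y (J (v - v *m r c)).
Proof.
set f := v - _; pose w := f - \sum_b (f *m fe b) 0 0 *: fx b.
exists (J w), (fun b => (f *m fe b) 0 0); split; last first.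
  under eq_bigr => b _ do rewrite -hx.
  by rewrite -ext_sum -(JD Jl) subrK.
have wE b : w *m fe b = 0.
  rewrite /w mulmxBl mulmx_suml (bigD1 b) //= big1 => [|b' /negPf b'b].
    by rewrite -scalemxAl XE addr0 scalemx1 -mx11_scalar subrr.
  by rewrite -scalemxAl (XE_all PP XE flatX_P tri) b'b raddf0 scaler0.
split=> [b|u hu]; first by rewrite -he wE; exact: mx00.
have [u' e] := ext_surj u; rewrite -e in hu *.
have uk b := distE4m_ker b hu; suff h : gy u' w = 0 by exact: etrans (chart_metric_sym w u') h.
rewrite /w (gDr chart_metric_scalar) (gNr chart_metric_scalar).
rewrite (proj_ker_orthogonal chart_metric_scalar chart_metric_sym chart_metric_pos PP XE flatX_P
  chart_metric_P TT chart_metric_T flat_k_neq0 v (uk c).1 (uk c).2) add0r.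
apply/eqP; rewrite oppr_eq0; apply/eqP; elim/big_rec: _ => [|b s _ IH].
  exact: g0r chart_metric_scalar _.
rewrite (gDr chart_metric_scalar) (gZr chart_metric_scalar) IH addr0.
by rewrite (g_xi chart_metric_scalar (XE b) (flatX_P b) (chart_metric_P b)) (uk b).1 mx00 mulr0.
Qed.

(** [theta] is prescribed only on the two distributions; v = (v - v r) + v r splits v along them. *)
Lemma Theta_chart c u v : Theta g (theta c) y (J u) (J v) = gy u (v *m r c *m fp c).
Proof.
have [[tl _] h1 h2] := htheta c; rewrite /Theta /gy hp -h1; last exact: distE4m_proj.
apply: (congr1 (g y (J u))); have e : J v = J (v - v *m r c) + J (v *m r c).
  by rewrite -(JD Jl) subrK.
apply: etrans (congr1 (theta c y) e) (etrans (JD (tl y) _ _) _).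
by apply: etrans (congr1 (+%R^~ _) (h2 _ _ (distE4l3_proj c v))) _; exact: add0r.
Qed.

Lemma Theta_chart_fundamental c u v : fk * Theta g (theta c) y (J u) (J v) =
  fk * gy u (v *m fp c) - gy u (v *m ft c).
Proof.
apply: etrans (congr1 ( *%R fk) (Theta_chart c u v)) _.
rewrite (proj_ker_P chart_metric_scalar chart_metric_sym PP XE flatX_P chart_metric_P XT chart_metric_T).
rewrite (gDr chart_metric_scalar) (gNr chart_metric_scalar) (gZr chart_metric_scalar) mulrBr.
by rewrite mulrA mulfV ?flat_k_neq0 // mul1r.
Qed.

Lemma Theta_chart_skew c u v :
  Theta g (theta c) y (J u) (J v) = - Theta g (theta c) y (J v) (J u).
Proof.
apply: (mulfI flat_k_neq0).
apply: etrans (Theta_chart_fundamental c u v) _; apply: esym.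
apply: etrans (mulrN _ _) _; apply: etrans (congr1 -%R (Theta_chart_fundamental c v u)) _.
rewrite (chart_metric_T c u v); have PE := P_E0 PP XE flatX_P.
rewrite (g_skewP chart_metric_scalar chart_metric_sym (PP c) (XE c) (flatX_P c) (PE c) (chart_metric_P c) u v).
by rewrite opprB opprK mulrN addrC.
Qed.
End AtPoint.

Hypothesis hk : forall i, der i k = 0.

Lemma flat_Theta c : k *: flatW x (Theta_tensor c) = k *: (G *m (P c)^T) - dd der (E c).
Proof.
apply/matrixP => i j; apply: smf_ext => a Oa.
suff : map_mx (ev Oa) (k *: flatW x (Theta_tensor c)) =
    map_mx (ev Oa) (k *: (G *m (P c)^T) - dd der (E c)).
  by move/matrixP/(_ i j); rewrite [LHS]mxE [RHS]mxE.
apply: bilin_mxP => u v; rewrite map_mxB !map_mxZ map_mxM -map_trmx.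
rewrite mulmxBr mulmxBl -!scalemxAr -!scalemxAl [LHS]mxE [RHS]mxE [X in _ = X + _]mxE [X in _ = _ + X]mxE.
rewrite (flatWE (Theta_tensor c) Oa) -(flat_dform (eta_form c) Oa).
rewrite mulmxA -[_ *m _^T *m v^T]mulmxA -trmx_mul (flatWE g_tensor Oa).
apply: etrans (Theta_chart_fundamental Oa c u v) _.
by congr (_ - _); apply: esym; exact: (dform_T Oa c u v).
Qed.

(** k Theta_c is closed; as dk = 0, the factor k comes out of the derivatives and is cancelled at
    the point, where it is nonzero. *)
Lemma flat_Theta_cyc c a (Oa : open_set_set O a) i j l :
  ev Oa (der i (flatW x (Theta_tensor c) j l)) + ev Oa (der j (flatW x (Theta_tensor c) l i))
  + ev Oa (der l (flatW x (Theta_tensor c) i j)) = 0.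
Proof.
have cP : closed_mx der (G *m (P c)^T).
  move=> i' j' l'; apply: smf_ext => b Ob.
  have := flat_closed c Ob i' j' l'; rewrite -!rmorphD => h.
  exact: etrans h (esym (rmorph0 (ev Ob))).
have cE := dd_closed (@sderD _ _ O) (@sderC _ _ O) (E c).
have h := closed_mx_scale (@sderD _ _ O) (@sderM _ _ O) hk (flat_Theta c) cP cE i j l.
have e i' j' l' : ev Oa (der i' ((k *: flatW x (Theta_tensor c)) j' l')) =
    ev Oa k * ev Oa (der i' (flatW x (Theta_tensor c) j' l')).
  by rewrite [in LHS]mxE sderM hk mul0r add0r rmorphM.
have z (A : smf O) (B C : smf O) (f p q t : R) : A + B + C = 0 -> f != 0 ->
    ev Oa A = f * p -> ev Oa B = f * q -> ev Oa C = f * t -> p + q + t = 0.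
  move=> /(congr1 (ev Oa)); rewrite !rmorphD rmorph0 => H f0 hA hB hC.
  by apply: (mulfI f0); rewrite !mulrDr mulr0 -hA -hB -hC.
exact: (z _ _ _ _ _ _ _ h (flat_k_neq0 Oa) (e i j l) (e j l i) (e l i j)).
Qed.

(** * The centre of the chart, where coordinates are those of the tangent space *)

Section Center.
Variables (mm : nat) (b c : 'I_3).
Hypothesis dE : d = (1 + rk * 2 + mm * 2)%N.
Let Ox : open_set_set O (chart x x).
Proof. by apply: img_in; exact: chart_dom_center. Qed.
Notation fp := (fun b => map_mx (ev Ox) (P b)).
Notation fx := (fun b => map_mx (ev Ox) (X b)).
Notation fe := (fun b => map_mx (ev Ox) (E b)).
Notation ft := (fun b => map_mx (ev Ox) (T b)).
Notation fk := (ev Ox k).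
Notation gy := (chart_metric (chart x x)).
Notation r := (proj_ker (fp c) (ft c) (fe c) (fx c) fk).

Let cx : chart_inv x (chart x x) = x.
Proof. by rewrite chartK //; exact: chart_dom_center. Qed.
Let PP := flatP_sq Ox.
Let XE := flatX_E Ox.
Let XP := flatX_P Ox.
Let PE := P_E0 PP XE XP.
Let gPP := chart_metric_P Ox.
Let gT := chart_metric_T Ox.
Let gl := chart_metric_scalar Ox.
Let gs := chart_metric_sym (chart x x).
Let gp := chart_metric_pos Ox.
Let k0 := flat_k_neq0 Ox.
Let TT a : ft a *m ft a = fk *: (fp a *m ft a). Proof. by have [_ h _ _] := hT Ox. Qed.
Let XT a a' : fx a *m ft a' = fk *: (fx a *m fp a'). Proof. by have [_ _ h _] := hT Ox. Qed.
Let XTc : fx c *m ft c = 0. Proof. by rewrite XT XP scaler0. Qed.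
Let rot b1 b2 b3 (v : V) : cyc b1 b2 b3 -> v *m fe b3 = 0 -> v *m ft b3 = 0 -> v *m ft b2 = 0.
Proof. by have [_ _ _ h] := hT Ox; exact: h. Qed.
Let tri b1 b2 b3 (h : cyc b1 b2 b3) := flat_tri Ox h.

Lemma dform_center a u v : dform (eta a) x u v = 2^-1 * gy u (v *m ft a).
Proof.
have := dform_T Ox a u v; rewrite /= cx !ext_self => <-.
by rewrite mulrA mulVf ?mul1r // pnatr_eq0.
Qed.

Lemma Theta_center u v : Theta g (theta c) x u v = gy u (v *m r *m fp c).
Proof. by have := Theta_chart Ox c u v; rewrite /= cx !ext_self. Qed.

Lemma rank_center : \rank (proj_im (fp c) (ft c) fk) = (rk * 2)%N.
Proof.
apply/eqP; rewrite eqn_leq; apply/andP; split.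
  apply: (rank_proj_im_le gl gs gp (PP c) (XE c) (XP c) (PE c) (gPP c) (TT c) XTc (gT c) k0
    (dform_center c)).
  by have [] := hrank c x.
have [v] := dform_wpow_neq0 (chart x x) c; rewrite cx.
exact: (rank_proj_im_ge gl gs gp (PP c) (XE c) (XP c) (PE c) (gPP c) (TT c) XTc (gT c) k0
    (dform_center c)).
Qed.

Lemma Theta_pow_eq0 v : wpow (of2 (Theta g (theta c) x)) mm.+1 v = 0.
Proof.
exact: (th_pow_eq0 gl gs gp (PP c) (XE c) (XP c) (PE c) (gPP c) (TT c) XTc (gT c) k0 dE
  rank_center Theta_center).
Qed.

(** For b different from c, [ker_T] puts the image of the projection for c in the kernel of d eta_b,
    and xi_b is killed both by that projection and by d eta_b. *)
Lemma volume_center : exists v, wedge (of1 (eta b x))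
  (wedge (wpow (of2 (dform (eta b) x)) rk) (wpow (of2 (Theta g (theta c) x)) mm)) v != 0.
Proof.
have -> : eta b x = fun u => (u *m fe b) 0 0.
  by apply: funext => u; rewrite (flatEE (eta_form b) Ox) cx ext_self.
have [v0] := dform_wpow_neq0 (chart x x) b; rewrite cx => v0n.
have rE : r *m fe b = 0.
  apply: row_mxP => v; rewrite mulmx0 mulmxA.
  exact: (proj_ker_horizontal gl gs gp PP XE XP gPP tri TT XT gT k0).
apply: (volume_neq0 gl gs gp (PP c) (XE c) (XP c) (PE c) (gPP c) (TT c) XTc (gT c) k0 dE
  rank_center Theta_center (XE b) _ _ _ _ _ rE v0n).
- exact: (X_proj_ker PP XT k0).
- move=> u a v w; rewrite !dform_center mulmxDl -scalemxAl gl mulrDr; congr (_ + _); exact: mulrCA.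
- by move=> u v; rewrite !dform_center gT mulrN.
- by move=> u; rewrite dform_center XT XP scaler0 (g0r gl) mulr0.
move=> u v vr; rewrite dform_center.
have [vE vT] := proj_ker_sub gl gs gp (PP c) (XE c) (XP c) (PE c) (gPP c) (TT c) XTc (gT c) k0 vr.
by rewrite (ker_T gl XE XP gPP tri XT gT rot k0 b vE vT) (g0r gl) mulr0.
Qed.

Lemma Theta_center_skew u v : Theta g (theta c) x u v = - Theta g (theta c) x v u.
Proof. by have := Theta_chart_skew Ox c u v; rewrite /= cx !ext_self. Qed.
End Center.
End Structure.

End ThreeQuasiSasakian.

(* The translation i |-> i + a of Z/3 has order 3, hence is even. *)
Lemma even_translation (a : 'I_3) : ~~ odd_perm (perm (addIr a)).
Proof.
set s := perm _; have s3 : (s * s * s)%g = 1%g.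
  by apply/permP => i; rewrite !permM !permE /=; apply/eqP;
    case: i => [[|[|[|//]]] hi]; case: (a) => [[|[|[|//]]] ha].
have := congr1 (@odd_perm _) s3; rewrite !odd_permM odd_perm1.
by case: (odd_perm s).
Qed.

Lemma cyc_relations (R : realType) (n : nat) (M : manifold R (4 * n + 3))
    (phi : 'I_3 -> M -> 'rV[R]_(4 * n + 3) -> 'rV[R]_(4 * n + 3))
    (xi : 'I_3 -> vfield M) (eta : 'I_3 -> M -> 'rV[R]_(4 * n + 3) -> R)
    (g : M -> 'rV[R]_(4 * n + 3) -> 'rV[R]_(4 * n + 3) -> R) :
  three_quasi_sasakian phi xi eta g -> forall a b c, cyc a b c -> forall y,
   [/\ forall u, phi c y u = phi a y (phi b y u) - eta b y u *: xi a y /\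
                 phi c y u = - phi b y (phi a y u) + eta a y u *: xi b y,
       xi c y = phi a y (xi b y) /\ xi c y = - phi b y (xi a y) &
       forall u, eta c y u = eta a y (phi b y u) /\
                 eta c y u = - eta b y (phi a y u)].
Proof.
move=> [_ h] a b c /andP[/eqP-> /eqP->] y.
(* The translation i -> i + a sends 0, 1, 2 to a, a + 1, a + 2. *)
have := h _ (even_translation a) y; rewrite !permE add0r.
by rewrite (addrC 1) (addrC 2%:R).
Qed.

Theorem corollary5p9 (R : realType) (n l m : nat) (M : manifold R (4 * n + 3))
    (phi : 'I_3 -> M -> 'rV[R]_(4 * n + 3) -> 'rV[R]_(4 * n + 3))
    (xi : 'I_3 -> vfield M) (eta : 'I_3 -> M -> 'rV[R]_(4 * n + 3) -> R)
    (g : M -> 'rV[R]_(4 * n + 3) -> 'rV[R]_(4 * n + 3) -> R)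
    (theta : 'I_3 -> M -> 'rV[R]_(4 * n + 3) -> 'rV[R]_(4 * n + 3))
    (hM : three_quasi_sasakian phi xi eta g)
    (hl : (l <= n)%N) (hm : m = (n - l)%N)
    (hrank : forall a : 'I_3, has_rank (eta a) (2 * l + 1))
    (htheta : forall c : 'I_3, is_theta (phi c) xi eta g (theta c)) :
  forall b c : 'I_3,
    contact_symplectic_pair (eta b) (Theta g (theta c)) (2 * l + 1) (2 * m).
Proof.
move=> b c; have [hq _] := hM; have ht := cyc_relations hM.
have r0 : (0 < 2 * l + 1)%N by lia.
(* The number 2l + 1 is the p for which the rank 4l + 3 is 2p + 1; the remaining 4m dimensions are
   those of E^(4m). *)
have dE : (4 * n + 3 = 1 + (2 * l + 1) * 2 + 2 * m * 2)%N by lia.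
have sk x u v : Theta g (theta c) x u v = - Theta g (theta c) x v u.
  have [k [T [_ hT]]] := three_structure_flat hq ht x.
  exact: (Theta_center_skew ht r0 hrank htheta hT c u v).
split.
- by lia.
- exact: eta_form hq b.
- split.
    split; first exact: (Theta_tensor hq htheta c).
    move=> x u; have := sk x u u => /eqP.
    by rewrite -addr_eq0 -mulr2n mulrn_eq0 => /eqP.
  apply: (closed_form_flat (hw := Theta_tensor hq htheta c)) => // x Ox i j l'.
  have [k [T [hk hT]]] := three_structure_flat hq ht x.
  exact: (flat_Theta_cyc ht r0 hrank htheta hT hk).
- move=> x; have [k [T [_ hT]]] := three_structure_flat hq ht x.
  exact: (volume_center ht r0 hrank htheta hT).
move=> x; split; first by have [] := hrank b x.
have [k [T [_ hT]]] := three_structure_flat hq ht x => v.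
exact: (Theta_pow_eq0 ht r0 hrank htheta hT).
Qed.
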